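(* There is a polynomial time algorithm with the following property. The input is $W \in \mathbb{Q}^{m \times n}$, $w \in \mathbb{Q}^m$, and $p \in \{0,1,\dots,n\}$. Let $$\mathcal{A} := \{x \in \mathbb{R}^n : Wx = w\}, \qquad \mathcal{S} := \mathcal{A} \cap (\mathbb{Z}^p \times \mathbb{R}^{n-p}).$$ The algorithm checks whether $\mathcal{S}$ is empty or not. Let $A \in \mathbb{Q}^{m \times p}$ and $B \in \mathbb{Q}^{m \times (n-p)}$ be such that $W = \begin{bmatrix} A & B \end{bmatrix}$, and let $n' := n - \operatorname{rank}(W)$ and $p' := p - \operatorname{rank}(W) + \operatorname{rank}(B)$. If $\mathcal{S}$ is nonempty, the algorithm finds a map $\tau : \mathbb{R}^{n'} \to \mathbb{R}^n$ of the form $\tau(x') = \bar x + Mx'$ with $\bar x \in \mathbb{Z}^p \times \mathbb{Q}^{n-p}$ and $M \in \mathbb{Q}^{n \times n'}$ of full rank, such that $$\mathcal{A} = \tau(\mathbb{R}^{n'}), \qquad \mathcal{S} = \tau(\mathbb{Z}^{p'} \times \mathbb{R}^{n'-p'}).$$ Furthermore, if $\mathcal{S}$ is nonempty and an equality of the form $d^{\mathsf T} x = \beta$ with $d \neq 0$ and $d_{p+1} = \cdots = d_n = 0$ is valid for $\mathcal{A}$ (i.e., holds for every $x \in \mathcal{A}$), then $p' \le p-1$.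
   Context: Polynomial time means polynomial in the size (number of bits of the standard binary encoding) of the rational input data. A matrix with zero columns has rank $0$. *)

(* Defs.v *)
From mathcomp Require Import all_boot all_order all_algebra.
From mathcomp Require Import classical_sets reals.

Set Implicit Arguments.
Unset Strict Implicit.
Unset Printing Implicit Defensive.

Import Order.TTheory GRing.Theory Num.Theory.
Local Open Scope ring_scope.

(** * Polynomial time

    The model of computation is the random access machine over integers with
    indirect addressing and logarithmic (bit) cost, programmed in structured
    form.  Every operation is charged the bit sizes of the values and of the
    addresses it handles, so that polynomial time on this machine is polynomial
    time on a Turing machine. *)

(* 1 (sign) + the least k such that |z| + 1 <= 2 ^ k *)
Definition bits (z : int) : nat := (up_log 2 `|z|.+1).+1.

Definition bits_seq (l : seq int) : nat := \sum_(z <- l) bits z.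

(* [s a i] is cell [i] of array [a].  A program names finitely many arrays, but
   cell indices are computed at run time. *)
Definition state := nat -> int -> int.

Definition update (s : state) (a : nat) (i v : int) : state :=
  fun b j => if (b == a) && (j == i) then v else s b j.

Inductive binop := Add | Sub | Mul | Div | Leq.

(* [Div] is Euclidean division, with value 0 when the divisor is 0. *)
Definition eval_op (o : binop) (x y : int) : int :=
  match o with
  | Add => x + y
  | Sub => x - y
  | Mul => x * y
  | Div => (x %/ y)%Z
  | Leq => if x <= y then 1 else 0
  end.

Inductive expr :=
  | Const of int
  | Get of nat & expr
  | Bin of binop & expr & expr.

Fixpoint eval (s : state) (e : expr) : int :=
  match e with
  | Const z => z
  | Get a i => s a (eval s i)
  | Bin o e1 e2 => eval_op o (eval s e1) (eval s e2)
  end.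

(* The product charged for a binary operation is, up to a constant factor, the
   number of bit operations of schoolbook multiplication and division. *)
Fixpoint cost (s : state) (e : expr) : nat :=
  match e with
  | Const z => bits z
  | Get a i => cost s i + bits (eval s i) + bits (eval s e)
  | Bin o e1 e2 => cost s e1 + cost s e2 + bits (eval s e1) * bits (eval s e2)
  end%N.

Inductive cmd :=
  | Skip
  | Put of nat & expr & expr
  | Then of cmd & cmd
  | If of expr & cmd & cmd
  | While of expr & cmd.

(* [exec c s t s']: started in state [s], program [c] halts after time [t] in
   state [s'].  In tests, an expression holds when its value is nonzero. *)
Inductive exec : cmd -> state -> nat -> state -> Prop :=
  | ExecSkip s : exec Skip s 1 s
  | ExecPut s a i e :
      exec (Put a i e) s
        (cost s i + cost s e + bits (eval s i) + bits (eval s e)).+1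
        (update s a (eval s i) (eval s e))
  | ExecThen c1 c2 s1 s2 s3 t1 t2 :
      exec c1 s1 t1 s2 -> exec c2 s2 t2 s3 ->
      exec (Then c1 c2) s1 (t1 + t2).+1 s3
  | ExecIfTrue e c1 c2 s t s' :
      eval s e != 0 -> exec c1 s t s' ->
      exec (If e c1 c2) s (cost s e + t).+1 s'
  | ExecIfFalse e c1 c2 s t s' :
      eval s e == 0 -> exec c2 s t s' ->
      exec (If e c1 c2) s (cost s e + t).+1 s'
  | ExecWhileTrue e c s1 s2 s3 t1 t2 :
      eval s1 e != 0 -> exec c s1 t1 s2 -> exec (While e c) s2 t2 s3 ->
      exec (While e c) s1 (cost s1 e + t1 + t2).+1 s3
  | ExecWhileFalse e c s :
      eval s e == 0 -> exec (While e c) s (cost s e).+1 s.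

Lemma exec_det c s t1 s1 t2 s2 :
  exec c s t1 s1 -> exec c s t2 s2 -> t1 = t2 /\ s1 = s2.
Proof.
move=> H; move: t2 s2.
induction H; move=> u v K; inversion K; subst=> //;
  repeat match goal with
  | A : is_true (?b != 0), B : is_true (?b == 0) |- _ => by rewrite B in A
  | IH : forall t s, exec ?c ?s0 t s -> _, L : exec ?c ?s0 _ _ |- _ =>
      destruct (IH _ _ L); clear L; subst
  end; by [].
Qed.

(* A list is stored in an array as its length followed by its elements.  The
   input is in array 0, all other cells being 0; the output is in array 1. *)
Definition initial (l : seq int) : state := fun a i =>
  match a, i with
  | 0%N, Posz k => nth 0 (Posz (size l) :: l) k
  | _, _ => 0
  end.

Definition outputs (s : state) (l : seq int) : Prop :=
  s 1%N 0 = Posz (size l) /\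
  forall k, (k < size l)%N -> s 1%N (Posz k.+1) = nth 0 l k.

(* Some program, given the encoding of any [x], halts within time polynomial in
   [sz x] with an output that is correct for [x]. *)
Definition poly_time (I : Type) (code : I -> seq int) (sz : I -> nat)
    (correct : I -> seq int -> Prop) : Prop :=
  exists (c : cmd) (k : nat), forall x : I,
    exists (t : nat) (s : state) (out : seq int),
      [/\ exec c (initial (code x)) t s,
          (t <= k * sz x ^ k + k)%N,
          outputs s out
        & correct x out].

(** * Rational data *)

Definition code_rat (q : rat) : seq int := [:: numq q; denq q].

(* dimensions, then the entries row by row *)
Definition code_mx m n (A : 'M[rat]_(m, n)) : seq int :=
  Posz m :: Posz n ::
  flatten [seq flatten [seq code_rat (A i j) | j <- enum 'I_n] | i <- enum 'I_m].

Record instance := Instance {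
  nrows : nat;
  ncols : nat;
  Wmx : 'M[rat]_(nrows, ncols);
  wvec : 'cV[rat]_nrows;
  nints : 'I_ncols.+1
}.

Definition code_instance (x : instance) : seq int :=
  code_mx (Wmx x) ++ code_mx (wvec x) ++ [:: Posz (nints x)].

(* The summand [ncols x] matters only for matrices without rows: as soon as
   there is a row, its entries contribute at least that many bits. *)
Definition size_instance (x : instance) : nat :=
  (ncols x + bits_seq (code_instance x))%N.

(** * Mixed integer linear systems *)

(* Z^p x K^(n - p) *)
Definition mixed (K : archiRealFieldType) (n p : nat) : set 'cV[K]_n :=
  [set x | forall i : 'I_n, (i < p)%N -> x i 0 \is a Num.int].
Arguments mixed : clear implicits.

Definition affine_space (R : realType) m n (W : 'M[rat]_(m, n))
    (w : 'cV[rat]_m) : set 'cV[R]_n :=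
  [set x | map_mx ratr W *m x = map_mx ratr w].

(* the block B of W = [A B], where A consists of the first p columns of W *)
Definition last_cols m n (p : 'I_n.+1) (W : 'M[rat]_(m, n)) :
    'M[rat]_(m, n - p) :=
  rsubmx (castmx (erefl m, esym (subnKC (leq_ord p))) W).

(* As rank W <= p + rank B, the truncated subtraction is exact. *)
Definition reduced_nints m n (p : 'I_n.+1) (W : 'M[rat]_(m, n)) : nat :=
  (p + \rank (last_cols p W) - \rank W)%N.

Definition full_rank (F : fieldType) m n (A : 'M[F]_(m, n)) : Prop :=
  \rank A = minn m n.

Definition affine_map (R : realType) n k (xbar : 'cV[rat]_n)
    (M : 'M[rat]_(n, k)) (y : 'cV[R]_k) : 'cV[R]_n :=
  map_mx ratr xbar + map_mx ratr M *m y.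

(* Main.v *)
(** Homogenize the system to [-w | W] (1, x) = 0 and clear denominators.  Integer
    pivoting, in which every step divides exactly by the previous pivot, turns
    the matrix into T = D E^-1 [-w | W], where every column of E is a unit vector
    or a column of the input; by Cramer's rule D and the entries of T are minors,
    hence of polynomial size.  Continuous columns are eliminated first, so the
    rows with an integer pivot involve integer variables only, and they say that
    linear combinations of the free integer variables vanish modulo D.  The
    vectors satisfying these congruences form a lattice containing D Z^N, so the
    Euclidean algorithm computes a triangular basis of it with all entries reduced
    modulo D.  In this basis, the system is feasible iff the leading entry at the
    homogenizing coordinate is 1; that basis vector then yields xbar, and the later
    ones yield the columns of M. *)

Require Import Defs.
From mathcomp Require Import all_boot all_order all_algebra.
From mathcomp Require Import perm.
From mathcomp Require Import boolp classical_sets reals.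
From mathcomp Require Import zify ring lra.

Set Implicit Arguments.
Unset Strict Implicit.
Unset Printing Implicit Defensive.
Import Order.TTheory GRing.Theory Num.Theory.
Local Open Scope ring_scope.

(** * Running time *)

(** A step is charged by the bit sizes it handles, so counting steps is not enough: numbers must
    stay short throughout. One parameter [b] therefore bounds both the stored values and the turns
    of each loop; for a fixed program the time bound is then a polynomial in [b], by recursion on
    the syntax. Values inside an expression need no separate care, since an expression of fixed size
    lengthens its operands by a constant factor only. Eliminating from the last column down has a
    second effect: the final table displays the rank of every block of last columns, hence of [W]
    and of [B] together. So p' is the number of free integer columns, and the first p' columns of M
    are those that take integer parameters. In the lattice the residues of the rows come before the
    variables. A basis vector that starts at coordinate [m] or later thus has residues 0, so its
    free integer variables force integral pivot variables. Conversely, integral points have integral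
    parameters because the leading entry of a basis vector divides that coordinate of every lattice
    vector vanishing before it. *)

Definition small (b : nat) (z : int) : bool := (`|z| < 2 ^ b)%N.

Definition bounded (b : nat) (s : state) : Prop := forall a i, small b (s a i).

Lemma bits_small (b : nat) (z : int) : small b z -> (bits z <= b.+1)%N.
Proof. by rewrite /small /bits ltnS => h; apply: up_log_min. Qed.

(** Bit length in units of [b]. A cell holds at most [b] bits, so a [Get] counts once however long
    its address is; the [.+1] of [Bin] absorbs a carry, as [b] is positive. *)
Fixpoint ewidth (e : expr) : nat :=
  match e with
  | Const z => bits z
  | Get _ _ => 1
  | Bin _ e1 e2 => (ewidth e1 + ewidth e2).+1
  end.

(** Coefficient of [b ^ 2] in the cost; the square is due to the product charged for a binary
    operation. *)
Fixpoint eweight (e : expr) : nat :=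
  match e with
  | Const z => bits z
  | Get _ i => (eweight i + (ewidth i).+1 + 2)%N
  | Bin _ e1 e2 =>
      (eweight e1 + eweight e2 + (ewidth e1).+1 * (ewidth e2).+1)%N
  end.

Lemma small_bits (z : int) : small (bits z) z.
Proof.
rewrite /small /bits expnS; have := @up_logP 2 `|z|.+1 isT.
by move: (2 ^ up_log _ _)%N => k; lia.
Qed.

Lemma small_le (a b : nat) (z : int) : (a <= b)%N -> small a z -> small b z.
Proof. by move=> ab h; apply: leq_trans h _; rewrite leq_exp2l. Qed.

(** One exponent serves all five operations: a product needs [a + b] bits, a sum at most one more,
    and a quotient never exceeds its dividend, also for a negative or zero divisor. *)
Lemma small_eval_op (o : binop) (a b : nat) (x y : int) :
  small a x -> small b y -> small (a + b).+1 (eval_op o x y).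
Proof.
rewrite /small => hx hy.
have h2 : (2 ^ a + 2 ^ b <= 2 ^ (a + b).+1)%N.
  rewrite expnS mul2n -addnn leq_add // leq_exp2l //; lia.
have hp : (`|x| * `|y| < 2 ^ (a + b))%N by rewrite expnD ltn_mul.
have hpp : (2 ^ (a + b) <= 2 ^ (a + b).+1)%N by rewrite leq_exp2l.
have h0 : (0 < 2 ^ (a + b))%N by rewrite expn_gt0.
have h1 : (1 < 2 ^ (a + b).+1)%N by rewrite expnS; lia.
case: o => /=.
- by lia.
- by lia.
- by rewrite abszM; lia.
- have : (`|(x %/ y)%Z| <= `|x|)%N.
    case: y {hy hp} => [[|d]|d].
    + by rewrite divz0.
    + by have := divz_eq x d.+1; have := @modz_ge0 x d.+1 isT; have := @ltz_pmod x d.+1 isT; nia.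
    + rewrite NegzE divzN abszN.
      by have := divz_eq x d.+1; have := @modz_ge0 x d.+1 isT; have := @ltz_pmod x d.+1 isT; nia.
  by lia.
- by case: ifP => _; [rewrite absz1|rewrite absz0]; lia.
Qed.

Lemma small_eval (b : nat) (s : state) (e : expr) : (0 < b)%N ->
  bounded b s -> small (ewidth e * b) (eval s e).
Proof.
move=> b0 hs; elim: e => [z|a i _|o e1 h1 e2 h2] /=.
- by apply: small_le (small_bits z); rewrite leq_pmulr.
- by rewrite mul1n.
- apply: small_le (small_eval_op o h1 h2).
  by rewrite mulSn mulnDl; lia.
Qed.

Lemma bits_eval (b : nat) (s : state) (e : expr) : (0 < b)%N ->
  bounded b s -> (bits (eval s e) <= (ewidth e).+1 * b)%N.
Proof.
move=> b0 hs; apply: leq_trans (bits_small (small_eval e b0 hs)) _.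
by rewrite mulSn; lia.
Qed.

Lemma cost_le (b : nat) (s : state) (e : expr) : (0 < b)%N ->
  bounded b s -> (cost s e <= eweight e * b ^ 2)%N.
Proof.
move=> b0 hs; have bb : (b <= b ^ 2)%N by rewrite expnS expn1 leq_pmulr.
have be z : (bits (eval s z) <= (ewidth z).+1 * b ^ 2)%N.
  by apply: leq_trans (bits_eval z b0 hs) _; rewrite leq_mul2l bb orbT.
elim: e => [z|a i hi|o e1 h1 e2 h2] /=.
- by rewrite leq_pmulr // expn_gt0 b0.
- by rewrite !mulnDl; have := be (Get a i); have := be i; rewrite /=; lia.
- rewrite !mulnDl; rewrite leq_add ?leq_add //.
  apply: leq_trans (leq_mul (bits_eval e1 b0 hs) (bits_eval e2 b0 hs)) _.
  by rewrite mulnACA expnS expn1.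
Qed.

(** A loop of at most [b] turns makes [b.+1] tests, the last one failing. Adding both branches of an
    [If] avoids a maximum and keeps the bound visibly polynomial in [b]. *)
Fixpoint ctime (b : nat) (c : cmd) : nat :=
  match c with
  | Skip => 1
  | Put _ i e =>
      ((eweight i + eweight e + (ewidth i).+1 + (ewidth e).+1) * b ^ 2).+1
  | Then c1 c2 => (ctime b c1 + ctime b c2).+1
  | If e c1 c2 => (eweight e * b ^ 2 + (ctime b c1 + ctime b c2)).+1
  | While e c => b.+1 * (eweight e * b ^ 2 + ctime b c).+1
  end%N.

(* Besides correctness, [wp b c Q s] demands that every value written is less
   than [2 ^ b] in absolute value and that every loop makes at most [b] turns;
   this is what bounds the running time. *)
Fixpoint wp (b : nat) (c : cmd) (Q : state -> Prop) (s : state) : Prop :=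
  match c with
  | Skip => Q s
  | Put a i e => small b (eval s e) /\ Q (update s a (eval s i) (eval s e))
  | Then c1 c2 => wp b c1 (wp b c2 Q) s
  | If e c1 c2 => if eval s e != 0 then wp b c1 Q s else wp b c2 Q s
  | While e c => exists2 n, (n <= b)%N &
      iter n (fun P s => eval s e != 0 /\ wp b c P s)
             (fun s => eval s e == 0 /\ Q s) s
  end.

(** Every write is checked, so [bounded b] is an invariant of the run and [cost_le] applies to each
    expression met on the way. *)
Lemma wp_sound (b : nat) (c : cmd) (Q : state -> Prop) (s : state) :
  (0 < b)%N -> bounded b s -> wp b c Q s ->
  exists t s', [/\ exec c s t s', (t <= ctime b c)%N, bounded b s' & Q s'].
Proof.
move=> b0; elim: c Q s => [|a i e|c1 h1 c2 h2|e c1 h1 c2 h2|e c h] Q s hs /=.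
- by move=> q; exists 1%N, s; split=> //; constructor.
- move=> [he q]; exists (cost s i + cost s e + bits (eval s i) + bits (eval s e)).+1%N.
  exists (update s a (eval s i) (eval s e)); split=> //; first by constructor.
    have bb : (b <= b ^ 2)%N by rewrite expnS expn1 leq_pmulr.
    have be z : (bits (eval s z) <= (ewidth z).+1 * b ^ 2)%N.
      by apply: leq_trans (bits_eval z b0 hs) _; rewrite leq_mul2l bb orbT.
    rewrite ltnS !mulnDl; have := be i; have := be e.
    by have := cost_le e b0 hs; have := cost_le i b0 hs; lia.
  by move=> a' i'; rewrite /update; case: ifP.
- move=> /(h1 _ _ hs) [t1 [s1 [x1 l1 hs1 /(h2 _ _ hs1) [t2 [s2 [x2 l2 hs2 q]]]]]].
  exists (t1 + t2).+1%N, s2; split=> //; last by rewrite ltnS leq_add.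
  by econstructor; eassumption.
- have ce := cost_le e b0 hs.
  case: ifPn => [ne|]; last rewrite negbK => e0.
    move=> /(h1 _ _ hs) [t1 [s1 [x1 l1 hs1 q]]].
    exists (cost s e + t1).+1%N, s1; split=> //; last by lia.
    by apply: ExecIfTrue.
  move=> /(h2 _ _ hs) [t1 [s1 [x1 l1 hs1 q]]].
  exists (cost s e + t1).+1%N, s1; split=> //; last by lia.
  by apply: ExecIfFalse.
- move=> [n nb hn].
  suff [t [s' [x l hs' q]]] : exists t s', [/\ exec (While e c) s t s',
      (t <= n.+1 * (eweight e * b ^ 2 + ctime b c).+1)%N, bounded b s' & Q s'].
    exists t, s'; split=> //; apply: leq_trans l _.
    by rewrite leq_mul2r ltnS nb orbT.
  elim: n s hs hn {nb} => [|n ih] s hs /= [te].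
    move=> q; exists (cost s e).+1, s; split=> //; first by constructor.
    by have := cost_le e b0 hs; lia.
  move=> /(h _ _ hs) [t1 [s1 [x1 l1 hs1 /(ih _ hs1)]]].
  move=> [t2 [s2 [x2 l2 hs2 q]]].
  exists (cost s e + t1 + t2).+1%N, s2; split=> //.
    by econstructor; eassumption.
  by have := cost_le e b0 hs; rewrite mulSn; lia.
Qed.

Lemma wp_mono (b : nat) (c : cmd) (Q Q' : state -> Prop) (s : state) :
  (forall s', Q s' -> Q' s') -> wp b c Q s -> wp b c Q' s.
Proof.
elim: c Q Q' s => [|a i e|c1 h1 c2 h2|e c1 h1 c2 h2|e c h] Q Q' s hq /=.
- exact: hq.
- by case=> ? /hq.
- by apply: h1 => s'; apply: h2.
- by case: ifP => _; [apply: h1|apply: h2].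
- move=> [n nb hn]; exists n => //; elim: n s hn {nb} => [|n ih] s /= [te].
    by move/hq.
  by move=> hc; split=> //; apply: h hc.
Qed.

(* the shape of the bound in [poly_time] *)
Definition polyb (f : nat -> nat) : Prop :=
  exists k : nat, forall z : nat, (f z <= k * z ^ k + k)%N.

Lemma polyb_le (f g : nat -> nat) :
  (forall z, (f z <= g z)%N) -> polyb g -> polyb f.
Proof. by move=> fg [k hk]; exists k => z; apply: leq_trans (fg z) (hk z). Qed.

(** The form [k * z.+1 ^ k] has a positive base, so exponents can be raised freely; this makes
    closure under sums and products immediate. The factor [2 ^ k] comes from
    [z.+2 ^ k <= 2 ^ k * z.+1 ^ k]. *)
Lemma polybP (f : nat -> nat) (k : nat) :
  (forall z, (f z <= k * (z.+1) ^ k)%N) -> polyb f.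
Proof.
move=> h; exists (k * 2 ^ k)%N => z; apply: leq_trans (h z) _.
case: z {h} => [|z].
  have : (0 < 2 ^ k)%N by rewrite expn_gt0.
  by rewrite exp1n; nia.
have h1 : (z.+2 ^ k <= 2 ^ k * z.+1 ^ k)%N.
  by rewrite -expnMn; case: k => // k; rewrite leq_exp2r //; lia.
have h2 : (z.+1 ^ k <= z.+1 ^ (k * 2 ^ k))%N.
  have : (0 < 2 ^ k)%N by rewrite expn_gt0.
  by move=> h3; apply: leq_pexp2l => //; nia.
apply: leq_trans (leq_addr _ _); rewrite -mulnA leq_mul2l.
by apply/orP; right; apply: leq_trans h1 _; rewrite leq_mul2l h2 orbT.
Qed.

Lemma polybS (f : nat -> nat) : polyb f ->
  exists k : nat, forall z : nat, (f z <= k * z.+1 ^ k)%N.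
Proof.
case=> k hk; exists (2 * k)%N => z; apply: leq_trans (hk z) _.
have h2 : (z ^ k <= z.+1 ^ (2 * k))%N.
  case: k {hk} => // k; apply: (@leq_trans (z.+1 ^ k.+1)); first by rewrite leq_exp2r.
  by apply: leq_pexp2l => //; lia.
have h3 : (0 < z.+1 ^ (2 * k))%N by rewrite expn_gt0.
by move: (z ^ k)%N (z.+1 ^ (2 * k))%N h2 h3 => u v; nia.
Qed.

Lemma polyb_cst (c : nat) : polyb (fun _ => c).
Proof. by exists c => z; rewrite leq_addl. Qed.

Lemma polyb_id : polyb id.
Proof. by exists 1%N => z; rewrite mul1n expn1 leq_addr. Qed.

Lemma polybD (f g : nat -> nat) :
  polyb f -> polyb g -> polyb (fun z => f z + g z)%N.
Proof.
move=> /polybS[k hk] /polybS[l hl]; apply: (@polybP _ (k + l)%N) => z.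
apply: leq_trans (leq_add (hk z) (hl z)) _; rewrite mulnDl leq_add //.
  by rewrite leq_mul2l leq_pexp2l ?leq_addr ?orbT.
by rewrite leq_mul2l leq_pexp2l ?leq_addl ?orbT.
Qed.

Lemma polybM (f g : nat -> nat) :
  polyb f -> polyb g -> polyb (fun z => f z * g z)%N.
Proof.
move=> /polybS[k hk] /polybS[l hl]; apply: (@polybP _ (k + l + k * l)%N) => z.
apply: leq_trans (leq_mul (hk z) (hl z)) _; rewrite mulnACA -expnD leq_mul //.
  by rewrite leq_addl.
by rewrite leq_pexp2l ?leq_addr.
Qed.

Lemma polyb_comp (f g : nat -> nat) :
  polyb f -> polyb g -> polyb (fun z => f (g z))%N.
Proof.
move=> [k hk] pg.
apply: (@polyb_le _ (fun z => k * g z ^ k + k)%N); first by move=> z; apply: hk.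
apply: polybD; last exact: polyb_cst.
apply: polybM; first exact: polyb_cst.
elim: k {hk} => [|k ih]; first exact: polyb_cst.
by apply: (polyb_le _ (polybM pg ih)) => z; rewrite expnS.
Qed.

(** * Program logic *)

Declare Scope expr_scope.
Delimit Scope expr_scope with E.
Bind Scope expr_scope with expr.
Notation "x + y" := (Bin Add x y) : expr_scope.
Notation "x - y" := (Bin Defs.Sub x y) : expr_scope.
Notation "x * y" := (Bin Mul x y) : expr_scope.
Notation "x / y" := (Bin Div x y) : expr_scope.
Notation "x <= y" := (Bin Leq x y) : expr_scope.
Notation "# n" := (Const (Posz n)) (at level 8, n at level 2, format "# n") : expr_scope.
Notation "$ a" := (Get a (Const (Posz 0))) (at level 8, a at level 2, format "$ a") : expr_scope.
Notation "c ;; d" := (Then c d) (at level 60, right associativity).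

Definition lt (x y : expr) : expr := (x + #1 <= y)%E.
Definition eqe (x y : expr) : expr := ((x <= y) * (y <= x))%E.
Definition mode (x y : expr) : expr := (x - x / y * y)%E.
Definition pr (x y : expr) : expr := ((x + y) * (x + y) + x)%E.
Definition Set_ (a : nat) (e : expr) : cmd := Put a #0%E e.

(* Injective on all pairs, so that two-dimensional arrays need no row width. *)
Definition pair (i j : nat) : nat := ((i + j) * (i + j) + i)%N.

(** With [s = i + j], the value lies from [s ^ 2] to below [(s + 1) ^ 2]; this determines [s], and
    then [i]. *)
Lemma pair_inj (i j i' j' : nat) :
  (pair i j == pair i' j') = (i == i') && (j == j').
Proof.
apply/eqP/andP => [|[/eqP-> /eqP->] //]; rewrite /pair => h.
have hh : (i + j = i' + j')%N.
  have [h1|h1|//] := ltngtP (i + j)%N (i' + j')%N.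
    have : ((i + j).+1 * (i + j).+1 <= (i' + j') * (i' + j'))%N by rewrite leq_mul.
    by lia.
  have : ((i' + j').+1 * (i' + j').+1 <= (i + j) * (i + j))%N by rewrite leq_mul.
  by lia.
by rewrite hh in h; lia.
Qed.

Lemma eval_const s z : eval s (Const z) = z. Proof. by []. Qed.
Lemma eval_get s a i : eval s (Get a i) = s a (eval s i). Proof. by []. Qed.
Lemma eval_add s x y : eval s (x + y)%E = eval s x + eval s y. Proof. by []. Qed.
Lemma eval_sub s x y : eval s (x - y)%E = eval s x - eval s y. Proof. by []. Qed.
Lemma eval_mul s x y : eval s (x * y)%E = eval s x * eval s y. Proof. by []. Qed.
Lemma eval_div s x y : eval s (x / y)%E = (eval s x %/ eval s y)%Z.
Proof. by []. Qed.
Lemma eval_leq s x y : eval s (x <= y)%E = (eval s x <= eval s y)%R :> int.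
Proof. by rewrite /=; case: ifP. Qed.
Lemma eval_lt s x y : eval s (lt x y) = (eval s x < eval s y)%R :> int.
Proof. by rewrite /lt eval_leq; congr (Posz (nat_of_bool _)); apply/idP/idP; rewrite eval_add eval_const; lia. Qed.
Lemma eval_eqe s x y : eval s (eqe x y) = (eval s x == eval s y)%R :> int.
Proof. by rewrite /eqe eval_mul !eval_leq; case: ltgtP. Qed.
Lemma eval_mode s x y : eval s (mode x y) = (eval s x %% eval s y)%Z.
Proof. by []. Qed.
Lemma eval_pr s x y (i j : nat) : eval s x = i -> eval s y = j ->
  eval s (pr x y) = pair i j.
Proof. by rewrite /pr !(eval_add, eval_mul) => -> ->; rewrite /pair; lia. Qed.

Definition evalE := (eval_const, eval_get, eval_lt, eval_eqe, eval_mode,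
  eval_add, eval_sub, eval_mul, eval_div, eval_leq).

Lemma upd_ne s a i v c j : c != a -> update s a i v c j = s c j.
Proof. by rewrite /update => /negPf->. Qed.
Lemma upd_same s a i v : update s a i v a i = v.
Proof. by rewrite /update !eqxx. Qed.
Lemma upd_eq s a i v j : update s a i v a j = if j == i then v else s a j.
Proof. by rewrite /update eqxx. Qed.

(** Frame condition by array names only: a list of closed numerals, so that membership is decided by
    computation. *)
Definition framed (mods : seq nat) (s s' : state) : Prop :=
  forall a j, a \notin mods -> s' a j = s a j.

Lemma framed_refl mods s : framed mods s s. Proof. by []. Qed.

Lemma framed_upd mods s s' a i v :
  a \in mods -> framed mods s s' -> framed mods s (update s' a i v).
Proof.
move=> am h c j cm; rewrite upd_ne ?h //.
by apply: contraNneq cm => ->.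
Qed.

Lemma framed_sub mods mods' s s' s'' : framed mods' s' s'' ->
  all (mem mods) mods' -> framed mods s s' -> framed mods s s''.
Proof.
move=> h /allP sub h' a j am; rewrite h ?h' //.
by apply: contra am => /sub.
Qed.

(** Reads a cell through updates and frames. The side conditions compare concrete array numbers,
    hence [isT] proves them. *)
Ltac rd1 :=
  match goal with
  | |- context [update ?s ?a ?i ?v ?c ?j] =>
      first [ rewrite (@upd_ne s a i v c j isT)
            | rewrite (@upd_same s a i v)
            | rewrite (@upd_eq s a i v j) ]
  | F : framed _ ?s ?s' |- context [?s' ?c ?j] => rewrite (F c j isT)
  end.
Ltac rd := repeat rd1.

Ltac frm := repeat first
  [ exact: framed_refl
  | match goal with F : framed ?l ?s ?s' |- framed ?l ?s ?s' => exact F end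
  | apply: framed_upd; [reflexivity|]
  | match goal with F : framed _ ?s ?s' |- framed _ _ ?s' =>
      apply: (framed_sub F); [reflexivity|] end ].

Lemma small_nat (b n : nat) : (n <= b)%N -> small b n.
Proof. by move=> h; apply: leq_ltn_trans h _; apply: ltn_expl. Qed.

Definition For (v : nat) (e : expr) (c : cmd) : cmd :=
  Set_ v #0%E;; While (lt $v%E e) (c;; Set_ v ($v + #1)%E).

(** The test re-evaluates [e] at every turn, so its value must be stable under the frame. The
    invariant refers to the state in which the counter is already updated. The bound [n <= b] limits
    both the turns and the counter. *)
Lemma wp_for mods (J : nat -> state -> Prop) (n b v : nat) (e : expr) (c : cmd)
    (Q : state -> Prop) (s : state) :
  (n <= b)%N -> v \in mods ->
  (forall s', framed mods s s' -> eval s' e = n) ->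
  J 0%N (update s v 0 0) ->
  (forall i s', (i < n)%N -> framed mods s s' -> s' v 0 = i -> J i s' ->
    wp b c (fun s'' => [/\ framed mods s s'', s'' v 0 = i &
      J i.+1 (update s'' v 0 i.+1)]) s') ->
  (forall s', framed mods s s' -> J n s' -> Q s') ->
  wp b (For v e c) Q s.
Proof.
move=> nb vm he j0 hc hq; split; first by apply: small_nat.
rewrite evalE; exists n => //.
pose K i s' := [/\ framed mods s s', s' v 0 = Posz i & J i s'].
have k0 : K 0%N (update s v 0 0).
  by split; rewrite ?upd_same //; apply: framed_upd.
rewrite -[in iter _ _ _](subn0 n); move: k0 (leq0n n); move: (update s v 0 0).
suff hi k i s' : k = (n - i)%N -> K i s' -> (i <= n)%N ->
    iter k (fun P s => eval s (lt $v%E e) != 0 /\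
      wp b (c;; Set_ v ($v + #1)%E) P s)
      (fun s => eval s (lt $v%E e) == 0 /\ Q s) s' by move=> s'; apply: hi.
elim: k i s' => [|k ih] i s' hk [fr hv hj] hin.
  have en : i = n by lia.
  by rewrite /iter eval_lt evalE he // hv en ltxx; split=> //; apply: hq; rewrite -?en.
rewrite iterS; split; first by rewrite eval_lt evalE he // hv ltz_nat; have -> : (i < n)%N by lia.
rewrite /=; have hlt : (i < n)%N by lia.
apply: wp_mono (hc i s' hlt fr hv hj) => s'' [fr' hv' hj'].
have e1 : s'' v 0 + 1 = i.+1 by rewrite hv'; lia.
rewrite e1; split; first by apply: small_nat; lia.
apply: (ih i.+1) => //; first by lia.
by split=> //; rewrite ?upd_same //; apply: framed_upd.
Qed.

(** The right-hand side may read the array being filled: the body may assume that cells not yet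
    visited still have their old values, which in-place pivoting needs. *)
Lemma wp_fill (n b v a : nat) (e idx rhs : expr) (ad : nat -> int)
    (f : nat -> int) (Q : state -> Prop) (s : state) :
  (n <= b)%N -> v != a ->
  (forall s', framed [:: v; a] s s' -> eval s' e = n) ->
  (forall i j, ad i = ad j -> i = j) ->
  (forall i s', (i < n)%N -> framed [:: v; a] s s' -> s' v 0 = i ->
    (forall j, (forall k, (k < i)%N -> j != ad k) -> s' a j = s a j) ->
    [/\ eval s' idx = ad i, eval s' rhs = f i & small b (f i)]) ->
  (forall s', framed [:: v; a] s s' ->
    (forall i, (i < n)%N -> s' a (ad i) = f i) ->
    (forall j, (forall i, (i < n)%N -> j != ad i) -> s' a j = s a j) -> Q s') ->
  wp b (For v e (Put a idx rhs)) Q s.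
Proof.
move=> nb va he inj hb hq.
pose J i (s' : state) := (forall k, (k < i)%N -> s' a (ad k) = f k) /\
  (forall j, (forall k, (k < i)%N -> j != ad k) -> s' a j = s a j).
apply: (@wp_for [:: v; a] J n) => //.
- by rewrite inE eqxx.
- by split=> // j _; rewrite upd_ne // eq_sym.
- move=> i s' hi fr hv [h1 h2].
  have [e1 e2 e3] := hb i s' hi fr hv h2.
  rewrite /wp e2 e1; split=> //; split.
  + by apply: framed_upd => //; rewrite !inE eqxx orbT.
  + by rewrite upd_ne.
  + have av : a != v by rewrite eq_sym.
    split=> [k|j] hk; rewrite upd_ne // upd_eq.
      case: eqP => [/inj-> //|ne]; apply: h1.
      by rewrite ltn_neqAle -ltnS hk andbT; apply/eqP=> kk; rewrite kk in ne.
    by rewrite (negPf (hk i _)) // h2 // => k ki; apply: hk; apply: leqW.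
- by move=> s' fr [h1 h2]; apply: hq.
Qed.

Lemma pairz_inj i j i' j' : Posz (pair i j) = Posz (pair i' j') -> i = i' /\ j = j'.
Proof. by case=> /eqP; rewrite pair_inj => /andP[/eqP-> /eqP->]. Qed.

Lemma wp_fill2 (n n' b v v' a : nat) (e e' rhs : expr)
    (f : nat -> nat -> int) (Q : state -> Prop) (s : state) :
  (n <= b)%N -> (n' <= b)%N -> uniq [:: v; v'; a] ->
  (forall s', framed [:: v; v'; a] s s' -> eval s' e = n) ->
  (forall s', framed [:: v; v'; a] s s' -> eval s' e' = n') ->
  (forall i j s', (i < n)%N -> (j < n')%N -> framed [:: v; v'; a] s s' ->
     s' v 0 = i -> s' v' 0 = j ->
     s' a (pair i j) = s a (pair i j) ->
     eval s' rhs = f i j /\ small b (f i j)) ->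
  (forall s', framed [:: v; v'; a] s s' ->
    (forall i j, (i < n)%N -> (j < n')%N -> s' a (pair i j) = f i j) -> Q s') ->
  wp b (For v e (For v' e' (Put a (pr $v $v') rhs))) Q s.
Proof.
move=> nb nb' un he he' hb hq.
have [vv' va v'a] : [/\ v != v', v != a & v' != a].
  by move: un; rewrite /= !inE negb_or andbT => /andP[/andP[]].
pose J i (s' : state) :=
  (forall k j, (k < i)%N -> (j < n')%N -> s' a (pair k j) = f k j) /\
  (forall k j, (i <= k)%N -> s' a (pair k j) = s a (pair k j)).
have am : a \in [:: v; v'; a] by rewrite !inE eqxx !orbT.
have vm : v \in [:: v; v'; a] by rewrite !inE eqxx.
have v'm : v' \in [:: v; v'; a] by rewrite !inE eqxx !orbT.
have sb : all (mem [:: v; v'; a]) [:: v'; a] by apply/allP=> x; rewrite /= !inE => ->; rewrite orbT.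
apply: (@wp_for [:: v; v'; a] J n) => //.
- by split=> // k j _; rewrite upd_ne // eq_sym.
- move=> i s1 hi fr hv [h1 h2].
  apply: (@wp_fill n' _ _ _ _ _ _ (fun j => pair i j) (f i)) => //.
  + by move=> s' fr'; apply: he'; apply: (framed_sub fr').
  + by move=> j j' /pairz_inj[].
  + move=> j s' hj fr' hv' h3.
    have hv2 : s' v 0 = i by rewrite fr' ?hv // !inE negb_or vv' va.
    have frs : framed [:: v; v'; a] s s' by apply: (framed_sub fr').
    have [|-> ?] := hb i j s' hi hj frs hv2 hv'.
      rewrite h3; first by apply: h2.
      by move=> k kj; rewrite eqz_nat pair_inj eqxx /= neq_ltn kj orbT.
    by split=> //; apply: eval_pr; rewrite evalE.
  + move=> s' fr' h3 h4; split.
    * by apply: (framed_sub fr').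
    * by rewrite fr' // !inE negb_or vv' va.
    * split=> [k j hk hj|k j hk]; rewrite upd_ne 1?eq_sym //.
        move: hk; rewrite ltnS leq_eqVlt => /orP[/eqP->|hk]; first exact: h3.
        rewrite h4; first exact: h1.
        by move=> x _; rewrite eqz_nat pair_inj negb_and neq_ltn hk.
      rewrite h4; first by apply: h2; lia.
      by move=> x _; rewrite eqz_nat pair_inj negb_and neq_ltn hk orbT.
- by move=> s' fr [h1 h2]; apply: hq => // i j hi hj; apply: h1.
Qed.

(* Each turn halves the product of the two numbers, except possibly the first,
   which may merely exchange them. *)
Lemma wp_euclid (K : nat -> nat -> state -> Prop) (b k x y : nat) (e : expr)
    (c : cmd) (Q : state -> Prop) (s : state) :
  (k < b)%N -> (x * y < 2 ^ k)%N -> K x y s ->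
  (forall x y s, K x y s -> eval s e = y) ->
  (forall x y s, (0 < y)%N -> K x y s -> wp b c (K y (x %% y)%N) s) ->
  (forall x s, K x 0%N s -> Q s) ->
  wp b (While e c) Q s.
Proof.
move=> kb hxy hK he hc hq.
pose It := fun (P : state -> Prop) s => eval s e != 0 /\ wp b c P s.
pose Q0 := fun s => eval s e == 0 /\ Q s.
have main : forall k x y, (x * y < 2 ^ k)%N -> (y <= x)%N ->
    exists2 n, (n <= k)%N & forall s, K x y s -> iter n It Q0 s.
  elim=> [|k' ih] x' y' lt1 le1.
    have y0 : y' = 0%N.
      by move: lt1; rewrite expn0; case: y' le1 => // y'; case: x' => // x'; lia.
    exists 0%N => // s' hK'; rewrite y0 in hK'.
    by split; [rewrite (he _ _ _ hK')|apply: hq hK'].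
  case: (posnP y') => [y0|y0].
    exists 0%N => // s' hK'; rewrite y0 in hK'.
    by split; [rewrite (he _ _ _ hK')|apply: hq hK'].
  have r1 : (x' %% y' < y')%N by rewrite ltn_mod.
  have r2 := divn_eq x' y'.
  have r3 : (0 < x' %/ y')%N by rewrite divn_gt0.
  (* As [y' <= x'], the quotient is at least 1, so [x'] is at least [y'] plus the remainder, hence
     more than twice the remainder. *)
  have r4 : (y' * (x' %% y') < 2 ^ k')%N.
    by move: lt1; rewrite expnS; move: (2 ^ k')%N (x' %% y')%N (x' %/ y')%N r1 r2 r3 => A B C; nia.
  have [n nk hn] := ih _ _ r4 (ltnW r1).
  exists n.+1 => // s' hK'; split; first by rewrite (he _ _ _ hK'); lia.
  exact: wp_mono hn (hc _ _ _ y0 hK').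
case: (leqP y x) => yx.
  have [n nk hn] := main _ _ _ hxy yx.
  by exists n; [apply: leq_trans nk (ltnW kb)|apply: hn].
(* Here [x < y], so the first turn is a mere exchange; this is why [k < b] is assumed strictly. *)
have xy : (y * (x %% y) < 2 ^ k)%N by rewrite modn_small // mulnC.
have xy' : (x %% y <= y)%N by rewrite ltnW // ltn_mod; lia.
have [n nk hn] := main _ _ _ xy xy'.
exists n.+1; first by apply: leq_ltn_trans nk kb.
have y0 : (0 < y)%N by lia.
split; first by rewrite (he _ _ _ hK); lia.
exact: wp_mono hn (hc _ _ _ y0 hK).
Qed.

Lemma wp_skip (b : nat) (Q : state -> Prop) (s : state) : Q s -> wp b Skip Q s.
Proof. by []. Qed.

Lemma wp_then (b : nat) (c1 c2 : cmd) (Q : state -> Prop) (s : state) :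
  wp b c1 (wp b c2 Q) s -> wp b (c1;; c2) Q s.
Proof. by []. Qed.

Lemma wp_put (k v : int) (b a : nat) (i e : expr) (Q : state -> Prop) (s : state) :
  eval s i = k -> eval s e = v -> small b v -> Q (update s a k v) ->
  wp b (Put a i e) Q s.
Proof. by move=> <- <-. Qed.

Lemma wp_set (v : int) (b a : nat) (e : expr) (Q : state -> Prop) (s : state) :
  eval s e = v -> small b v -> Q (update s a 0 v) -> wp b (Set_ a e) Q s.
Proof. exact: wp_put. Qed.

Lemma wp_if (c : bool) (b : nat) (e : expr) (c1 c2 : cmd) (Q : state -> Prop)
    (s : state) :
  eval s e = c%:Z -> (if c then wp b c1 Q s else wp b c2 Q s) ->
  wp b (If e c1 c2) Q s.
Proof. by move=> /= ->; case: c. Qed.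

Global Opaque wp eval update.

(** * Integer pivoting *)

(** Leibniz expansion with [n!] terms; cruder than Hadamard's bound, but its logarithm is still
    polynomial. *)
Lemma det_bound (n : nat) (A : 'M[int]_n) (a : int) :
  (forall i j, `|A i j| <= a) -> `|\det A| <= n`!%:R * a ^+ n.
Proof.
move=> hA; rewrite /determinant.
apply: le_trans (ler_norm_sum _ _ _) _.
apply: (@le_trans _ _ (\sum_(s : 'S_n) a ^+ n)); last first.
  by rewrite sumr_const card_Sn mulr_natl.
apply: ler_sum => s _; rewrite normrM normrX normrN1 expr1n mul1r normr_prod.
rewrite -[in leRHS](card_ord n) -prodr_const; apply: ler_prod => i _.
by rewrite normr_ge0 hA.
Qed.

Definition repl_col (R : Type) (m : nat) (E : 'M[R]_m) (r : 'I_m) (v : 'cV[R]_m) :=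
  \matrix_(i, j) if j == r then v i 0 else E i j.

(** Expand along column [r]: its cofactors do not see the replaced column. *)
Lemma cramer_det (m k : nat) (E : 'M[int]_m) (A : 'M[int]_(m, k)) r c :
  \det (repl_col E r (col c A)) = (\adj E *m A) r c.
Proof.
rewrite (expand_det_col _ r) mxE; apply: eq_bigr => i _.
rewrite !mxE eqxx mulrC; congr (_ * _).
rewrite /cofactor; congr (_ * \det _); apply/matrixP => x y; rewrite !mxE.
by rewrite eq_sym (negPf (neq_lift _ _)).
Qed.

Lemma scalemx_inj (m n : nat) (a : int) : a != 0 ->
  injective ( *:%R a : 'M[int]_(m, n) -> 'M[int]_(m, n)).
Proof.
move=> a0 A B /matrixP h; apply/matrixP => i j.
by apply: (mulfI a0); have := h i j; rewrite !mxE.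
Qed.

Definition mxfun (m n : nat) (T : nat -> nat -> int) : 'M[int]_(m, n) :=
  \matrix_(i, j) T i j.

(* [T] is [D E^-1 T0], and the columns after [t] have been processed.  [rp r] is
   the pivot column of row [r], or 0 if there is none (column 0 is never a
   pivot); [cp c] is the successor of the pivot row of column [c], or 0. *)
Record pivoted (m n : nat) (a : int) (T0 T : nat -> nat -> int) (D : int)
    (rp cp : nat -> nat) (t : nat) : Prop := Pivoted {
  piv_mx : exists E : 'M[int]_m, [/\ \det E = D,
    E *m mxfun m n.+1 T = D *: mxfun m n.+1 T0 & forall i j, `|E i j| <= a];
  piv_D : D != 0;
  piv_zero : forall i j, (i < m)%N -> (t < j <= n)%N -> (rp i < j)%N -> T i j = 0;
  piv_rp : forall r, (r < m)%N -> (0 < rp r)%N ->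
    (t < rp r <= n)%N /\ cp (rp r) = r.+1;
  piv_cp : forall c r, cp c = r.+1 -> [/\ (r < m)%N, rp r = c & (0 < c)%N];
  piv_unit : forall r i, (r < m)%N -> (i < m)%N -> (0 < rp r)%N ->
    T i (rp r) = if i == r then D else 0 }.

Lemma pivoted_init (m n : nat) (a : int) (T0 : nat -> nat -> int) :
  1 <= a -> pivoted m n a T0 T0 1 (fun _ => 0%N) (fun _ => 0%N) n.
Proof.
move=> a1; split=> //.
- exists 1%:M; split; rewrite ?det1 ?mul1mx ?scale1r // => i j.
  by rewrite mxE; case: eqP; rewrite ?normr0 ?normr1 // (le_trans _ a1).
- by move=> i j _; lia.
Qed.

Section PivotStep.

Variables (m n : nat) (a : int) (T0 T : nat -> nat -> int) (D : int).
Variables (rp cp : nat -> nat) (t : nat).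

(** A division-free form of [D E^-1 T0]: it shows the integrality of the table and makes its entries
    accessible to [cramer_det]. *)
Lemma adj_solve (E : 'M[int]_m) : D != 0 -> \det E = D ->
  E *m mxfun m n.+1 T = D *: mxfun m n.+1 T0 ->
  mxfun m n.+1 T = \adj E *m mxfun m n.+1 T0.
Proof.
move=> D0 dE eT; apply: (scalemx_inj D0).
by rewrite scalemxAr -eT mulmxA mul_adj_mx dE mul_scalar_mx.
Qed.

(** [D] and each [T i j] are determinants whose columns come from [E] and [T0], so the bound does
    not depend on the number of pivots made. *)
Lemma pivoted_bound : pivoted m n a T0 T D rp cp t ->
  (forall i j, (i < m)%N -> (j <= n)%N -> `|T0 i j| <= a) ->
  `|D| <= m`!%:R * a ^+ m /\
  (forall i j, (i < m)%N -> (j <= n)%N -> `|T i j| <= m`!%:R * a ^+ m).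
Proof.
case=> -[E [dE eT hE]] D0 _ _ _ _ hT0; split; first by rewrite -dE; apply: det_bound.
move=> i j hi hj; rewrite -ltnS in hj.
have /matrixP/(_ (Ordinal hi) (Ordinal hj)) := adj_solve D0 dE eT.
rewrite mxE /= => ->; rewrite -cramer_det; apply: det_bound => x y.
rewrite !mxE; case: eqP => _; last exact: hE.
by rewrite hT0 // -ltnS ltn_ord.
Qed.

(** A row with a pivot has it to the right of column [t.+1], so in that column only rows without
    pivot must vanish. *)
Lemma pivoted_skip : pivoted m n a T0 T D rp cp t.+1 ->
  (forall i, (i < m)%N -> rp i = 0%N -> T i t.+1 = 0) ->
  pivoted m n a T0 T D rp cp t.
Proof.
case=> hE D0 hz hr hc hu h0; split=> //.
- move=> i j hi /andP[tj jn] hij; case: (ltngtP j t.+1) => jt.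
  + by lia.
  + by apply: hz => //; rewrite jt jn.
  + case: (posnP (rp i)) => [e|p]; first by rewrite jt h0.
    by have [/andP[? _] _] := hr i hi p; lia.
- by move=> r hr' p; have [/andP[? ?] ?] := hr r hr' p; split=> //; apply/andP; split=> //; lia.
Qed.

Variables (T' : nat -> nat -> int) (rp' cp' : nat -> nat) (r : nat).

(** A fraction-free Gauss-Jordan step is an exchange in [E]: column [r] gives way to the input
    column [t.+1]. By Cramer the new determinant is the pivot, and the new table is again an
    adjugate times [T0], which is why the division by [D] is exact. *)
Lemma pivoted_step : pivoted m n a T0 T D rp cp t.+1 ->
  (forall i j, (i < m)%N -> (j <= n)%N -> `|T0 i j| <= a) ->
  (t < n)%N -> (r < m)%N -> rp r = 0%N -> T r t.+1 != 0 ->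
  (forall i j, (i < m)%N -> (j <= n)%N -> T' i j =
    if i == r then T r j
    else ((T i j * T r t.+1 - T i t.+1 * T r j) %/ D)%Z) ->
  (forall i, rp' i = if i == r then t.+1 else rp i) ->
  (forall c, cp' c = if c == t.+1 then r.+1 else cp c) ->
  pivoted m n a T0 T' (T r t.+1) rp' cp' t.
Proof.
case=> -[E [dE eT hE]] D0 hz hr hc hu hT0 tn rm rr P0 hT' hrp hcp.
set P := T r t.+1 in P0 hT' *.
have tn1 : (t.+1 < n.+1)%N by [].
pose ro := Ordinal rm; pose co := Ordinal tn1.
pose A := mxfun m n.+1 T; pose A0 := mxfun m n.+1 T0.
have A_adj : A = \adj E *m A0 by apply: adj_solve.
pose E' := repl_col E ro (col co A0).
have dE' : \det E' = P by rewrite /E' cramer_det -A_adj mxE.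
(* The numerators before division by [D]. Row [r] becomes [D] times the pivot row, so one rank-one
   correction describes all rows. *)
pose X : 'M[int]_(m, n.+1) := P *: A - (col co A - D *: delta_mx ro 0) *m row ro A.
have eX i j : X i j = if i == ro then D * T r j
                      else T i j * P - T i t.+1 * T r j.
  rewrite !mxE big_ord1 !mxE /=; case: (i =P ro) => [->|_] /=; first by rewrite -/P; ring.
  by ring.
have eE' : E' = E + (col co A0 - col ro E) *m delta_mx 0 ro.
  apply/matrixP => i j; rewrite !mxE big_ord1 !mxE /=.
  case: (j =P ro) => [->|_] /=; last by rewrite mulr0 addr0.
  by rewrite mulr1; ring.
have rX : delta_mx 0 ro *m X = D *: row ro A.
  by rewrite -rowE; apply/rowP => j; rewrite mxE eX eqxx !mxE.
have EA : E *m A = D *: A0 by [].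
have EX : E' *m X = (D * P) *: A0.
  have EX1 : E *m X = (D * P) *: A0 - D *: ((col co A0 - col ro E) *m row ro A).
    have ECo : E *m col co A = D *: col co A0.
      by rewrite colE mulmxA EA -scalemxAl -colE.
    rewrite /X mulmxBr -scalemxAr EA scalerA mulmxA mulmxBr ECo -scalemxAr.
    by rewrite -colE -scalerBr -scalemxAl mulrC.
  by rewrite eE' mulmxDl EX1 -mulmxA rX -scalemxAr subrK.
(* Multiply [EX] by the adjugate of [E'] and cancel the factor [P]; this is the divisibility by
   [D]. *)
have XD : X = D *: (\adj E' *m A0).
  apply: (scalemx_inj P0); rewrite -dE' -mul_scalar_mx -mul_adj_mx -mulmxA EX -scalemxAr.
  by rewrite -dE' scalerA mulrC.
have eT' : mxfun m n.+1 T' = \adj E' *m A0.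
  apply/matrixP => i j; rewrite [LHS]mxE hT' //; last by rewrite -ltnS ltn_ord.
  have := eX i j; rewrite XD mxE; case: (i =P ro) => [->|/eqP ne] h.
    by rewrite eqxx; apply: (mulfI D0).
  by have -> : (i == r :> nat) = false by [apply: negPf]; rewrite -h mulrC mulzK.
have T'z i j : (i < m)%N -> (j <= n)%N -> (i == r) = false -> T r j = 0 -> T i j = 0 -> T' i j = 0.
  by move=> hi hj ir h1 h2; rewrite hT' // ir h1 h2 mulr0 mul0r subrr div0z.
have T'c i : (i < m)%N -> (i == r) = false -> T' i t.+1 = 0.
  by move=> hi ir; rewrite hT' // ir mulrC subrr div0z.
have rpne i : (i < m)%N -> (0 < rp i)%N -> (i == r) = false.
  by move=> hi p; apply/eqP=> e; rewrite e rr in p.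
split=> //.
- exists E'; split; rewrite // ?eT' ?mulmxA ?mul_mx_adj ?dE' ?mul_scalar_mx //.
  move=> i j; rewrite !mxE; case: eqP => _; last exact: hE.
  by rewrite hT0.
- move=> i j hi /andP[tj jn]; rewrite hrp; case: eqP => [->|/eqP/negPf ir] hij.
    by rewrite hT' // eqxx hz //; rewrite ?rr; lia.
  case: (ltngtP j t.+1) => jt; [lia| |by rewrite jt T'c].
  by apply: T'z => //; apply: hz => //; rewrite ?rr; lia.
- move=> i hi; rewrite hrp hcp; case: eqP => [->|/eqP/negPf ir] p.
    by rewrite eqxx; split=> //; lia.
  have [/andP[h1 h2] h3] := hr i hi p.
  by have -> : (rp i == t.+1) = false by [lia]; split=> //; lia.
- move=> c q; rewrite hcp; case: eqP => [-> [<-]|/eqP/negPf ct /hc[h1 h2 h3]].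
    by rewrite hrp eqxx.
  rewrite hrp; case: eqP => [e|_] //.
  by rewrite e rr in h2; lia.
- move=> q i hq hi; rewrite hrp; case: eqP => [->|/eqP/negPf qr] p.
    case: eqP => [->|/eqP/negPf ir]; last exact: T'c.
    by rewrite hT' // eqxx.
  have [/andP[h1 h2] h3] := hr q hq p.
  have u := hu _ _ hq rm p; rewrite eq_sym qr in u.
  rewrite hT' //; case: eqP => [e|/eqP/negPf ir].
    by rewrite u e; rewrite eq_sym in qr; rewrite qr.
  rewrite u mulr0 subr0 hu //; case: eqP => _; first by rewrite mulrC mulzK.
  by rewrite mul0r div0z.
Qed.

End PivotStep.

(** * Echelon bases modulo an integer *)

Section Echelon.

Variables (N K : nat) (E : int) (L : (nat -> int) -> Prop).
Hypothesis E0 : 0 < E.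
Hypothesis L_ext : forall x y, (forall j, (j < N)%N -> x j = y j) -> L x -> L y.
Hypothesis L_lin : forall c x y, L x -> L y -> L (fun j => x j + c * y j).
Hypothesis L_mod : forall w, L (fun j => E * w j).

Definition lead_zero (i : nat) (x : nat -> int) : Prop :=
  forall j, (j < i)%N -> x j = 0.

(* In [ech_gen], [w] vanishes up to [i] included: at coordinate [i] the multiples
   of [E] are multiples of [h i]. *)
Record echelon (i : nat) (h : nat -> int) (V : nat -> nat -> int) : Prop := Echelon {
  ech_h : L h;
  ech_V : forall k, (k < K)%N -> L (V k);
  ech_hz : lead_zero i h;
  ech_Vz : forall k, (k < K)%N -> lead_zero i (V k);
  ech_hi : 0 < h i;
  ech_hle : forall j, (j < N)%N -> 0 <= h j <= E;
  ech_hlt : forall j, (j < N)%N -> j != i -> h j < E;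
  ech_Vle : forall k j, (k < K)%N -> (j < N)%N -> 0 <= V k j < E;
  ech_gen : forall x, L x -> lead_zero i x -> exists (c : int) (b w : nat -> int), lead_zero i.+1 w /\
    forall j, (j < N)%N -> x j = c * h j + \sum_(k < K) b k * V k j + E * w j }.

(** A Euclidean step is unimodular up to multiples of [E]. Reduction modulo [E] changes nothing up
    to coordinate [i]: before it all entries vanish, and at it the remainder is already below [E].
    So the multiples of [E] introduced satisfy the restriction on [w] in [ech_gen]. *)
Lemma echelon_swap (i k : nat) (h h' : nat -> int) (V V' : nat -> nat -> int) :
  (k < K)%N -> (i < N)%N -> 0 < V k i -> echelon i h V ->
  (forall j, (j < N)%N -> h' j = V k j) ->
  (forall j, (j < N)%N -> V' k j = ((h j - (h i %/ V k i)%Z * V k j) %% E)%Z) ->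
  (forall k' j, (k' < K)%N -> k' != k -> (j < N)%N -> V' k' j = V k' j) ->
  echelon i h' V' /\ V' k i = (h i %% V k i)%Z.
Proof.
move=> kK iN vp [hL VL hz Vz hi hle hlt Vle gen] eh eV eV'.
set q := (h i %/ V k i)%Z in eV.
have jN j : (j < i)%N -> (j < N)%N by move=> ji; apply: ltn_trans iN.
have r0 j : (0 <= (h j - q * V k j) %% E)%Z by rewrite modz_ge0 // gt_eqF.
have r1 j : ((h j - q * V k j) %% E)%Z < E by rewrite ltz_pmod.
have zn j : (j < i)%N -> V' k j = 0.
  by move=> ji; rewrite eV ?jN // hz // Vz // mulr0 subr0 mod0z.
have vi : V' k i = (h i %% V k i)%Z.
  rewrite eV //; have := divz_eq (h i) (V k i); rewrite -/q => e.
  have -> : h i - q * V k i = (h i %% V k i)%Z by rewrite {1}e; ring.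
  rewrite modz_small // modz_ge0 ?gt_eqF //=.
  by apply: lt_trans (ltz_pmod _ vp) _; case/andP: (Vle k i kK iN).
split=> //; split.
- by apply: L_ext (VL k kK) => j hj; rewrite eh.
- move=> k' hk'; case: (k' =P k) => [->|/eqP ne]; last first.
    by apply: L_ext (VL k' hk') => j hj; rewrite eV'.
  apply: (L_ext _ (L_lin 1 (L_lin (- q) hL (VL k kK))
      (L_mod (fun j => - ((h j - q * V k j) %/ E)%Z)))) => j hj /=.
  rewrite eV //; have := divz_eq (h j - q * V k j) E.
  move: ((h j - q * V k j) %/ E)%Z ((h j - q * V k j) %% E)%Z => u r e.
  by have -> : r = h j - q * V k j - u * E; [rewrite e; ring|ring].
- by move=> j ji; rewrite eh ?Vz // jN.
- move=> k' hk' j ji; case: (k' =P k) => [->|/eqP ne]; first exact: zn.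
  by rewrite eV' ?Vz // jN.
- by rewrite eh.
- by move=> j hj; rewrite eh //; have /andP[-> /ltW->] := Vle k j kK hj.
- by move=> j hj _; rewrite eh //; have /andP[] := Vle k j kK hj.
- move=> k' j hk' hj; case: (k' =P k) => [->|/eqP ne]; last by rewrite eV' ?Vle.
  by rewrite eV // r0 r1.
- move=> x xL xz; have [c [b [w [wz ex]]]] := gen x xL xz.
  pose b' k' := if k' == k then c else b k'.
  pose w' j := w j + (if (j < i.+1)%N then 0 else c * ((h j - q * V k j) %/ E)%Z).
  (* From [h = q V_k + (h - q V_k)]: the old coefficient of [h] passes to the new [V' k], and the
     reduction modulo [E] goes into [w']. *)
  exists (c * q + b k), b', w'; split.
    by move=> j ji; rewrite /w' wz // ji addr0.
  move=> j hj; rewrite ex // eh //.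
  rewrite (bigD1 (Ordinal kK)) //= [in RHS](bigD1 (Ordinal kK)) //= /b' eqxx eV //.
  have -> : \sum_(l < K | l != Ordinal kK) (if l == k :> nat then c else b l) * V' l j =
            \sum_(l < K | l != Ordinal kK) b l * V l j.
    apply: eq_bigr => l ne; have ne' : l != k :> nat by [].
    by rewrite (negPf ne') eV'.
  rewrite /w'; case: ifP => ji.
    have -> : ((h j - q * V k j) %% E)%Z = h j - q * V k j.
      rewrite -eV //; move: ji; rewrite ltnS leq_eqVlt => /orP[/eqP->|ji].
        by rewrite vi {2}(divz_eq (h i) (V k i)) -/q; ring.
      by rewrite zn // hz // Vz // mulr0 subr0.
    by ring.
  have := divz_eq (h j - q * V k j) E.
  move: ((h j - q * V k j) %/ E)%Z ((h j - q * V k j) %% E)%Z => u r e.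
  by have -> : r = h j - q * V k j - u * E; [rewrite e; ring|ring].
Qed.

Definition unit_fun (i j : nat) : int := if j == i then E else 0.

(** The vector [E e_0] takes over the coefficient [w 0], so that the remaining multiples of [E]
    vanish at coordinate 0. *)
Lemma echelon_start (V : nat -> nat -> int) : (0 < N)%N ->
  (forall k, (k < K)%N -> L (V k)) ->
  (forall k j, (k < K)%N -> (j < N)%N -> 0 <= V k j < E) ->
  (forall x, L x -> exists b w : nat -> int, forall j, (j < N)%N ->
     x j = \sum_(k < K) b k * V k j + E * w j) ->
  echelon 0 (unit_fun 0) V.
Proof.
move=> N0 VL Vle gen; split=> //.
- apply: (L_ext _ (L_mod (fun j => (j == 0%N)%:R))) => j _.
  by rewrite /unit_fun; case: eqP => _; rewrite ?mulr1 ?mulr0.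
- by move=> j _; rewrite /unit_fun; case: eqP => _; rewrite ?lexx ?ltW.
- by move=> j _ /negPf j0; rewrite /unit_fun j0.
- move=> x /gen[b [w hx]] _.
  exists (w 0%N), b, (fun j => if j == 0%N then 0 else w j); split.
    by case.
  by move=> j hj; rewrite hx // /unit_fun; case: eqP => [->|_]; ring.
Qed.

(** Once the generators vanish at [i], only [h] contributes there: this gives the divisibility, and
    a vector vanishing at [i] does not use [h] at all. So [h] can be set aside, and [E e_(i+1)]
    takes its place. *)
Lemma echelon_next (i : nat) (h : nat -> int) (V : nat -> nat -> int) :
  (i < N)%N -> echelon i h V -> (forall k, (k < K)%N -> V k i = 0) ->
  (forall x, L x -> lead_zero i x -> (h i %| x i)%Z) /\
  ((i.+1 < N)%N -> echelon i.+1 (unit_fun i.+1) V).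
Proof.
move=> iN [hL VL hz Vz hi hle hlt Vle gen] V0.
have gi x : L x -> lead_zero i x -> exists (c : int) (b w : nat -> int), [/\ lead_zero i.+1 w, x i = c * h i &
    forall j, (j < N)%N -> x j = c * h j + \sum_(k < K) b k * V k j + E * w j].
  move=> xL xz; have [c [b [w [wz ex]]]] := gen x xL xz.
  exists c, b, w; split=> //; rewrite ex // wz // mulr0 addr0 big1 ?addr0 // => k _.
  by rewrite V0 // mulr0.
split=> [x xL xz|iN'].
  by have [c [b [w [_ -> _]]]] := gi x xL xz; rewrite dvdz_mull.
split=> //.
- apply: (L_ext _ (L_mod (fun j => (j == i.+1)%:R))) => j _.
  by rewrite /unit_fun; case: eqP => _; rewrite ?mulr1 ?mulr0.
- by move=> j ji; rewrite /unit_fun ltn_eqF.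
- move=> k hk j; rewrite ltnS leq_eqVlt => /orP[/eqP->|]; first exact: V0.
  exact: Vz.
- by rewrite /unit_fun eqxx.
- by move=> j _; rewrite /unit_fun; case: eqP => _; rewrite ?lexx ?ltW.
- by move=> j _ /negPf j0; rewrite /unit_fun j0.
- move=> x xL xz.
  have xz' : lead_zero i x by move=> j ji; apply: xz; apply: leqW.
  have [c [b [w [wz exi ex]]]] := gi x xL xz'.
  have c0 : c = 0.
    move: exi; rewrite xz // => /esym/eqP; rewrite mulf_eq0 (gt_eqF hi) orbF.
    by move/eqP.
  exists (w i.+1), b, (fun j => if j == i.+1 then 0 else w j); split.
    move=> j; rewrite ltnS leq_eqVlt => /orP[/eqP->|ji]; first by rewrite eqxx.
    by rewrite wz ?if_same.
  move=> j hj; rewrite ex // c0 /unit_fun; case: eqP => [->|_]; ring.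
Qed.

Lemma echelon_ext (i : nat) (h h' : nat -> int) (V : nat -> nat -> int) :
  (i < N)%N -> (forall j, (j < N)%N -> h' j = h j) ->
  echelon i h V -> echelon i h' V.
Proof.
move=> iN eh [hL VL hz Vz hi hle hlt Vle gen]; split=> //.
- by apply: (L_ext _ hL) => j hj; rewrite eh.
- by move=> j ji; rewrite eh ?hz //; apply: ltn_trans iN.
- by rewrite eh.
- by move=> j hj; rewrite eh ?hle.
- by move=> j hj ne; rewrite eh ?hlt.
- move=> x xL xz; have [c [b [w [wz ex]]]] := gen x xL xz.
  by exists c, b, w; split=> // j hj; rewrite eh ?ex.
Qed.

End Echelon.

(** * Ranks and free columns read off the pivots *)

Lemma rank_pivots (F : fieldType) (m n : nat) (A : 'M[F]_(m, n)) (d : F)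
    (S : {set 'I_m}) (g : 'I_m -> 'I_n) : d != 0 ->
  (forall i j, i \notin S -> A i j = 0) ->
  (forall i r, r \in S -> A i (g r) = if i == r then d else 0) ->
  \rank A = #|S|.
Proof.
move=> d0 hz hu; apply/eqP; rewrite eqn_leq; apply/andP; split.
  have sub : (A <= rowsub (@enum_val _ (mem S)) A)%MS.
    apply/row_subP => i; have [iS|iS] := boolP (i \in S).
      rewrite -[i in row i A](enum_rankK_in iS iS).
      have -> : row (enum_val (enum_rank_in iS i)) A =
          row (enum_rank_in iS i) (rowsub (@enum_val _ (mem S)) A).
        by apply/rowP => j; rewrite !mxE.
      exact: row_sub.
    have -> : row i A = 0 by apply/rowP => j; rewrite !mxE hz.
    exact: sub0mx.
  by apply: leq_trans (mxrankS sub) (rank_leq_row _).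
(* Lower bound: rows [S] and columns [g S] form a nonzero scalar matrix. *)
have e : colsub (fun k => g (enum_val k)) (rowsub (@enum_val _ (mem S)) A) = d%:M.
  apply/matrixP => i j; rewrite !mxE hu ?enum_valP // (inj_eq enum_val_inj).
  by case: eqP.
rewrite -(mxrank1 F #|S|) -(mxrank_scale_nz _ d0) scalemx1 -e.
rewrite -[rowsub _ A]mulmx1 -mulmx_colsub.
apply: leq_trans (mxrankM_maxl _ _) _; rewrite rowsubE.
exact: mxrankM_maxr.
Qed.

Lemma card_ord_count (n : nat) (P : pred nat) :
  #|[set i : 'I_n | P i]| = count P (iota 0 n).
Proof.
rewrite cardsE cardE size_filter -val_enum_ord count_map.
by rewrite enumT.
Qed.

Section Pivots.

Variables (m n : nat) (T0 T : nat -> nat -> int) (D a : int).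
Variables (rp cp : nat -> nat).
Hypothesis piv : pivoted m n a T0 T D rp cp 0.

Let nonpiv (c : nat) : bool := cp c == 0%N.

(** [rp] is a bijection from these rows to these columns, inverted by [cp]. *)
Lemma pivot_counts (t : nat) : (t <= n)%N ->
  count (fun r => (t < rp r)%N) (iota 0 m) =
  count (predC nonpiv) (iota t.+1 (n - t)).
Proof.
case: piv => _ _ _ hr hc _ tn; rewrite -!size_filter -(size_map rp).
apply/perm_size/uniq_perm.
- rewrite map_inj_in_uniq ?filter_uniq ?iota_uniq // => i j.
  rewrite !mem_filter !mem_iota !add0n /= => /andP[ti im] /andP[tj jm] e.
  have [|_ hi] := hr i im; first by lia.
  have [|_ hj] := hr j jm; first by lia.
  by move: hi; rewrite e hj => -[].
- by rewrite filter_uniq // iota_uniq.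
move=> c; rewrite mem_filter mem_iota /=.
apply/mapP/idP => [[r]|/andP[cc hcn]].
  rewrite mem_filter mem_iota !add0n /= => /andP[tr rm ->].
  have [|/andP[_ h1] h2] := hr r rm; first by lia.
  by rewrite /nonpiv h2 /= tr; lia.
rewrite /nonpiv in cc; case e: (cp c) cc => [|r] // _.
have [h1 h2 h3] := hc c r e.
by exists r; rewrite // mem_filter mem_iota /= h2; lia.
Qed.

(** This uses the right-to-left order: a row whose pivot is not beyond [t] vanishes on the last [k]
    columns, and the other rows have their pivots there. Used with [t = 0] for [W] and [t = p] for
    [B]. *)
Lemma rank_tail (k t : nat) (A : 'M[rat]_(m, k)) (Q : rat) :
  Q != 0 -> (t + k = n)%N ->
  (forall (i : 'I_m) (j : 'I_k), Q * A i j = (T0 i (t + j).+1)%:~R) ->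
  \rank A = count (predC nonpiv) (iota t.+1 (n - t)).
Proof.
move=> Q0 tk hA; rewrite -pivot_counts; last by lia.
case: piv => -[E [dE eT _]] D0 hz hr hc hu.
pose AT : 'M[rat]_(m, k) := \matrix_(i, j) (T i (t + j).+1)%:~R.
have eA : map_mx intr E *m AT = (D%:~R * Q) *: A.
  apply/matrixP => i j; rewrite !mxE -mulrA hA.
  have jn : ((t + j).+1 < n.+1)%N by have := ltn_ord j; lia.
  have /matrixP/(_ i (Ordinal jn)) := eT; rewrite !mxE /= => e.
  rewrite -intrM -e rmorph_sum; apply: eq_bigr => l _.
  by rewrite !mxE rmorphM.
have DQ : D%:~R * Q != 0 :> rat by rewrite mulf_neq0 // intr_eq0.
have Eu : row_full (map_mx intr E : 'M[rat]_m).
  by rewrite row_full_unit unitmxE det_map_mx dE unitfE intr_eq0.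
rewrite -(mxrank_scale_nz A DQ) -eA (eqmxMfull AT Eu).
rewrite -card_ord_count.
have [k0|k0] := posnP k.
  have -> : [set i : 'I_m | (t < rp i)%N] = finset.set0.
    apply/setP => i; rewrite !inE; apply/negP => ti.
    by have [|/andP[_ ?] _] := hr i (ltn_ord i); lia.
  by rewrite cards0; apply/eqP; rewrite -leqn0 -[in leqRHS]k0 rank_leq_col.
pose g (r : 'I_m) : 'I_k := insubd (Ordinal k0) (rp r - t.+1)%N.
apply: (@rank_pivots _ _ _ _ D%:~R _ g); first by rewrite intr_eq0.
- move=> i j; rewrite inE -leqNgt => h; rewrite mxE hz //; have := ltn_ord j; lia.
- move=> i r; rewrite inE => tr; rewrite mxE /g val_insubd.
  have [|/andP[h1 h2] _] := hr r (ltn_ord r); first by lia.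
  have -> : (rp r - t.+1 < k)%N by lia.
  have -> : (t + (rp r - t.+1)).+1 = rp r by lia.
  rewrite hu //.
  by rewrite (inj_eq val_inj); case: eqP.
Qed.

Variables (W : 'M[rat]_(m, n)) (p : 'I_n.+1) (Q : rat).
Hypothesis Q0 : Q != 0.
Hypothesis T0W : forall (i : 'I_m) (j : 'I_n), Q * W i j = (T0 i j.+1)%:~R.

Definition free_cols : seq nat := [seq c <- iota 1 n | cp c == 0%N].

Let rankW : \rank W = count (predC (fun c => cp c == 0%N)) (iota 1 n).
Proof. by rewrite (rank_tail Q0 (add0n n) T0W) subn0. Qed.

Lemma size_free_cols : size free_cols = (n - \rank W)%N.
Proof.
rewrite size_filter rankW; have := count_predC (fun c => cp c == 0%N) (iota 1 n).
by rewrite size_iota; lia.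
Qed.

Lemma free_cols_mem k : (k < n - \rank W)%N ->
  (0 < nth 0%N free_cols k <= n)%N /\ cp (nth 0%N free_cols k) = 0%N.
Proof.
rewrite -size_free_cols => /(mem_nth 0%N); rewrite mem_filter mem_iota.
by case/andP=> /eqP -> h; split=> //; lia.
Qed.

Lemma free_cols_mono k k' : (k < k')%N -> (k' < n - \rank W)%N ->
  (nth 0%N free_cols k < nth 0%N free_cols k')%N.
Proof.
rewrite -size_free_cols => kk k'n.
have st : sorted ltn free_cols by apply: sorted_filter (iota_ltn_sorted _ _); apply: ltn_trans.
by apply: (sorted_ltn_nth ltn_trans 0%N st) => //; rewrite inE //; apply: ltn_trans k'n.
Qed.

(** [\rank W - \rank B] counts the pivots among the first [p] columns, so [reduced_nints] counts the
    free columns there; they come first in the increasing list. *)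
Lemma free_cols_int k : (k < n - \rank W)%N ->
  (nth 0%N free_cols k <= p)%N = (k < reduced_nints p W)%N.
Proof.
have pn : (p <= n)%N by rewrite -ltnS.
have rankB : \rank (last_cols p W) =
    count (predC (fun c => cp c == 0%N)) (iota p.+1 (n - p)).
  apply: (rank_tail Q0 (subnKC pn)) => i j; rewrite mxE castmxE /=.
  by rewrite T0W.
have split_iota : iota 1 n = iota 1 p ++ iota p.+1 (n - p).
  by rewrite -[in LHS](subnKC pn) iotaD add1n.
have sz : reduced_nints p W = size [seq c <- iota 1 p | cp c == 0%N].
  rewrite /reduced_nints rankB rankW split_iota count_cat size_filter.
  by have := count_predC (fun c => cp c == 0%N) (iota 1 p); rewrite size_iota; lia.
rewrite -size_free_cols sz /free_cols split_iota filter_cat size_cat nth_cat => kn.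
case: ltnP => ks.
  have := mem_nth 0%N ks; rewrite mem_filter mem_iota add1n ltnS.
  by case/and3P=> _ _ ->.
have ks' : (k - size [seq c <- iota 1 p | cp c == 0%N] <
    size [seq c <- iota p.+1 (n - p) | cp c == 0%N])%N by lia.
have := mem_nth 0%N ks'; rewrite mem_filter mem_iota => /and3P[_ h _].
by rewrite leqNgt h.
Qed.

End Pivots.

(** * The lattice of integer solutions *)

Section Lattice.

Variables (m n p : nat) (E : int) (T : nat -> nat -> int) (rp cp : nat -> nat).

(* the free integer columns, with the column 0 of the right-hand side *)
Definition act (c : nat) : bool := (c <= p)%N && (cp c == 0%N).

(* Coordinate [i < m] holds the residue of row [i], if the pivot of this row is
   an integer variable; coordinate [m + c] holds the variable of column [c]. *)
Definition lat (x : nat -> int) : Prop :=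
  (forall i, (i < m)%N -> (E %| x i -
    (rp i <= p)%N%:Z * \sum_(c < n.+1) (act c)%:Z * T i c * x (m + c)%N)%Z) /\
  (forall c, (c <= n)%N -> ~~ act c -> (E %| x (m + c)%N)%Z).

Lemma lat_ext x y : (forall j, (j < m + n.+1)%N -> x j = y j) -> lat x -> lat y.
Proof.
move=> e [h1 h2]; split=> [i hi|c hc ac]; last by rewrite -e ?h2 //; lia.
have := h1 i hi; rewrite e; last by lia.
by under eq_bigr => c _ do rewrite e ?ltn_add2l //.
Qed.

Lemma lat_lin c x y : lat x -> lat y -> lat (fun j => x j + c * y j).
Proof.
move=> [h1 h2] [g1 g2]; split=> [i hi|k hk ak]; last first.
  by apply: rpredD; [apply: h2|apply: dvdz_mull; apply: g2].
have -> : \sum_(k < n.+1) (act k)%:Z * T i k * (x (m + k)%N + c * y (m + k)%N) =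
    \sum_(k < n.+1) (act k)%:Z * T i k * x (m + k)%N +
    c * \sum_(k < n.+1) (act k)%:Z * T i k * y (m + k)%N.
  by rewrite mulr_sumr -big_split /=; apply: eq_bigr => k _; ring.
have := rpredD (h1 i hi) (dvdz_mull c (g1 i hi)).
by congr (_ %| _)%Z; ring.
Qed.

Lemma lat_mod w : lat (fun j => E * w j).
Proof.
split=> [i hi|c hc ac]; last by rewrite dvdz_mulr.
apply: rpredB; first by rewrite dvdz_mulr.
apply: dvdz_mull; apply: rpred_sum => c _.
by rewrite mulrCA dvdz_mulr.
Qed.

(** Column [k] of [T] stacked on the identity, with rows of continuous pivot and inactive columns
    erased. *)
Definition gen_col (k j : nat) : int :=
  (act k)%:Z * ((j < m)%N%:Z * (rp j <= p)%N%:Z * T j k + (j == m + k)%N%:Z).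

Lemma gen_col_lt k j : (j < m)%N ->
  gen_col k j = (rp j <= p)%N%:Z * ((act k)%:Z * T j k).
Proof.
move=> jm; rewrite /gen_col jm; have -> : (j == m + k)%N = false by lia.
by rewrite /= mul1r addr0 mulrCA.
Qed.

Lemma gen_col_ge k c : gen_col k (m + c) = (act k)%:Z * (c == k)%:Z.
Proof.
rewrite /gen_col eqn_add2l; have -> : (m + c < m)%N = false by lia.
by rewrite !mul0r add0r.
Qed.

Definition gen_mod (k j : nat) : int := (gen_col k j %% E)%Z.

Lemma gen_modE k : exists z, forall j, gen_mod k j = gen_col k j + E * z j.
Proof.
exists (fun j => - (gen_col k j %/ E)%Z) => j.
rewrite /gen_mod.
by move: (_ %/ E)%Z (_ %% E)%Z (divz_eq (gen_col k j) E) => u r ->; ring.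
Qed.

Lemma lat_gen k : (k <= n)%N -> lat (gen_mod k).
Proof.
move=> kn; have [z hz] := gen_modE k.
suff lg : lat (gen_col k).
  apply: (lat_ext _ (lat_lin 1 lg (lat_mod z))) => j _.
  by rewrite hz mul1r.
split=> [i hi|c hc ac]; last first.
  rewrite gen_col_ge; case: eqP => [<-|_]; last by rewrite mulr0 dvdz0.
  by rewrite (negPf ac) mul0r dvdz0.
rewrite gen_col_lt // -mulrBr; apply: dvdz_mull.
rewrite (bigD1 (Ordinal (kn : (k < n.+1)%N))) //= gen_col_ge eqxx big1 => [|c ck].
  by rewrite addr0 mulr1 mulrAC; case: (act k); rewrite ?mul1r ?mul0r subrr dvdz0.
by rewrite gen_col_ge; have -> : (c == k :> nat) = false; [exact: negPf|rewrite !mulr0].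
Qed.

(** The coefficients are the variable coordinates of [x] itself; the two clauses of [lat] say
    exactly that the difference is divisible by [E]. *)
Lemma lat_span x : lat x -> exists b w : nat -> int,
  forall j, (j < m + n.+1)%N -> x j = \sum_(k < n.+1) b k * gen_mod k j + E * w j.
Proof.
move=> [h1 h2]; exists (fun k => x (m + k)%N).
exists (fun j => ((x j - \sum_(k < n.+1) x (m + k)%N * gen_mod k j) %/ E)%Z) => j hj.
suff h : (E %| x j - \sum_(k < n.+1) x (m + k)%N * gen_mod k j)%Z.
  by rewrite [E * _]mulrC (divzK h); ring.
have -> : \sum_(k < n.+1) x (m + k)%N * gen_mod k j =
   \sum_(k < n.+1) x (m + k)%N * gen_col k j +
   E * \sum_(k < n.+1) - (x (m + k)%N * (gen_col k j %/ E)%Z).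
  rewrite mulr_sumr -big_split /=; apply: eq_bigr => k _.
  rewrite /gen_mod.
  by move: (_ %/ E)%Z (_ %% E)%Z (divz_eq (gen_col k j) E) => u r ->; ring.
rewrite opprD addrA; apply: rpredB; last by rewrite dvdz_mulr.
case: (ltnP j m) => jm.
  have := h1 j jm; congr (_ %| _ - _)%Z; rewrite mulr_sumr.
  by apply: eq_bigr => k _; rewrite gen_col_lt //; ring.
have [c ec] : exists c, j = (m + c)%N by exists (j - m)%N; lia.
have cn : (c < n.+1)%N by lia.
rewrite ec (bigD1 (Ordinal cn)) //= big1 => [|k ck]; last first.
  rewrite gen_col_ge; have -> : (c == k) = false; last by rewrite !mulr0.
  by apply/negP => /eqP e; move/eqP: ck; apply; apply: val_inj.
rewrite gen_col_ge eqxx addr0 mulr1; have [ac|ac] := boolP (act c).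
  by rewrite mulr1 subrr dvdz0.
by rewrite mulr0 subr0 h2.
Qed.

Hypothesis E0 : 0 < E.

Lemma gen_mod_bound k j : 0 <= gen_mod k j < E.
Proof. by rewrite modz_ge0 ?gt_eqF // ltz_pmod. Qed.

End Lattice.

(** * From echelon rows to the parametrization *)

Record echelon_rows (N : nat) (E : int) (L : (nat -> int) -> Prop)
    (H : nat -> nat -> int) : Prop := EchelonRows {
  row_in : forall i, (i < N)%N -> L (H i);
  row_lead : forall i, (i < N)%N -> lead_zero i (H i);
  row_pos : forall i, (i < N)%N -> 0 < H i i;
  row_le : forall i j, (i < N)%N -> (j < N)%N -> 0 <= H i j <= E;
  row_lt : forall i j, (i < N)%N -> (j < N)%N -> j != i -> H i j < E;
  row_dvd : forall i x, (i < N)%N -> L x -> lead_zero i x -> (H i i %| x i)%Z }.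

(** The homogenized vector (a, x), indexed by naturals to match the tables, whose column 0 is the
    right-hand side. *)
Definition hom (R : ringType) (n : nat) (a : R) (x : 'cV[R]_n) (j : nat) : R :=
  if j is k.+1 then if insub k is Some i then x i 0 else 0 else a.

Arguments hom : simpl never.

Lemma hom_ord (R : ringType) (n : nat) (a : R) (x : 'cV[R]_n) (i : 'I_n) :
  hom a x i.+1 = x i 0.
Proof. by rewrite /hom valK. Qed.

Lemma hom_0 (R : ringType) (n : nat) (a : R) (x : 'cV[R]_n) : hom a x 0 = a.
Proof. by []. Qed.

Lemma ratr_is_int (R : realType) (q : rat) :
  q \is a Num.int -> ratr q \is a @Num.int R.
Proof. by case/intrP => z ->; rewrite ratr_int intr_int. Qed.

Lemma dvdz_opp (E x : int) : (E %| - x)%Z = (E %| x)%Z.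
Proof. exact: rpredN. Qed.

Lemma dvdz_small0 (E x : int) : 0 <= x -> x < E -> (E %| x)%Z -> x = 0.
Proof. by move=> h0 h1 /dvdz_mod0P; rewrite modz_small // h0. Qed.

Section Solution.

Variables (R : realType) (m n : nat) (p : 'I_n.+1).
Variables (W : 'M[rat]_(m, n)) (w : 'cV[rat]_m) (Q : rat).
Variables (T0 T : nat -> nat -> int) (D a E sg : int) (rp cp : nat -> nat).
Variables (H : nat -> nat -> int).
Hypothesis Q0 : Q != 0.
Hypothesis T0W : forall (i : 'I_m) (j : 'I_n), Q * W i j = (T0 i j.+1)%:~R.
Hypothesis T0w : forall i : 'I_m, Q * w i 0 = - (T0 i 0%N)%:~R.
Hypothesis piv : pivoted m n a T0 T D rp cp 0.
Hypothesis E0 : 0 < E.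
Hypothesis DE : D = sg * E.
Hypothesis sg1 : sg * sg = 1.
Hypothesis rows : echelon_rows (m + n.+1) E (lat m n p E T rp cp) H.

Definition sol (y : nat -> R) : Prop :=
  forall i, (i < m)%N -> \sum_(j < n.+1) (T i j)%:~R * y j = 0.

(** Row operations invertible over the field preserve solutions. The scalar [b] covers two uses: 1
    for the affine space, 0 for its directions. *)
Lemma solP (b : R) (x : 'cV[R]_n) :
  map_mx ratr W *m x = b *: map_mx ratr w <-> sol (hom b x).
Proof.
pose h : 'cV[R]_n.+1 := \col_j hom b x j.
case: piv => -[F [dF eT _]] D0 _ _ _ _.
have s1 : sol (hom b x) <-> map_mx intr (mxfun m n.+1 T) *m h = 0.
  split=> [hs|/matrixP hs i hi].
    apply/matrixP => i j; rewrite !mxE -[RHS](hs i (ltn_ord i)).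
    by apply: eq_bigr => k _; rewrite !mxE.
  have := hs (Ordinal hi) 0; rewrite !mxE => e; rewrite -[RHS]e.
  by apply: eq_bigr => k _; rewrite !mxE.
have s2 : map_mx ratr W *m x = b *: map_mx ratr w <->
    map_mx intr (mxfun m n.+1 T0) *m h = 0.
  have eq0 i : (map_mx intr (mxfun m n.+1 T0) *m h) i 0 =
      ratr Q * ((map_mx ratr W *m x) i 0 - (b *: map_mx ratr w) i 0).
    rewrite !mxE big_ord_recl !mxE /= mulrBr addrC; congr (_ + _).
      rewrite mulr_sumr; apply: eq_bigr => j _.
      by rewrite !mxE /= (hom_ord b x j) mulrA -rmorphM /= T0W ratr_int.
    rewrite hom_0 mulrCA -rmorphM /= T0w rmorphN /= ratr_int; ring.
  have qn : ratr Q != 0 :> R by rewrite fmorph_eq0.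
  split=> [e|/matrixP e].
    by apply/matrixP => i j; rewrite !ord1 eq0 e subrr mulr0 mxE.
  apply/matrixP => i j; rewrite !ord1; apply/eqP; rewrite -subr_eq0.
  by rewrite -(mulrI_eq0 _ (mulfI qn)) -eq0 e mxE.
have eF : map_mx intr F *m (map_mx intr (mxfun m n.+1 T) *m h) =
    D%:~R *: (map_mx intr (mxfun m n.+1 T0) *m h).
  by rewrite mulmxA -map_mxM eT map_mxZ scalemxAl.
have Fu : (map_mx intr F : 'M[R]_m) \in unitmx.
  by rewrite unitmxE det_map_mx dF unitfE intr_eq0.
apply: iff_trans s2 (iff_trans _ (iff_sym s1)); split=> e; move: eF; rewrite e.
  rewrite scaler0 => /(congr1 (mulmx (invmx (map_mx intr F)))).
  by rewrite mulKmx // mulmx0.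
rewrite mulmx0 => /esym/eqP; rewrite scaler_eq0 intr_eq0 (negPf D0) /=.
by move/eqP.
Qed.

Let rank_pos r : (r < m)%N -> (0 < rp r)%N -> (0 < rp r <= n)%N /\ cp (rp r) = r.+1.
Proof. by case: piv => _ _ _ h _ _; apply: h. Qed.

Let cp_rp c r : cp c = r.+1 -> [/\ (r < m)%N, rp r = c & (0 < c)%N].
Proof. by case: piv => _ _ _ _ h _; apply: h. Qed.

Let col_unit r i : (r < m)%N -> (i < m)%N -> (0 < rp r)%N ->
  T i (rp r) = if i == r then D else 0.
Proof. by case: piv => _ _ _ _ _ h; apply: h. Qed.

Let col_zero i j : (i < m)%N -> (0 < j <= n)%N -> (rp i < j)%N -> T i j = 0.
Proof. by case: piv => _ _ h _ _ _; apply: h. Qed.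

Let cp0 : cp 0 = 0%N.
Proof. by case e: (cp 0) => [|r] //; have [] := cp_rp e. Qed.

(** The other pivot columns vanish in row [r], so the row expresses its pivot variable through the
    free ones. *)
Lemma pivot_row_sum (F : ringType) (y : nat -> F) (r : nat) :
  (r < m)%N -> (0 < rp r)%N ->
  \sum_(j < n.+1) (T r j)%:~R * y j = D%:~R * y (rp r) +
  \sum_(j < n.+1 | cp j == 0%N) (T r j)%:~R * y j.
Proof.
move=> rm rr; have [/andP[_ rn] crr] := rank_pos rm rr.
rewrite (bigID (fun j : 'I_n.+1 => cp j == 0%N)) /= addrC; congr (_ + _).
rewrite (bigD1 (Ordinal (rn : (rp r < n.+1)%N))) /=; last by rewrite crr.
rewrite col_unit // eqxx big1 ?addr0 // => j /andP[cj ne].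
case e: (cp j) cj => [//|r'] _; have [rm' er' j0] := cp_rp e.
have rr' : (0 < rp r')%N by rewrite er'.
rewrite -er' col_unit //; case: eqP => [er|_]; last by rewrite mul0r.
by case/eqP: ne; apply: val_inj; rewrite /= er er'.
Qed.

(* [numer i c / E] is coordinate [i] of the solution whose free coordinates are
   given by the lattice vector [H (m + c)]. *)
Definition numer (i c : nat) : int :=
  if cp i == 0%N then E * H (m + c) (m + i)
  else - sg * \sum_(j < n.+1) T (cp i).-1 j * H (m + c) (m + j).

Definition entry (i c : nat) : rat := (numer i c)%:~R / E%:~R.

Let En : E%:~R != 0 :> R. Proof. by rewrite intr_eq0 gt_eqF. Qed.
Let Enq : E%:~R != 0 :> rat. Proof. by rewrite intr_eq0 gt_eqF. Qed.

Lemma entry_free i c : cp i = 0%N -> entry i c = (H (m + c) (m + i))%:~R.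
Proof. by rewrite /entry /numer => ->; rewrite eqxx intrM mulrC mulKf. Qed.

(** An inactive coordinate is a multiple of [E], and off the diagonal the entries lie in [0, E); so
    it is exactly 0. The same argument gives [row_cont]. *)
Lemma row_pivot c j : (c <= n)%N -> (j <= n)%N -> cp c = 0%N -> cp j != 0%N ->
  H (m + c) (m + j) = 0.
Proof.
move=> cn jn cc cj; have hc : (m + c < m + n.+1)%N by lia.
have hj : (m + j < m + n.+1)%N by lia.
have ne : (m + j != m + c)%N by rewrite eqn_add2l; apply: contraNneq cj => ->; rewrite cc.
have /andP[h0 _] := row_le rows hc hj; have h1 := row_lt rows hc hj ne.
have [_ /(_ j jn)] := row_in rows hc; rewrite /act (negPf cj) andbF => /(_ isT).
exact: dvdz_small0.
Qed.

Lemma row_cont c j : (c <= n)%N -> (j <= n)%N -> (p < j)%N -> j != c ->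
  H (m + c) (m + j) = 0.
Proof.
move=> cn jn pj ne'; have hc : (m + c < m + n.+1)%N by lia.
have hj : (m + j < m + n.+1)%N by lia.
have ne : (m + j != m + c)%N by rewrite eqn_add2l.
have /andP[h0 _] := row_le rows hc hj; have h1 := row_lt rows hc hj ne.
have [_ /(_ j jn)] := row_in rows hc; rewrite /act leqNgt pj => /(_ isT).
exact: dvdz_small0.
Qed.

Lemma row_low c j : (c <= n)%N -> (j < c)%N -> H (m + c) (m + j) = 0.
Proof. by move=> cn jc; apply: (row_lead rows); lia. Qed.

Lemma row_head c i : (c <= n)%N -> (i < m)%N -> H (m + c) i = 0.
Proof. by move=> cn im; apply: (row_lead rows); lia. Qed.

(** Rows with a pivot hold by the choice of [numer]. A row without pivot can be nonzero only in
    column 0, which matters only for the vector with nonzero homogenizing coordinate. *)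
Lemma entry_sol c : (c <= n)%N -> cp c = 0%N ->
  (c == 0%N -> forall i, (i < m)%N -> rp i = 0%N -> T i 0%N = 0) ->
  sol (fun j => ratr (entry j c)).
Proof.
move=> cn cc hc i im; case: (posnP (rp i)) => ri.
  rewrite big_ord_recl /= big1 => [|j _]; last first.
    by rewrite /bump /= add1n col_zero ?mul0r ?ri //; have := ltn_ord j; lia.
  rewrite addr0 entry_free // ratr_int -intrM.
  case: (posnP c) => [c0|c0]; first by rewrite hc ?c0 ?mul0r.
  by rewrite row_low ?mulr0.
have [/andP[_ rn] crr] := rank_pos im ri.
rewrite (pivot_row_sum (fun j => ratr (entry j c))) // /entry /numer crr /=.
have -> : \sum_(j < n.+1) T i j * H (m + c) (m + j) =
    \sum_(j < n.+1 | cp j == 0%N) T i j * H (m + c) (m + j).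
  rewrite (bigID (fun j : 'I_n.+1 => cp j == 0%N)) /= [X in _ + X]big1 ?addr0 // => j cj.
  by rewrite row_pivot ?mulr0 // -ltnS.
rewrite fmorph_div /= !ratr_int DE intrM rmorphM /= rmorphN /= rmorph_sum /=.
under [X in _ + X]eq_bigr => j cj.
  rewrite cj fmorph_div /= !ratr_int intrM [E%:~R * _]mulrC mulfK // -intrM; over.
have sg1R : sg%:~R * sg%:~R = 1 :> R by rewrite -intrM sg1.
set S := \sum_(j < _ | _) _.
have -> : sg%:~R * E%:~R * (- sg%:~R * S / E%:~R) = - (sg%:~R * sg%:~R) * S :> R by field.
by rewrite sg1R mulN1r addNr.
Qed.

(** The residue coordinates of this row are 0, so the congruence for the pivot row makes [E] divide
    the sum in [numer]. *)
Lemma entry_int i c : (i <= p)%N -> (c <= p)%N -> cp c = 0%N ->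
  entry i c \is a Num.int.
Proof.
move=> ip cp' cc; have pn : (p <= n)%N by rewrite -ltnS.
have cn : (c <= n)%N by lia.
case e: (cp i) => [|r]; first by rewrite entry_free // intr_int.
have [rm er i0] := cp_rp e.
have hc : (m + c < m + n.+1)%N by lia.
have [/(_ r rm) h _] := row_in rows hc.
move: h; rewrite row_head // er ip mul1r sub0r dvdz_opp => h.
rewrite /entry /numer e /=.
have -> : \sum_(j < n.+1) T r j * H (m + c) (m + j) =
    \sum_(j < n.+1) (act p cp j)%:Z * T r j * H (m + c) (m + j).
  apply: eq_bigr => j _; rewrite /act; case: leqP => /= jp; last first.
    by rewrite row_cont ?mulr0 //; [rewrite -ltnS|rewrite gtn_eqF //; lia].
  by case: eqP => /= [_|/eqP cj]; rewrite ?mul1r // row_pivot ?mulr0 // -ltnS.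
case/dvdzP: h => q ->; rewrite mulrA intrM mulfK //.
Qed.

(** Moving a continuous parameter leaves the integer coordinates fixed: a row with integer pivot
    vanishes to the right of it, and the basis vector vanishes to the left of [c]. *)
Lemma entry_cont i c : (i <= p)%N -> (p < c <= n)%N -> entry i c = 0.
Proof.
move=> ip /andP[pc cn]; case e: (cp i) => [|r].
  by rewrite entry_free // row_low //; lia.
have [rm er i0] := cp_rp e.
rewrite /entry /numer e /= big1 ?mulr0 ?mul0r // => j _.
case: (ltnP j c) => jc; first by rewrite row_low ?mulr0.
by rewrite col_zero ?mul0r // ?er; have := ltn_ord j; lia.
Qed.

Definition feasible_rows : Prop :=
  forall i, (i < m)%N -> rp i = 0%N -> T i 0%N = 0.

(** Converse of [entry_int]: in a row with integer pivot the sum over the free columns is minus [D]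
    times an integer, so residues 0 are admissible. *)
Lemma integral_lat (y : nat -> R) (z : nat -> int) : feasible_rows -> sol y ->
  (forall j, (j <= p)%N -> y j = (z j)%:~R) ->
  lat m n p E T rp cp (fun k => if (k < m)%N then 0 else
    (act p cp (k - m)%N)%:Z * z (k - m)%N).
Proof.
move=> ok sy yz; split=> [i im|c cn ac]; last first.
  by rewrite ltnNge leq_addr /= addKn (negPf ac) mul0r dvdz0.
rewrite im sub0r dvdz_opp.
have -> : \sum_(c < n.+1) (act p cp c)%:Z * T i c * (if (m + c < m)%N then 0
    else (act p cp (m + c - m)%N)%:Z * z (m + c - m)%N) =
  \sum_(c < n.+1) (act p cp c)%:Z * T i c * z c.
  apply: eq_bigr => c _; rewrite ltnNge leq_addr /= addKn.
  by case: act; rewrite ?mul1r ?mul0r.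
case: leqP => rip; last by rewrite mul0r dvdz0.
rewrite mul1r; case: (posnP (rp i)) => ri.
  rewrite big1 ?dvdz0 // => c _; case: (posnP c) => [->|c0].
    by rewrite ok // mulr0 mul0r.
  by rewrite col_zero ?mulr0 ?mul0r // ?ri //; have := ltn_ord c; lia.
have := sy i im; rewrite pivot_row_sum // yz // => e.
have e2 : \sum_(j < n.+1 | cp j == 0%N) (T i j)%:~R * y j =
    (\sum_(c < n.+1) (act p cp c)%:Z * T i c * z c)%:~R.
  rewrite rmorph_sum big_mkcond /=; apply: eq_bigr => c _; rewrite /act.
  case: eqP => _; last by rewrite andbF !mul0r.
  case: leqP => cpp; first by rewrite mul1r intrM yz.
  by rewrite col_zero ?mul0r ?mulr0 //; have := ltn_ord c; lia.
have : D * z (rp i) + \sum_(c < n.+1) (act p cp c)%:Z * T i c * z c = 0.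
  by apply: (@intr_inj R); rewrite rmorphD /= -e2 intrM.
move/eqP; rewrite addrC addr_eq0 => /eqP->.
by rewrite dvdz_opp DE mulrAC dvdz_mull.
Qed.

Lemma feasible_row : (exists x : 'cV[R]_n, affine_space W w x) -> feasible_rows.
Proof.
case=> x; rewrite /affine_space /= -[RHS]scale1r => /solP sx i im ri.
have := sx i im; rewrite big_ord_recl big1 => [|j _]; last first.
  by rewrite lift0 col_zero ?mul0r ?ri //; have := ltn_ord j; lia.
by rewrite addr0 mulr1 => /eqP; rewrite intr_eq0 => /eqP.
Qed.

Let lead_bound c : (c <= n)%N -> (m + c < m + n.+1)%N. Proof. by lia. Qed.

Lemma hom_mixed (x : 'cV[R]_n) j :
  mixed R n p x -> (j <= p)%N -> hom 1 x j \is a Num.int.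
Proof.
move=> mx; case: j => [|j] jp; first exact: rpred1.
have jn : (j < n)%N by apply: leq_trans jp _; rewrite -ltnS.
by rewrite (hom_ord 1 x (Ordinal jn)) mx.
Qed.

(** A mixed integer solution gives a lattice vector with residues 0 and homogenizing coordinate 1;
    the leading entry divides it. *)
Lemma feasible_lead (x : 'cV[R]_n) :
  affine_space W w x -> mixed R n p x -> H m m = 1.
Proof.
move=> Ax mx; have ok : feasible_rows by apply: feasible_row; exists x.
move: Ax; rewrite /affine_space /= -[RHS]scale1r => /solP sx.
pose z j := Num.floor (hom 1 x j).
have yz j : (j <= p)%N -> hom 1 x j = (z j)%:~R.
  by move=> jp; rewrite floorK // hom_mixed.
have z0 : z 0%N = 1 by apply: (@intr_inj R); rewrite -yz.
have zl : lead_zero (m + 0) (fun k => if (k < m)%N then 0 else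
    (act p cp (k - m)%N)%:Z * z (k - m)%N).
  by move=> k; rewrite addn0 => ->.
have := row_dvd rows (lead_bound (leq0n n)) (integral_lat ok sx yz) zl.
have := row_pos rows (lead_bound (leq0n n)).
rewrite addn0 ltnn subnn /act cp0 /= mul1r z0 dvdz1.
by lia.
Qed.

Definition particular : 'cV[rat]_n := \col_i entry i.+1 0.

Definition directions : 'M[rat]_(n, n - \rank W) :=
  \matrix_(i, k) entry i.+1 (nth 0%N (free_cols n cp) k).

Hypothesis lead1 : H m m = 1.
Hypothesis ok : feasible_rows.

Lemma entry_lead c : (c <= n)%N -> entry 0 c = (c == 0%N)%:R.
Proof.
move=> cn; rewrite entry_free //; case: c cn => [|c] cn; first by rewrite !addn0 lead1.
by rewrite row_low.
Qed.

Lemma particular_sol : affine_space W w (map_mx ratr particular : 'cV[R]_n).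
Proof.
rewrite /affine_space /= -[RHS]scale1r; apply/solP => i im.
rewrite -[RHS](entry_sol (leq0n n) cp0 (fun _ => ok) im).
apply: eq_bigr => -[[|j] hj] _ /=; first by rewrite entry_lead // rmorph1.
by rewrite (hom_ord _ _ (Ordinal (hj : (j < n)%N))) !mxE.
Qed.

Lemma directions_ker : map_mx ratr W *m map_mx ratr directions = 0 :> 'M[R]_(m, _).
Proof.
apply/matrixP => i k; have [/andP[c0 cn] cc] := free_cols_mem piv Q0 T0W (ltn_ord k).
set c := nth _ _ _ in c0 cn cc.
have : map_mx ratr W *m map_mx ratr (col k directions) = 0 *: map_mx ratr w :> 'cV[R]_m.
  apply/solP => {}i im; have nc : c == 0%N -> forall i, (i < m)%N -> rp i = 0%N -> T i 0%N = 0.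
    by move/eqP => c00; rewrite c00 in c0.
  rewrite -[RHS](entry_sol cn cc nc im).
  apply: eq_bigr => -[[|j] hj] _ /=.
    by rewrite entry_lead // gtn_eqF // rmorph0.
  by rewrite (hom_ord _ _ (Ordinal (hj : (j < n)%N))) !mxE.
rewrite scale0r => /matrixP/(_ i 0); rewrite !mxE => e; rewrite -[RHS]e.
by apply: eq_bigr => j _; rewrite !mxE.
Qed.

(** On the rows of the free variables the entries are those of [H], a triangular matrix with
    positive diagonal. *)
Lemma directions_rank : \rank directions = (n - \rank W)%N.
Proof.
apply/eqP; rewrite eqn_leq rank_leq_col /=.
have mem (k : 'I_(n - \rank W)) := free_cols_mem piv Q0 T0W (ltn_ord k).
have [n'0|n'0] := posnP (n - \rank W)%N; first by rewrite [X in (X <= _)%N]n'0.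
have n0 : (0 < n)%N by lia.
pose f (k : 'I_(n - \rank W)) : 'I_n :=
  insubd (Ordinal n0) (nth 0%N (free_cols n cp) k).-1.
have fE k : (f k).+1 = nth 0%N (free_cols n cp) k.
  have [/andP[h1 h2] _] := mem k; rewrite /f val_insubd.
  by have -> : ((nth 0%N (free_cols n cp) k).-1 < n)%N by [lia]; lia.
pose S := rowsub f directions.
have SE i k : S i k = (H (m + nth 0%N (free_cols n cp) k) (m + nth 0%N (free_cols n cp) i))%:~R.
  by rewrite !mxE fE entry_free //; case: (mem i).
have Su : S \in unitmx.
  rewrite unitmxE unitfE det_trig.
    apply/prodf_neq0 => i _; rewrite SE intr_eq0 gt_eqF //.
    by apply: (row_pos rows); case: (mem i) => /andP[_ h] _; apply: lead_bound.
  apply/is_trig_mxP => i k ik; rewrite SE row_low //.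
    by case: (mem k) => /andP[].
  exact: (free_cols_mono piv Q0 T0W).
apply: (@leq_trans (\rank S)); first by rewrite mxrank_unit.
by rewrite /S rowsubE mxrankM_maxr.
Qed.

(** The directions lie in the kernel of [W] and their rank equals its dimension, so they span it. *)
Lemma affine_range :
  affine_space W w = (range (@affine_map R n _ particular directions))%classic.
Proof.
apply/seteqP; split=> [x Ax|_ [y _ <-]]; last first.
  rewrite /affine_map /affine_space /= mulmxDr mulmxA directions_ker mul0mx addr0.
  exact: particular_sol.
pose WR : 'M[R]_(m, n) := map_mx ratr W.
pose MR : 'M[R]_(n, _) := map_mx ratr directions.
have sub : (MR^T <= kermx WR^T)%MS.
  by apply/sub_kermxP; rewrite -trmx_mul directions_ker trmx0.
have : (kermx WR^T <= MR^T)%MS.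
  rewrite -(mxrank_leqif_sup sub) mxrank_ker !mxrank_tr !mxrank_map.
  by rewrite directions_rank.
have xk : ((x - map_mx ratr particular)^T <= kermx WR^T)%MS.
  apply/sub_kermxP; rewrite -trmx_mul mulmxBr particular_sol.
  by rewrite Ax subrr trmx0.
move=> /(submx_trans xk)/submxP[y ey]; exists y^T => //.
have e : MR *m y^T = x - map_mx ratr particular.
  by rewrite -[LHS]trmxK trmx_mul trmxK -ey trmxK.
by rewrite /affine_map e addrC subrK.
Qed.

Lemma affine_coord (y : 'cV[R]_(n - \rank W)) j : (j <= n)%N ->
  hom 1 (affine_map particular directions y) j =
  ratr (entry j 0) + \sum_(k < n - \rank W) ratr (entry j (nth 0%N (free_cols n cp) k)) * y k 0.
Proof.
move=> jn; case: j jn => [|j] jn.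
  rewrite entry_lead // rmorph1 big1 ?addr0 // => k _.
  have [/andP[c0 cn] _] := free_cols_mem piv Q0 T0W (ltn_ord k).
  by rewrite entry_lead // gtn_eqF // rmorph0 mul0r.
rewrite (hom_ord _ _ (Ordinal (jn : (j < n)%N))) !mxE; congr (_ + _).
by apply: eq_bigr => k _; rewrite !mxE.
Qed.

Let act_free c : (c <= n)%N -> ~~ act p cp c -> cp c != 0%N \/ (p < c)%N.
Proof. by move=> _; rewrite negb_and -ltnNge => /orP[]; [right|left]. Qed.

Let row_inactive c j : (c <= n)%N -> (j <= n)%N -> cp c = 0%N ->
  ~~ act p cp j -> j != c -> H (m + c) (m + j) = 0.
Proof.
move=> cn jn cc nj jc; have [cj|pj] := act_free jn nj; first exact: row_pivot.
exact: row_cont.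
Qed.

(* Column by column, the integrality of [y] follows because the leading entry of
   a row divides the corresponding entry of the vector that remains. *)
Lemma mixed_reduced (y : 'cV[R]_(n - \rank W)) :
  mixed R n p (affine_map particular directions y) ->
  mixed R _ (reduced_nints p W) y.
Proof.
move=> mx; set x := affine_map _ _ _ in mx.
have Ax : affine_space W w x by rewrite affine_range; exists y.
have sx : sol (hom 1 x) by apply/solP; rewrite scale1r.
pose z j := Num.floor (hom 1 x j).
have yz j : (j <= p)%N -> hom 1 x j = (z j)%:~R.
  by move=> jp; rewrite floorK // hom_mixed.
pose fc k := nth 0%N (free_cols n cp) k.
have memk (k : 'I_(n - \rank W)) := free_cols_mem piv Q0 T0W (ltn_ord k).
(* [v] is what remains of the lattice vector of [x] after removing the particular row and the first
   [k] directions. *)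
have main k : (k <= n - \rank W)%N -> (k <= reduced_nints p W)%N ->
  (forall i : 'I_(n - \rank W), (i < k)%N -> y i 0 \is a Num.int) /\
  exists v : nat -> int, [/\ lat m n p E T rp cp v,
    forall i, (i < m)%N -> v i = 0,
    forall j, (j <= n)%N -> ~~ act p cp j -> v (m + j)%N = 0 &
    forall j, (j <= n)%N -> act p cp j -> (v (m + j)%N)%:~R =
      \sum_(i < n - \rank W | (k <= i)%N) (H (m + fc i) (m + j))%:~R * y i 0].
  elim: k => [|k ih] kn kp.
    split=> //; have lz := integral_lat ok sx yz.
    (* Row [m] lies behind [particular]; removing it leaves the contribution of the directions. *)
    have := lat_lin (-1) lz (row_in rows (lead_bound (leq0n n))).
    set v := (fun j => _) => lv; exists v; split=> //.
    - by move=> i im; rewrite /v im row_head // mulr0 addr0.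
    - move=> j jn nj; have j0 : j != 0%N by apply: contraNneq nj => ->; rewrite /act cp0 leq0n.
      rewrite /v ltnNge leq_addr /= addKn (negPf nj) mul0r add0r.
      by rewrite row_inactive ?mulr0.
    - move=> j jn aj; rewrite /v ltnNge leq_addr /= addKn aj mul1r mulN1r intrB.
      have /andP[jp /eqP cj] := aj.
      rewrite -yz // /x affine_coord // entry_free // ratr_int addrC addKr.
      by apply: eq_bigr => i _; rewrite entry_free // ratr_int.
  have [iy [v [lv v0 vn va]]] := ih (ltnW kn) (ltnW kp).
  pose ko := Ordinal kn; have [/andP[c0 cn] cc] := memk ko.
  have cp' : (fc k <= p)%N by rewrite /fc (free_cols_int piv p Q0 T0W).
  have ak : act p cp (fc k) by rewrite /act cp' cc eqxx.
  have later (i : 'I_(n - \rank W)) : (k <= i)%N -> i != ko -> (fc k < fc i)%N.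
    move=> ki ne; apply: (free_cols_mono piv Q0 T0W) => //; rewrite ltn_neqAle ki andbT.
    by apply: contraNneq ne => e; apply/eqP/val_inj.
  have vl : lead_zero (m + fc k) v.
    move=> i; case: (ltnP i m) => im; first by rewrite v0.
    have [j ->] : exists j, i = (m + j)%N by exists (i - m)%N; lia.
    rewrite ltn_add2l => jc; have jn : (j <= n)%N by apply: ltnW (leq_trans jc cn).
    have [aj|nj] := boolP (act p cp j); last exact: vn.
    apply: (@intr_inj R); rewrite va // big1 // => l kl.
    have [/andP[_ ln] _] := memk l; rewrite row_low ?mul0r //.
    have [->//|ne] := eqVneq l ko; apply: ltn_trans jc _; exact: later.
  have sumk j : \sum_(i < n - \rank W | (k <= i)%N) (H (m + fc i) (m + j))%:~R * y i 0 =
      (H (m + fc k) (m + j))%:~R * y ko 0 +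
      \sum_(i < n - \rank W | (k < i)%N) (H (m + fc i) (m + j))%:~R * y i 0.
    rewrite (bigD1 ko) //=; congr (_ + _); apply: eq_bigl => l.
    by rewrite ltn_neqAle andbC eq_sym.
  have /dvdzP[q eq] := row_dvd rows (lead_bound cn) lv vl.
  (* At coordinate [m + fc k] all later rows vanish, so [v] equals [H] times [y ko 0] there, and [H]
     divides [v]. *)
  have yq : y ko 0 = q%:~R.
    have := va _ cn ak; rewrite sumk big1 ?addr0 => [|l kl]; last first.
      have [/andP[_ ln] _] := memk l; rewrite row_low ?mul0r //.
      by apply: later (ltnW kl) _; apply/eqP => e; rewrite e ltnn in kl.
    rewrite eq intrM mulrC => /mulfI -> //.
    by rewrite intr_eq0 gt_eqF // (row_pos rows) // lead_bound.
  split=> [i|].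
    rewrite ltnS leq_eqVlt => /orP[/eqP ik|]; last exact: iy.
    have -> : i = ko by apply: val_inj.
    by rewrite yq intr_int.
  exists (fun j => v j + (- q) * H (m + fc k) j); split.
  - by apply: lat_lin => //; apply: (row_in rows); apply: lead_bound.
  - by move=> i im; rewrite v0 // row_head // mulr0 addr0.
  - move=> j jn nj; rewrite vn // row_inactive ?mulr0 ?addr0 //.
    by apply: contraNneq nj => ->.
  - move=> j jn aj; rewrite intrD va // sumk yq intrM rmorphN /=; ring.
move=> i ip; have [h _] := main i.+1 (ltn_ord i) ip.
exact: h.
Qed.

Lemma mixed_affine (y : 'cV[R]_(n - \rank W)) :
  mixed R _ (reduced_nints p W) y ->
  mixed R n p (affine_map particular directions y).
Proof.
move=> my i ip; rewrite -(hom_ord 1) affine_coord //; apply: rpredD.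
  by apply: ratr_is_int; rewrite entry_int.
apply: rpred_sum => k _; have [/andP[c0 cn] cc] := free_cols_mem piv Q0 T0W (ltn_ord k).
have [kp|kp] := leqP (nth 0%N (free_cols n cp) k) p; last first.
  by rewrite entry_cont ?kp // rmorph0 mul0r rpred0.
apply: rpredM; first by apply: ratr_is_int; rewrite entry_int.
by apply: my; rewrite -(free_cols_int piv p Q0 T0W).
Qed.

Lemma mixed_range : (affine_space W w `&` mixed R n p =
  affine_map particular directions @` mixed R _ (reduced_nints p W))%classic.
Proof.
rewrite affine_range; apply/seteqP; split=> [_ [[y _ <-] mx]|_ [y my <-]].
  by exists y => //; apply: mixed_reduced.
by split; [exists y|apply: mixed_affine].
Qed.

Lemma particular_mixed : mixed rat n p particular.
Proof. by move=> i ip; rewrite mxE entry_int. Qed.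

End Solution.

(** * Reduced fractions, and the strict inequality for p' *)

Lemma numq_denq_gcd (z E : int) : 0 < E ->
  numq (z%:~R / E%:~R) = (z %/ gcdz z E)%Z /\
  denq (z%:~R / E%:~R) = (E %/ gcdz z E)%Z.
Proof.
move=> E0; set g := gcdz z E.
have g0 : 0 < g by rewrite lt_def gcdz_eq0 negb_and (gt_eqF E0) orbT.
have zg : (z %/ g)%Z * g = z by apply: divzK; apply: dvdz_gcdl.
have Eg : (E %/ g)%Z * g = E by apply: divzK; apply: dvdz_gcdr.
have e0 : 0 < (E %/ g)%Z by rewrite -(pmulr_lgt0 _ g0) Eg.
have cop : coprime `|(z %/ g)%Z| `|(E %/ g)%Z|.
  have : gcdz (z %/ g)%Z (E %/ g)%Z * g = g.
    by rewrite -[X in _ * X](gtr0_norm g0) -abszE mulz_gcdl zg Eg.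
  rewrite -[RHS]mul1r => /(mulIf (lt0r_neq0 g0)) h.
  by rewrite /coprime -eqz_nat; apply/eqP.
have -> : z%:~R / E%:~R = (z %/ g)%Z%:~R / (E %/ g)%Z%:~R :> rat.
  rewrite -{1}zg -{1}Eg !intrM invfM mulrACA divff ?mulr1 //.
  by rewrite intr_eq0 gt_eqF.
rewrite coprimeq_num // coprimeq_den // gtr0_sg // mul1r gt_eqF //.
by split=> //; rewrite gtr0_norm.
Qed.

Lemma last_colsE (m n : nat) (p : 'I_n.+1) (W : 'M[rat]_(m, n)) :
  exists S, last_cols p W = W *m S.
Proof.
pose g (j : 'I_(n - p)) := cast_ord (subnKC (leq_ord p)) (rshift p j).
exists (colsub g 1%:M); rewrite mulmx_colsub mulmx1.
by apply/matrixP => i j; rewrite !mxE castmxE /= cast_ord_id; congr (W _ _); apply: val_inj.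
Qed.

(** Write [d] as a combination [y] of the rows of [W]. Then [y] annihilates the block [B] but not
    [W], so the left kernel of [B] is strictly larger and its rank strictly smaller. *)
Lemma reduced_nints_lt (R : realType) (m n : nat) (W : 'M[rat]_(m, n))
    (w : 'cV[rat]_m) (p : 'I_n.+1) (d : 'cV[R]_n) (beta : R) :
  (exists x : 'cV[R]_n, affine_space W w x) -> d != 0 ->
  (forall i : 'I_n, (p <= i)%N -> d i 0 = 0) ->
  (forall x : 'cV[R]_n, affine_space W w x -> (d^T *m x) 0 0 = beta) ->
  (reduced_nints p W < p)%N.
Proof.
move=> [x0 Ax0] d0 dz hd; pose WR : 'M[R]_(m, n) := map_mx ratr W.
(* Needed because of truncated subtraction; for [p = 0] all of [d] would vanish. *)
have p0 : (0 < p)%N.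
  rewrite lt0n; apply: contraNneq d0 => p0; apply/eqP/colP => i.
  by rewrite mxE dz // p0.
(* Translating a solution by a kernel vector of [W] keeps the value [beta]; so [d] is orthogonal to
   the kernel and lies in the row space. *)
have /submxP[y ey] : (d^T <= WR)%MS.
  rewrite submxE; apply/eqP/rowP => j; rewrite [RHS]mxE.
  have Ax1 : affine_space W w (x0 + col j (cokermx WR)).
    rewrite /affine_space /= mulmxDr Ax0 -/WR colE mulmxA mulmx_coker.
    by rewrite mul0mx addr0.
  have := hd _ Ax1; rewrite mulmxDr mxE hd // colE mulmxA -colE mxE.
  by move/(canRL (addKr _)); rewrite addNr.
have [S eS] := last_colsE p W.
pose BR : 'M[R]_(m, n - p) := map_mx ratr (last_cols p W).
have eB : BR = WR *m map_mx ratr S by rewrite /BR eS map_mxM.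
have yB : (y <= kermx BR)%MS.
  apply/sub_kermxP; apply/rowP => j; rewrite [RHS]mxE.
  have -> : (y *m BR) 0 j = (y *m WR) 0 (cast_ord (subnKC (leq_ord p)) (rshift p j)).
    rewrite !mxE; apply: eq_bigr => k _; rewrite !mxE castmxE /= cast_ord_id.
    by congr (_ * ratr (W _ _)); apply: val_inj.
  by rewrite -ey mxE dz //= leq_addr.
have yW : ~~ (y <= kermx WR)%MS.
  apply/negP => /sub_kermxP; rewrite -ey => /(congr1 trmx); rewrite trmxK trmx0.
  by move/eqP; rewrite (negPf d0).
have lt : (kermx WR < kermx BR)%MS.
  rewrite ltmxE; apply/andP; split.
    by apply/sub_kermxP; rewrite eB mulmxA mulmx_ker mul0mx.
  by apply: contra yW; apply: submx_trans.
have := rank_ltmx lt; rewrite !mxrank_ker !mxrank_map /reduced_nints.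
have := rank_leq_row (last_cols p W); have := rank_leq_row W.
move: (\rank _) (\rank _) => a b; lia.
Qed.

(** * The program *)

(* [aT] holds the matrix and [vD] its common denominator; column 0 of the matrix
   is [-w] and column [j.+1] is column [j] of [W].  [aRp] and [aCp] hold [rp] and
   [cp], [aV] the lattice generators and [aH] the echelon rows.  Names starting
   with [v] are scalars, kept in cell 0 of their array. *)
Definition aIn := 0%N.
Definition aOut := 1%N.
Definition vm := 2%N.
Definition vn := 3%N.
Definition vp := 4%N.
Definition vQ := 5%N.
Definition aT := 6%N.
Definition vD := 7%N.
Definition aRp := 8%N.
Definition aCp := 9%N.
Definition vi := 10%N.
Definition vj := 11%N.
Definition vk := 12%N.
Definition vc := 13%N.
Definition vr := 14%N.
Definition vP := 15%N.
Definition vF := 16%N.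
Definition vok := 17%N.
Definition vE := 18%N.
Definition vsg := 19%N.
Definition aV := 20%N.
Definition aH := 21%N.
Definition vq := 22%N.
Definition vt := 23%N.
Definition vfree := 24%N.
Definition vo := 25%N.
Definition vsum := 26%N.
Definition vx := 27%N.
Definition vy := 28%N.
Definition vl := 29%N.

Lemma smallP (b : nat) (z : int) : small b z <-> `|z| < (2 ^ b)%N%:Z.
Proof. by rewrite /small; lia. Qed.

Lemma small_int (b : nat) (z : int) : `|z| < (2 ^ b)%N%:Z -> small b z.
Proof. by move/smallP. Qed.

Ltac ev := rewrite ?evalE; rd.

(* The place of the numerator in row [vi] and column [vj] of [-w | W]; the
   denominator follows it. *)
Definition address : expr :=
  (eqe $vj #0 * (#5 + #2 * $vm * $vn + #2 * $vi) +
   lt #0 $vj * (#3 + #2 * ($vi * $vn + $vj - #1)))%E.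

(** Cell 0 holds the list length and each encoded matrix starts with its two dimensions: [W] begins
    at cell 3, [w] at cell [5 + 2 * m * n]. *)
Definition offset (m n i c : nat) : nat :=
  if c is c'.+1 then (3 + 2 * (i * n + c'))%N else (5 + 2 * m * n + 2 * i)%N.

Lemma eval_address (s : state) (m n i c : nat) : s vm 0 = m -> s vn 0 = n ->
  s vi 0 = i -> s vj 0 = c -> eval s address = offset m n i c.
Proof.
rewrite /address !evalE => -> -> -> ->; case: c => [|c] /=; last by lia.
by rewrite mul1r mul0r addr0; lia.
Qed.

(** * Clearing denominators *)

Definition read_input : cmd :=
  Set_ vm (Get aIn #1);; Set_ vn (Get aIn #2);;
  Set_ vp (Get aIn (#5 + #2 * $vm * $vn + #2 * $vm));;
  Set_ vQ #1;;
  For vi $vm (For vj ($vn + #1) (Set_ vQ ($vQ * Get aIn (address + #1))));;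
  For vi $vm (For vj ($vn + #1) (Put aT (pr $vi $vj)
    ((#1 - #2 * eqe $vj #0) * Get aIn address * ($vQ / Get aIn (address + #1)))));;
  Set_ vD #1.

Definition negate_first (c : nat) : int := if c is 0%N then -1 else 1.

(** The common denominator is the plain product of all [m * n.+1] denominators. With one numerator
    that makes [(m * n.+1).+1] factors of [Z] bits each. *)
Lemma wp_read_input (b Z m n p : nat) (num den : nat -> nat -> int) (s : state)
    (Q : state -> Prop) :
  (m <= b)%N -> (n < b)%N -> (p <= b)%N -> (Z * (m * n.+1).+1 < b)%N ->
  s aIn 1 = m -> s aIn 2 = n -> s aIn (5 + 2 * m * n + 2 * m)%N = p ->
  (forall i c, (i < m)%N -> (c <= n)%N -> s aIn (offset m n i c) = num i c /\
     s aIn (offset m n i c).+1 = den i c) ->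
  (forall i c, (i < m)%N -> (c <= n)%N -> `|num i c| < (2 ^ Z)%N%:Z /\
     0 < den i c < (2 ^ Z)%N%:Z) ->
  (forall s' (q : int), framed [:: vm; vn; vp; vQ; vi; vj; aT; vD] s s' ->
    s' vm 0 = m -> s' vn 0 = n -> s' vp 0 = p -> s' vD 0 = 1 -> 0 < q ->
    (forall i c, (i < m)%N -> (c <= n)%N ->
      [/\ s' aT (pair i c) = negate_first c * num i c * (q %/ den i c)%Z,
      (den i c %| q)%Z & `|s' aT (pair i c)| <= (2 ^ (Z * (m * n.+1).+1))%N%:Z]) ->
    Q s') ->
  wp b read_input Q s.
Proof.
move=> mb nb pb Zb e1 e2 e3 hin hb hq.
have b0 : (0 < b)%N by lia.
apply/wp_then/(@wp_set m); [by ev|exact: small_nat|].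
apply/wp_then/(@wp_set n); [by ev|by apply: small_nat; lia|].
apply/wp_then/(@wp_set p); [|exact: small_nat|].
  by ev; rewrite -e3; congr (s _ _); lia.
apply/wp_then/(@wp_set 1); [by ev|exact: small_nat|].
set s1 := update _ vQ _ _.
have f1 : framed [:: vm; vn; vp; vQ; vi; vj; aT; vD] s s1 by rewrite /s1; frm.
have m1 : s1 vm 0 = m by rewrite /s1; rd.
have n1 : s1 vn 0 = n by rewrite /s1; rd.
have p1 : s1 vp 0 = p by rewrite /s1; rd.
have Q1 : s1 vQ 0 = 1 by rewrite /s1; rd.
clearbody s1.
pose bnd k := (2 ^ (Z * k))%N%:Z.
pose J i j (s' : state) := [/\ 0 < s' vQ 0, s' vQ 0 <= bnd (i * n.+1 + j)%N &
  forall k c, (k < m)%N -> (c <= n)%N -> (k < i)%N || (k == i) && (c < j)%N ->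
    (den k c %| s' vQ 0)%Z].
have bS k : bnd k.+1 = bnd k * (2 ^ Z)%N%:Z.
  by rewrite /bnd mulnS addnC expnD PoszM.
apply/wp_then/(@wp_for [:: vi; vj; vQ] (fun i => J i 0%N) m) => //.
- by move=> s' fr; ev.
- rewrite /J; ev; rewrite Q1; split=> //; first by rewrite /bnd muln0.
  by move=> k c _ _; rewrite ltn0 andbF.
- move=> i s2 im f2 i2 [q1 q2 q3].
  apply: (@wp_for [:: vj; vQ] (J i) n.+1) => //.
  + by move=> s' fr; ev; rewrite n1; lia.
  + move=> j s3; rewrite ltnS => jn f3 j3 [r1 r2 r3].
    have [_ h1] := hin i j im jn; have [_ /andP[h2 h3]] := hb i j im jn.
    have ea : eval s3 address = offset m n i j by apply: eval_address; ev.
    have q3b : s3 vQ 0 * den i j <= bnd (i * n.+1 + j.+1)%N.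
      by rewrite addnS bS; nia.
    apply: (@wp_set (s3 vQ 0 * den i j)).
    * by rewrite ?(ea, evalE); rd; rewrite -h1; congr (_ * s _ _); lia.
    * apply: small_int; rewrite gtr0_norm; last by nia.
      apply: le_lt_trans q3b _; rewrite /bnd ltz_nat ltn_exp2l //.
      apply: leq_ltn_trans Zb; rewrite leq_mul2l; apply/orP; right.
      by nia.
    * split; [by frm|by ev|rewrite /J; ev; split=> //; first by nia].
      move=> k c km cn; rewrite ltnS => hk.
      have [e|ne] := eqVneq (k, c) (i, j); first by case: e => -> ->; rewrite dvdz_mull.
      rewrite dvdz_mulr // r3 //.
      case/orP: hk => [->//|/andP[/eqP ki]]; rewrite ki eqxx leq_eqVlt.
      by case/orP=> [/eqP cj|->]; [rewrite ki cj eqxx in ne|rewrite orbT].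
  + move=> s3 f3 [r1 r2 r3]; split; [by frm|by ev|rewrite /J; ev; split=> //].
      by rewrite addn0 mulSn addnC.
    move=> k c km cn hk; apply: r3 => //; rewrite ltnS cn andbT.
    by move: hk; rewrite andbF orbF ltnS leq_eqVlt orbC.
move=> s2 f2 [q1 q2 q3].
have dq i c : (i < m)%N -> (c <= n)%N -> (den i c %| s2 vQ 0)%Z.
  by move=> im cn; apply: q3; rewrite ?im.
pose f i c := negate_first c * num i c * (s2 vQ 0 %/ den i c)%Z.
have fb i c : (i < m)%N -> (c <= n)%N -> `|f i c| <= (2 ^ (Z * (m * n.+1).+1))%N%:Z.
  move=> im cn; have [h1 /andP[h2 h3]] := hb i c im cn.
  have := divzK (dq i c im cn); rewrite /f !normrM.
  have -> : `|negate_first c| = 1 by case: (c).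
  move: (_ %/ _)%Z => u eu; rewrite -/(bnd (m * n.+1).+1) bS.
  have u0 : 0 < u by rewrite -(pmulr_lgt0 _ h2) eu.
  rewrite mul1r (gtr0_norm u0) mulrC ler_pM //; [by rewrite ltW| |by rewrite ltW].
  rewrite addn0 in q2; apply: le_trans q2; rewrite -eu ler_peMr //; first by rewrite ltW.
apply/wp_then/(@wp_fill2 m n.+1 _ _ _ _ _ _ _ f) => //.
- by move=> s' fr; ev.
- by move=> s' fr; ev; rewrite n1; lia.
- move=> i j s3 im; rewrite ltnS => jn fr i3 j3 _.
  have [h0 h1] := hin i j im jn.
  have ea : eval s3 address = offset m n i j by apply: eval_address; ev.
  split.
    rewrite ?(ea, evalE); rd; rewrite j3 h0.
    have -> : (offset m n i j)%:Z + 1 = (offset m n i j).+1 by lia.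
    by rewrite h1 /f; congr (_ * _ * _); case: (j).
  apply: small_int; apply: le_lt_trans (fb i j im jn) _.
  by rewrite ltz_nat ltn_exp2l.
move=> s3 f3 h3; apply: (@wp_set 1); [by ev|exact: small_nat|].
apply: (hq _ (s2 vQ 0)); try (by ev); first by frm.
by move=> i c im cn; ev; rewrite h3 //; split; [by []|exact: dq|exact: fb].
Qed.

(** * The elimination program *)

Definition pivot : cmd :=
  Set_ vP (Get aT (pr $vr $vc));;
  For vi $vm (If (eqe $vi $vr) Skip
    (Set_ vF (Get aT (pr $vi $vc));;
     For vj ($vn + #1) (Put aT (pr $vi $vj)
       ((Get aT (pr $vi $vj) * $vP - $vF * Get aT (pr $vr $vj)) / $vD))));;
  Set_ vD $vP;; Put aRp $vr $vc;; Put aCp $vc ($vr + #1).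

Definition mat (s : state) (a i j : nat) : int := s a (pair i j).

Lemma mat_eq (s : state) (a : nat) (f : nat -> nat -> int) :
  (forall i j, s a (pair i j) = f i j) -> mat s a = f.
Proof.
by move=> h; apply: boolp.funext => i; apply: boolp.funext => j; apply: h.
Qed.

Lemma eval_mat (s : state) (a : nat) (x y : expr) (i j : nat) :
  eval s x = i -> eval s y = j -> eval s (Get a (pr x y)) = mat s a i j.
Proof. by move=> ex ey; rewrite eval_get (eval_pr ex ey). Qed.

(** The pass works in place: row [r] is skipped and stays readable, [vF] keeps the entry that the
    inner loop overwrites at [j = c], and [vD] is replaced only afterwards. Smallness of the result
    is a hypothesis because it follows from minors, not from the formula. *)
Lemma wp_pivot (b m n r c : nat) (Q : state -> Prop) (s : state) :
  (m <= b)%N -> (n < b)%N -> (r < m)%N -> (c <= n)%N ->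
  s vm 0 = m -> s vn 0 = n -> s vr 0 = r -> s vc 0 = c ->
  let T' i j := if i == r then mat s aT r j else
    ((mat s aT i j * mat s aT r c - mat s aT i c * mat s aT r j) %/ s vD 0)%Z in
  (forall i j, (i < m)%N -> (j <= n)%N -> small b (mat s aT i j)) ->
  (forall i j, (i < m)%N -> (j <= n)%N -> small b (T' i j)) ->
  (forall s', framed [:: vP; vi; vF; vj; aT; vD; aRp; aCp] s s' ->
    (forall i j, (i < m)%N -> (j <= n)%N -> mat s' aT i j = T' i j) ->
    s' vD 0 = mat s aT r c ->
    (forall i : nat, s' aRp i = if i == r then c%:Z else s aRp i) ->
    (forall i : nat, s' aCp i = if i == c then r.+1%:Z else s aCp i) -> Q s') ->
  wp b pivot Q s.
Proof.
move=> mb nb rm cn em en er ec T' sT sT' hq.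
apply/wp_then/(@wp_set (mat s aT r c)); first by apply: eval_mat; ev.
  exact: sT.
set s1 := update _ _ _ _.
have f1 : framed [:: vP] s s1 by rewrite /s1; frm.
have P1 : s1 vP 0 = mat s aT r c by rewrite /s1; rd.
clearbody s1.
pose J k (s' : state) := forall i j, (i < m)%N -> (j <= n)%N ->
  mat s' aT i j = if (i < k)%N then T' i j else mat s aT i j.
apply/wp_then/(@wp_for [:: vi; vF; vj; aT] J m) => //.
- by move=> s' fr; ev.
- by move=> i j im jn; rewrite /mat; ev.
- move=> i s2 im f2 i2 h2.
  apply: (@wp_if (i == r)); first by ev; rewrite i2 er eqz_nat.
  case: eqP => [ir|/eqP ir].
    apply: wp_skip; split; [by frm|by ev|move=> x y xm yn; rewrite /mat; rd].
    rewrite -/(mat s2 aT x y) h2 // ltnS; case: (ltngtP x i) => //= xi.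
    by rewrite /T' xi ir eqxx.
  apply/wp_then/(@wp_set (mat s aT i c)).
  + rewrite (@eval_mat _ _ _ _ i c); last 2 first.
    * by ev.
    * by ev.
    by rewrite h2 // ltnn.
  + exact: sT.
  set s3 := update _ _ _ _.
  have f3 : framed [:: vF] s2 s3 by rewrite /s3; frm.
  have F3 : s3 vF 0 = mat s aT i c by rewrite /s3; rd.
  clearbody s3.
  apply: (@wp_fill n.+1 _ _ _ _ _ _ (fun j => pair i j) (T' i)) => //.
  + by move=> s' fr; ev; rewrite en; lia.
  + by move=> j j' /pairz_inj[].
  + move=> j s4; rewrite ltnS => jn f4 j4 h4.
    have same x y : (x == i -> (j <= y)%N) -> s4 aT (pair x y) = mat s2 aT x y.
      move=> xy; rewrite h4 ?f3 // => k kj; rewrite eqz_nat pair_inj.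
      by apply/negP => /andP[/xy jy /eqP yk]; lia.
    split; [by apply: eval_pr; ev| |exact: sT'].
    have eI : mat s4 aT i j = mat s aT i j by rewrite /mat same // -/(mat s2 aT i j) h2 // ltnn.
    have eR : mat s4 aT r j = mat s aT r j.
      rewrite /mat same; last by move=> /eqP e; rewrite e eqxx in ir.
      by rewrite -/(mat s2 aT r j) h2 //; case: ifP => // _; rewrite /T' eqxx.
    rewrite eval_div eval_sub !eval_mul (@eval_mat _ _ _ _ i j); try by ev.
    rewrite (@eval_mat _ _ _ _ r j); try by ev.
    by rewrite eI eR /T' (negPf ir); ev; rewrite F3 P1.
  + move=> s4 f4 h4 h4'; split; [by frm|by ev|].
    move=> x y xm yn; rewrite /mat; rd; case: (ltngtP x i) => xi.
    - rewrite h4' ?f3 // => [|k _]; last by rewrite eqz_nat pair_inj ltn_eqF.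
      by rewrite -/(mat s2 aT x y) h2 // xi leqW.
    - rewrite h4' ?f3 // => [|k _]; last by rewrite eqz_nat pair_inj gtn_eqF.
      by rewrite -/(mat s2 aT x y) h2 //; have [-> ->] : (x < i)%N = false /\ (x < i.+1)%N = false by lia.
    - by rewrite xi h4 // ltnSn.
- move=> s2 f2 h2.
  apply/wp_then/(@wp_set (mat s aT r c)); [by ev|exact: sT|].
  apply/wp_then/(@wp_put r c); [by ev|by ev|by apply: small_nat; lia|].
  apply: (@wp_put c r.+1); [by ev|by ev; rewrite er; lia|by apply: small_nat; lia|].
  apply: hq; first by frm.
  + by move=> i j im jn; rewrite /mat; rd; rewrite -/(mat s2 aT i j) h2 // im.
  + by rd.
  + by move=> i; rd; rewrite eqz_nat; case: eqP => // _; rd.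
  + by move=> i; rd; rewrite eqz_nat; case: eqP => // _; rd.
Qed.

(** At turn [k] the column is [n - k], so columns run from [n] down to 1 and column 0 is never
    chosen; [vr = m] signals that there is no pivot. *)
Definition find_pivot : cmd :=
  Set_ vc ($vn - $vk);; Set_ vr $vm;;
  For vi $vm (If (eqe (Get aRp $vi) #0 * (#1 - eqe (Get aT (pr $vi $vc)) #0))
    (Set_ vr $vi) Skip).

Definition pivoting : cmd :=
  For vk $vn (find_pivot;; If (lt $vr $vm) pivot Skip).

Lemma wp_find_pivot (b m n k : nat) (rp : nat -> nat) (Q : state -> Prop) (s : state) :
  (m <= b)%N -> (n < b)%N -> (k <= n)%N ->
  s vm 0 = m -> s vn 0 = n -> s vk 0 = k -> (forall i : nat, s aRp i = rp i) ->
  (forall s' r, framed [:: vc; vr; vi] s s' -> s' vc 0 = (n - k)%N ->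
     s' vr 0 = Posz r -> (r <= m)%N ->
     ((r < m)%N -> rp r = 0%N /\ mat s aT r (n - k) != 0) ->
     (r = m -> forall i, (i < m)%N -> rp i = 0%N -> mat s aT i (n - k) = 0) -> Q s') ->
  wp b find_pivot Q s.
Proof.
move=> mb nb kn em en ek erp hq; set c := (n - k)%N.
have cz : n%:Z - k%:Z = c by rewrite /c; lia.
apply/wp_then/(@wp_set c); [by ev; rewrite en ek|by apply: small_nat; lia|].
apply/wp_then/(@wp_set m); [by ev|exact: small_nat|].
set s1 := update _ _ _ _.
have f1 : framed [:: vc; vr] s s1 by rewrite /s1; frm.
have c1 : s1 vc 0 = c by rewrite /s1; rd.
have r1 : s1 vr 0 = m by rewrite /s1; rd.
clearbody s1.
pose J k (s' : state) := exists r, [/\ s' vr 0 = Posz r, (r <= m)%N,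
   (r < m)%N -> rp r = 0%N /\ mat s aT r c != 0 &
   r = m -> forall i, (i < k)%N -> rp i = 0%N -> mat s aT i c = 0].
apply: (@wp_for [:: vi; vr] J m) => //.
- by move=> s' fr; ev.
- by exists m; split; rewrite ?ltnn //; ev.
- move=> i s2 im f2 i2 [r [r2 rm h3 h4]].
  have et : eval s2 (eqe (Get aRp $vi) #0 * (#1 - eqe (Get aT (pr $vi $vc)) #0))%E
    = ((rp i == 0%N) && (mat s aT i c != 0))%:Z.
    rewrite eval_mul eval_sub !eval_eqe eval_const (@eval_mat _ _ _ _ i c); try by ev.
    by ev; rewrite i2 erp /mat; ev; rewrite eqz_nat; case: eqP; case: eqP.
  apply: (wp_if et); case: ifP => [/andP[/eqP h5 h6]|/negbT h5].
  + apply: (@wp_set i); [by ev|apply: small_nat; lia|].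
    split; [by frm|by ev|exists i; split; [by ev|exact: ltnW|by []|by lia]].
  + apply: wp_skip; split; [by frm|by ev|exists r; split; [by ev|by []|by []|]].
    move=> rm' x; rewrite ltnS leq_eqVlt => /orP[/eqP->|xi] rx; last exact: h4.
    by apply/eqP; move: h5; rewrite rx eqxx /= negbK.
- move=> s2 f2 [r [r2 rm h3 h4]]; apply: (hq s2 r) => //; first by frm.
  by ev.
Qed.

Lemma pivoted_ext (m n : nat) (a : int) (T0 T T' : nat -> nat -> int) (D : int)
    (rp cp : nat -> nat) (t : nat) :
  (forall i j, (i < m)%N -> (j <= n)%N -> T' i j = T i j) ->
  pivoted m n a T0 T D rp cp t -> pivoted m n a T0 T' D rp cp t.
Proof.
move=> eT [hE D0 hz hr hc hu].
have eM : mxfun m n.+1 T' = mxfun m n.+1 T.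
  by apply/matrixP => i j; rewrite !mxE eT // -ltnS ltn_ord.
split; rewrite ?eM //.
- by move=> i j im tj ij; rewrite eT ?hz //; case/andP: tj.
- by move=> r i rm im r0; have [/andP[_ ?] _] := hr r rm r0; rewrite eT ?hu.
Qed.

(** All intermediate tables obey the same minor bound, so a single [b] suffices for the whole
    elimination. *)
Lemma wp_pivoting (b m n : nat) (a : int) (Q : state -> Prop) (s : state) :
  (m <= b)%N -> (n < b)%N -> 1 <= a ->
  (forall i j, (i < m)%N -> (j <= n)%N -> `|mat s aT i j| <= a) ->
  m`!%:R * a ^+ m < (2 ^ b)%N%:Z ->
  s vm 0 = m -> s vn 0 = n -> s vD 0 = 1 ->
  (forall i : nat, s aRp i = 0) -> (forall i : nat, s aCp i = 0) ->
  (forall s' rp cp,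
    framed [:: vk; vc; vr; vP; vi; vF; vj; aT; vD; aRp; aCp] s s' ->
    pivoted m n a (mat s aT) (mat s' aT) (s' vD 0) rp cp 0 ->
    (forall i : nat, s' aRp i = rp i) -> (forall i : nat, s' aCp i = cp i) ->
    Q s') ->
  wp b pivoting Q s.
Proof.
move=> mb nb a1 sa hb em en eD eR eC hq.
pose J k (s' : state) := exists rp cp,
  [/\ pivoted m n a (mat s aT) (mat s' aT) (s' vD 0) rp cp (n - k),
      forall i : nat, s' aRp i = rp i & forall i : nat, s' aCp i = cp i].
apply: (@wp_for [:: vk; vc; vr; vP; vi; vF; vj; aT; vD; aRp; aCp] J n) => //.
- exact: ltnW.
- by move=> s' fr; ev.
- exists (fun _ => 0%N), (fun _ => 0%N); split.
  + by rewrite subn0; rd; rewrite eD; apply: pivoted_init.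
  + by move=> i; rd; rewrite eR.
  + by move=> i; rd; rewrite eC.
- move=> k s1 kn f1 k1 [rp [cp [piv hR hC]]].
  have nk : (n - k)%N = (n - k.+1).+1 by lia.
  have sm t (T : nat -> nat -> int) D r c : pivoted m n a (mat s aT) T D r c t ->
      forall i j, (i < m)%N -> (j <= n)%N -> small b (T i j).
    move=> /pivoted_bound/(_ sa)[_ h] i j im jn; apply: small_int.
    by apply: le_lt_trans (h i j im jn) _.
  apply: wp_then; apply: (@wp_find_pivot b m n k rp) => //; try by ev.
    exact: ltnW.
  move=> s2 r f2 c2 r2 rm h1 h2.
  have eT2 : mat s2 aT = mat s1 aT by apply: mat_eq => x y; rd.
  apply: (@wp_if (r < m)%N); first by ev; rewrite r2; ev; rewrite em ltz_nat.
  case: ltnP => rm'; last first.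
    apply: wp_skip; split; [by frm|by ev|exists rp, cp; split].
    + have -> : mat (update s2 vk 0 k.+1) aT = mat s1 aT by apply: mat_eq => x y; rd.
      rd; apply: pivoted_skip; rewrite -?nk // => i im ri; apply: h2 => //.
      by apply/eqP; rewrite eqn_leq rm.
    + by move=> i; rd.
    + by move=> i; rd.
  have [r0 Tr] := h1 rm'.
  rewrite nk in piv h1 Tr c2.
  pose T' i j := if i == r then mat s1 aT r j else
    ((mat s1 aT i j * mat s1 aT r (n - k.+1).+1 -
      mat s1 aT i (n - k.+1).+1 * mat s1 aT r j) %/ s1 vD 0)%Z.
  pose rp' i := if i == r then (n - k.+1).+1 else rp i.
  pose cp' c := if c == (n - k.+1).+1 then r.+1 else cp c.
  have piv' : pivoted m n a (mat s aT) T' (mat s1 aT r (n - k.+1).+1) rp' cp' (n - k.+1).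
    by apply: (pivoted_step piv) => //; lia.
  have eT' : (fun i j => if i == r then mat s2 aT r j else
    ((mat s2 aT i j * mat s2 aT r (n - k.+1).+1 -
      mat s2 aT i (n - k.+1).+1 * mat s2 aT r j) %/ s2 vD 0)%Z) = T'.
    by rewrite eT2 /T'; rd.
  apply: (@wp_pivot b m n r (n - k.+1).+1) => //; try by ev.
  + by lia.
  + by rewrite eT2; apply: (sm _ _ _ _ _ piv).
  + by move=> i j im jn; rewrite eT2; rd; apply: (sm _ _ _ _ _ piv' i j im jn).
  move=> s3 f3 hT hD hr hc; split; [by frm|by ev|exists rp', cp'; split].
  + rewrite /mat; rd; rewrite hD eT2.
    apply: pivoted_ext piv'.
    by move=> i j im jn; rd; rewrite -/(mat s3 aT i j) hT // eT2; rd.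
  + by move=> i; rd; rewrite hr /rp'; case: eqP => // _; rd.
  + by move=> i; rd; rewrite hc /cp'; case: eqP => // _; rd.
- move=> s1 f1 [rp [cp [piv hR hC]]]; apply: (hq s1 rp cp) => //.
  by rewrite subnn in piv.
Qed.

Definition check_rows : cmd :=
  Set_ vok #1;;
  For vi $vm (If (eqe (Get aRp $vi) #0 * (#1 - eqe (Get aT (pr $vi #0)) #0))
    (Set_ vok #0) Skip).

Lemma wp_check_rows (b m : nat) (rp : nat -> nat) (Q : state -> Prop) (s : state) :
  (m <= b)%N -> (0 < b)%N -> s vm 0 = m -> (forall i : nat, s aRp i = rp i) ->
  (forall s' (ok : bool), framed [:: vok; vi] s s' -> s' vok 0 = ok ->
     (ok <-> feasible_rows m (mat s aT) rp) -> Q s') ->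
  wp b check_rows Q s.
Proof.
move=> mb b0 em erp hq.
apply/wp_then/(@wp_set 1); [by ev|exact: small_nat|].
pose J k (s' : state) := exists ok : bool, s' vok 0 = ok /\
  (ok <-> forall i, (i < k)%N -> rp i = 0%N -> mat s aT i 0 = 0).
apply: (@wp_for [:: vi; vok] J m) => //.
- by move=> s' fr; ev.
- by exists true; split; [ev|split].
- move=> i s2 im f2 i2 [ok [e2 h2]].
  apply: (@wp_if ((rp i == 0%N) && (mat s aT i 0 != 0))).
    rewrite eval_mul eval_sub !eval_eqe eval_const (@eval_mat _ _ _ _ i 0); try by ev.
    by ev; rewrite i2 erp /mat; ev; rewrite eqz_nat; case: eqP; case: eqP.
  case: ifP => [/andP[/eqP h3 /eqP h4]|/negbT h3].
    apply: (@wp_set 0); [by ev|exact: small_nat|].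
    split; [by frm|by ev|exists false; split; [by ev|split=> // h]].
    by case: h4; apply: h.
  apply: wp_skip; split; [by frm|by ev|exists ok; split; [by ev|]].
  rewrite h2; split=> h x; last by move=> xi; apply: h; apply: leqW.
  rewrite ltnS leq_eqVlt => /orP[/eqP->|xi] rx; last exact: h.
  by apply/eqP; move: h3; rewrite rx eqxx /= negbK.
- by move=> s2 f2 [ok [e2 h2]]; apply: (hq s2 ok) => //; frm.
Qed.

(** The last pivot may be negative, whereas the lattice needs a positive modulus. *)
Definition split_sign : cmd :=
  If (#0 <= $vD)%E (Set_ vE $vD;; Set_ vsg #1)
    (Set_ vE (#0 - $vD);; Set_ vsg (Const (-1))).

Lemma wp_split_sign (b : nat) (Q : state -> Prop) (s : state) :
  (0 < b)%N -> small b (s vD 0) ->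
  (forall s', framed [:: vE; vsg] s s' -> s' vE 0 = `|s vD 0| ->
     s vD 0 = s' vsg 0 * s' vE 0 -> s' vsg 0 * s' vsg 0 = 1 -> Q s') ->
  wp b split_sign Q s.
Proof.
move=> b0 hs hq; apply: (@wp_if (0 <= s vD 0)); first by ev.
case: lerP => D0.
  apply/wp_then/(@wp_set (s vD 0)); [by ev|by []|].
  apply: (@wp_set 1); [by ev|exact: small_nat|].
  by apply: hq; [frm|rd; rewrite ger0_norm|rd; rewrite mul1r|rd].
apply/wp_then/(@wp_set (- s vD 0)); [by ev; rewrite sub0r| |].
  by move: hs; rewrite /small abszN.
apply: (@wp_set (-1)); [by ev|by apply: (@small_nat b 1)|].
by apply: hq; [frm|rd; rewrite ltr0_norm|rd; rewrite mulN1r opprK|rd].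
Qed.

(** * The echelon basis program *)

Definition generators : cmd :=
  For vk ($vn + #1) (For vj ($vm + $vn + #1) (Put aV (pr $vk $vj)
    (mode (($vk <= $vp) * eqe (Get aCp $vk) #0 *
      (lt $vj $vm * (Get aRp $vj <= $vp) * Get aT (pr $vj $vk) +
       eqe $vj ($vm + $vk))) $vE))).

Lemma wp_generators (b m n p : nat) (rp cp : nat -> nat) (Q : state -> Prop)
    (s : state) :
  (m + n < b)%N -> s vm 0 = m -> s vn 0 = n -> s vp 0 = p ->
  (forall i : nat, s aRp i = rp i) -> (forall i : nat, s aCp i = cp i) ->
  0 < s vE 0 -> small b (s vE 0) ->
  (forall s', framed [:: vk; vj; aV] s s' ->
    (forall k j, (k <= n)%N -> (j < m + n.+1)%N ->
      mat s' aV k j = gen_mod m p (s vE 0) (mat s aT) rp cp k j) -> Q s') ->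
  wp b generators Q s.
Proof.
move=> nb em en ep eR eC E0 Eb hq.
apply: (@wp_fill2 n.+1 (m + n.+1) _ _ _ _ _ _ _
  (gen_mod m p (s vE 0) (mat s aT) rp cp)) => //; try by lia.
- by move=> s' fr; ev; rewrite en; lia.
- by move=> s' fr; ev; rewrite em en; lia.
- move=> k j s2 kn jn f2 k2 j2 _; split.
    rewrite eval_mode !eval_mul eval_add !eval_mul (@eval_mat _ _ _ _ j k); try by ev.
    ev; rewrite k2 j2 eR eC em ep /mat; ev.
    rewrite !lez_nat ltz_nat /gen_mod /gen_col /act /mat.
    by rewrite -!PoszM !mulnb -!eqn_leq.
  have /andP[h1 h2] := gen_mod_bound m p (mat s aT) rp cp E0 k j.
  by move: Eb; rewrite /small; lia.
Qed.

(** The quotient is fixed before the loop, which overwrites both leading entries; each pair of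
    entries is exchanged through [vt]. *)
Definition euclid_step : cmd :=
  Set_ vq (Get aH (pr $vi $vi) / Get aV (pr $vk $vi));;
  For vj ($vm + $vn + #1)
    (Set_ vt (Get aH (pr $vi $vj));;
     Put aH (pr $vi $vj) (Get aV (pr $vk $vj));;
     Put aV (pr $vk $vj) (mode ($vt - $vq * Get aV (pr $vk $vj)) $vE)).

Definition echelonize : cmd :=
  For vi ($vm + $vn + #1)
    (For vj ($vm + $vn + #1) (Put aH (pr $vi $vj) (eqe $vj $vi * $vE));;
     For vk ($vn + #1) (While (Get aV (pr $vk $vi)) euclid_step)).

Lemma wp_euclid_step (b m n i k : nat) (Q : state -> Prop) (s : state) :
  (m + n < b)%N -> s vm 0 = m -> s vn 0 = n -> (i < m + n.+1)%N ->
  s vi 0 = i -> s vk 0 = k -> 0 < s vE 0 -> small b (s vE 0) ->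
  (forall j, (j < m + n.+1)%N -> 0 <= mat s aH i j <= s vE 0) ->
  (forall j, (j < m + n.+1)%N -> 0 <= mat s aV k j <= s vE 0) ->
  0 < mat s aV k i ->
  (forall s', framed [:: vq; vj; vt; aH; aV] s s' ->
    (forall j, (j < m + n.+1)%N -> mat s' aH i j = mat s aV k j) ->
    (forall j, (j < m + n.+1)%N -> mat s' aV k j =
      ((mat s aH i j - (mat s aH i i %/ mat s aV k i)%Z * mat s aV k j) %% s vE 0)%Z) ->
    (forall i' j, i' != i -> mat s' aH i' j = mat s aH i' j) ->
    (forall k' j, k' != k -> mat s' aV k' j = mat s aV k' j) -> Q s') ->
  wp b euclid_step Q s.
Proof.
move=> nb em en iN ei ek E0 Eb Hb Vb Vp hq.
have sE z : 0 <= z <= s vE 0 -> small b z by move: Eb; rewrite /small; lia.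
set q := (mat s aH i i %/ mat s aV k i)%Z in hq.
have q_s : small b q.
  apply: sE; have /andP[h1 h2] := Hb i iN.
  rewrite divz_ge0 // h1 /=; apply: le_trans h2; rewrite /q.
  by have := divz_eq (mat s aH i i) (mat s aV k i); have := @modz_ge0 (mat s aH i i) (mat s aV k i); nia.
apply/wp_then/(@wp_set q); last 1 first.
- set s1 := update _ _ _ _.
  have f1 : framed [:: vq] s s1 by rewrite /s1; frm.
  have q1 : s1 vq 0 = q by rewrite /s1; rd.
  clearbody s1.
  pose V' j := ((mat s aH i j - q * mat s aV k j) %% s vE 0)%Z.
  pose J j (s' : state) :=
    (forall x y, mat s' aH x y = if (x == i) && (y < j)%N then mat s aV k y else mat s aH x y) /\
    (forall x y, mat s' aV x y = if (x == k) && (y < j)%N then V' y else mat s aV x y).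
  apply: (@wp_for [:: vj; vt; aH; aV] J (m + n.+1)) => //.
  + by lia.
  + by move=> s' fr; ev; rewrite em en; lia.
  + by split=> x y; rewrite andbF /mat; rd.
  + move=> j s2 jN f2 j2 [hH hV].
    apply/wp_then/(@wp_set (mat s aH i j)); [|exact/sE/Hb|].
      rewrite (@eval_mat _ _ _ _ i j); try by ev.
      by rewrite hH ltnn andbF.
    apply/wp_then/(@wp_put (pair i j) (mat s aV k j)); [by apply: eval_pr; ev| |exact/sE/Vb|].
      rewrite (@eval_mat _ _ _ _ k j); try by ev.
      by rewrite /mat; rd; rewrite -/(mat s2 aV k j) hV ltnn andbF.
    apply: (@wp_put (pair k j) (V' j)); [by apply: eval_pr; ev| | |].
    * rewrite eval_mode eval_sub eval_mul (@eval_mat _ _ _ _ k j); try by ev.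
      rewrite /mat; ev; rewrite -/(mat s2 aV k j) hV ltnn andbF q1.
      by [].
    * by apply: sE; rewrite /V' modz_ge0 ?gt_eqF //= ltW // ltz_pmod.
    * split; [by frm|by ev|split=> x y; rewrite /mat; rd; rewrite eqz_nat pair_inj ltnS].
      - rewrite -/(mat s2 aH x y) hH.
        by case: (x =P i) => //= xi; case: (ltngtP y j) => //= ->.
      - rewrite -/(mat s2 aV x y) hV.
        by case: (x =P k) => //= xi; case: (ltngtP y j) => //= ->.
  + move=> s2 f2 [hH hV]; apply: hq; first by frm.
    * by move=> j jN; rewrite hH eqxx jN.
    * by move=> j jN; rewrite hV eqxx jN.
    * by move=> x j /negPf xi; rewrite hH xi.
    * by move=> x j /negPf xi; rewrite hV xi.
- rewrite eval_div (@eval_mat _ _ _ _ i i) // (@eval_mat _ _ _ _ k i) //.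
- exact: q_s.
Qed.

Section Echelonize.

Variables (b b' m n : nat) (E : int) (L : (nat -> int) -> Prop).
Hypothesis nb : (m + n < b)%N.
Hypothesis bb : (2 * b' < b)%N.
Hypothesis E0 : 0 < E.
Hypothesis Eb : E < (2 ^ b')%N%:Z.
Hypothesis L_ext : forall x y, (forall j, (j < m + n.+1)%N -> x j = y j) -> L x -> L y.
Hypothesis L_lin : forall c x y, L x -> L y -> L (fun j => x j + c * y j).
Hypothesis L_mod : forall w, L (fun j => E * w j).

Let ech := echelon (m + n.+1) n.+1 E L.
Let good i h := exists V, ech i h V /\ forall k, (k < n.+1)%N -> V k i = 0.

Lemma wp_euclid_loop (i k : nat) (Q : state -> Prop) (s : state) :
  s vm 0 = m -> s vn 0 = n -> s vE 0 = E -> (i < m + n.+1)%N -> (k <= n)%N ->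
  s vi 0 = i -> s vk 0 = k -> ech i (mat s aH i) (mat s aV) ->
  (forall s', framed [:: vq; vj; vt; aH; aV] s s' ->
    ech i (mat s' aH i) (mat s' aV) -> mat s' aV k i = 0 ->
    (forall i' j, i' != i -> mat s' aH i' j = mat s aH i' j) ->
    (forall k' j, k' != k -> mat s' aV k' j = mat s aV k' j) -> Q s') ->
  wp b (While (Get aV (pr $vk $vi)) euclid_step) Q s.
Proof.
move=> em en eE iN kn ei ek hech hq.
pose K x y (s' : state) := [/\ framed [:: vq; vj; vt; aH; aV] s s',
  ech i (mat s' aH i) (mat s' aV), mat s' aH i i = Posz x /\ mat s' aV k i = Posz y,
  (forall i' j, i' != i -> mat s' aH i' j = mat s aH i' j) &
  (forall k' j, k' != k -> mat s' aV k' j = mat s aV k' j)].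
have [x ex] : exists x, mat s aH i i = Posz x.
  by exists `|mat s aH i i|%N; rewrite gez0_abs // ltW // (ech_hi hech).
have [y ey] : exists y, mat s aV k i = Posz y.
  by exists `|mat s aV k i|%N; have /andP[h _] := ech_Vle hech kn iN; rewrite gez0_abs.
have xE := ech_hle hech iN; have yE := ech_Vle hech kn iN; rewrite ex in xE; rewrite ey in yE.
(* Both leading entries are at most [E < 2 ^ b'], so their product is below [2 ^ (2 * b')]. *)
apply: (@wp_euclid K _ (2 * b') x y) => //.
- have [h1 h2] : (x < 2 ^ b')%N /\ (y < 2 ^ b')%N by move: Eb xE yE; lia.
  by rewrite mul2n -addnn expnD; apply: ltn_mul.
- by move=> x' y' s' [f' _ [_ h] _ _]; rewrite (@eval_mat _ _ _ _ k i) //; ev.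
- move=> x' y' s' y0 [f' hech' [hx hy] hH hV].
  have Vp : 0 < mat s' aV k i by rewrite hy ltz_nat.
  apply: (@wp_euclid_step b m n i k) => //; try by ev.
  + by rd; rewrite eE.
  + by rd; rewrite eE; apply: small_le (_ : small b' E); [lia|apply: small_int; rewrite gtr0_norm].
  + by rd; rewrite eE => j jN; apply: (ech_hle hech').
  + by rd; rewrite eE => j jN; have /andP[-> /ltW->] := ech_Vle hech' kn jN.
  rd; rewrite eE => s'' f'' h1 h2 h3 h4.
  have kn' : (k < n.+1)%N by [].
  have [|hech'' e] := echelon_swap E0 L_ext L_lin L_mod kn' iN Vp hech' h1 h2.
    by move=> k' j _ ne _; apply: h4.
  split=> //.
  + by frm.
  + by rewrite h1 // hy e hx hy modz_nat.
  + by move=> i' j ne; rewrite h3 ?hH.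
  + by move=> k' j ne; rewrite h4 ?hV.
- by move=> x' s' [f' hech' [hx hy] hH hV]; apply: hq.
Qed.

Lemma wp_echelonize (Q : state -> Prop) (s : state) :
  s vm 0 = m -> s vn 0 = n -> s vE 0 = E ->
  (forall k, (k <= n)%N -> L (mat s aV k)) ->
  (forall k j, (k <= n)%N -> (j < m + n.+1)%N -> 0 <= mat s aV k j < E) ->
  (forall x, L x -> exists c w : nat -> int, forall j, (j < m + n.+1)%N ->
     x j = \sum_(k < n.+1) c k * mat s aV k j + E * w j) ->
  (forall s', framed [:: vi; vj; vk; vq; vt; aH; aV] s s' ->
     echelon_rows (m + n.+1) E L (mat s' aH) -> Q s') ->
  wp b echelonize Q s.
Proof.
move=> em en eE VL Vb Vs hq.
have sE : small b E.
  by apply: small_le (_ : small b' E); [lia|apply: small_int; rewrite gtr0_norm].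
(* Finished rows keep some witness [V], although the generators in memory go on changing. The second
   part is guarded because no coordinate follows the last one. *)
pose J i (s' : state) := (forall i', (i' < i)%N -> good i' (mat s' aH i')) /\
  ((i < m + n.+1)%N -> ech i (unit_fun E i) (mat s' aV)).
apply: (@wp_for [:: vi; vj; vk; vq; vt; aH; aV] J (m + n.+1)) => //.
- by lia.
- by move=> s' fr; ev; rewrite em en; lia.
- by split=> // N0; apply: echelon_start.
- move=> i s1 iN f1 i1 [h1 h2].
  apply/wp_then/(@wp_fill (m + n.+1) _ _ _ _ _ _ (fun j => pair i j) (unit_fun E i)) => //.
  + by lia.
  + by move=> s' fr; ev; rewrite em en; lia.
  + by move=> j j' /pairz_inj[].
  + move=> j s2 jN f2 j2 h3; split; first by apply: eval_pr; ev.
      rewrite eval_mul eval_eqe; ev; rewrite j2 i1 eE /unit_fun eqz_nat.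
      by case: eqP; rewrite ?mul1r ?mul0r.
    by rewrite /unit_fun; case: eqP => _ //; apply: small_nat; lia.
  move=> s2 f2 h3 h3'.
  have rows2 i' : (i' < i)%N -> mat s2 aH i' = mat s1 aH i'.
    move=> ii; apply: funext => j; rewrite /mat h3' // => x _.
    by rewrite eqz_nat pair_inj ltn_eqF.
  pose Jk k (s' : state) := [/\ ech i (mat s' aH i) (mat s' aV),
    forall k', (k' < k)%N -> mat s' aV k' i = 0 &
    forall i', (i' < i)%N -> mat s' aH i' = mat s1 aH i'].
  apply: (@wp_for [:: vk; vq; vj; vt; aH; aV] Jk n.+1) => //.
  + by lia.
  + by move=> s' fr; ev; rewrite en; lia.
  + have -> : Jk 0%N (update s2 vk 0 0) <-> Jk 0%N s2.
      rewrite /Jk.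
      have eq a : a != vk -> mat (update s2 vk 0 0) a = mat s2 a.
        by move=> ne; apply: mat_eq => x y; rewrite upd_ne.
      by rewrite !eq.
    have eV : mat s2 aV = mat s1 aV by apply: mat_eq => x y; rd.
    by split=> //; rewrite eV; apply: (echelon_ext L_ext iN h3); apply: h2.
  + move=> k s3 kn f3 k3 [hech hV hH].
    apply: (@wp_euclid_loop i k) => //; try by ev.
    move=> s4 f4 hech4 hk4 hH4 hV4; split; [by frm|by ev|].
    have eq a : a != vk -> mat (update s4 vk 0 k.+1) a = mat s4 a.
      by move=> ne; apply: mat_eq => x y; rewrite upd_ne.
    rewrite /Jk !eq //; split=> //.
    * move=> k'; rewrite ltnS leq_eqVlt => /orP[/eqP->//|kk].
      by rewrite hV4 ?hV // ltn_eqF.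
    * move=> i' ii; rewrite -hH //; apply: funext => j; apply: hH4.
      by rewrite ltn_eqF.
  move=> s3 f3 [hech hV hH]; split; [by frm|by ev|].
  have eq a : a != vi -> mat (update s3 vi 0 i.+1) a = mat s3 a.
    by move=> ne; apply: mat_eq => x y; rewrite upd_ne.
  rewrite /J !eq //; split.
    move=> i'; rewrite ltnS leq_eqVlt => /orP[/eqP->|ii]; first by exists (mat s3 aV).
    by rewrite hH //; apply: h1.
  by have [] := echelon_next E0 L_ext L_mod iN hech hV.
- move=> s1 f1 [h1 _]; apply: hq => //.
  have g i : (i < m + n.+1)%N -> good i (mat s1 aH i) := h1 i.
  split=> [i /g|i /g|i /g|i j /g|i j /g|i x iN]; try by case=> V [[]].
  + by case=> V [hech _]; apply: (ech_hle hech).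
  + by case=> V [hech _]; apply: (ech_hlt hech).
  + have [V [hech V0]] := g i iN.
    by have [h _] := echelon_next E0 L_ext L_mod iN hech V0; apply: h.
Qed.

End Echelonize.

(** * Printing the result *)

Definition count_free : cmd :=
  Set_ vfree #0;;
  For vc $vn (If (eqe (Get aCp ($vc + #1)) #0) (Set_ vfree ($vfree + #1)) Skip).

Lemma wp_count_free (b n : nat) (cp : nat -> nat) (Q : state -> Prop) (s : state) :
  (n < b)%N -> s vn 0 = n -> (forall i : nat, s aCp i = cp i) ->
  (forall s', framed [:: vfree; vc] s s' -> s' vfree 0 = size (free_cols n cp) ->
     Q s') ->
  wp b count_free Q s.
Proof.
move=> nb en eC hq.
apply/wp_then/(@wp_set 0); [by ev|by apply: small_nat|].
pose cnt k := size [seq c <- iota 1 k | cp c == 0%N].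
pose J k (s' : state) := s' vfree 0 = cnt k.
have cntS k : cnt k.+1 = (cnt k + (cp k.+1 == 0%N))%N.
  by rewrite /cnt -[k.+1]addn1 iotaD filter_cat size_cat add1n addn1 /=; case: eqP.
have cntk k : (cnt k <= k)%N.
  by rewrite /cnt size_filter; apply: leq_trans (count_size _ _) _; rewrite size_iota.
apply: (@wp_for [:: vc; vfree] J n) => //.
- exact: ltnW.
- by move=> s' fr; ev.
- move=> k s2 kn f2 k2 h2.
  apply: (@wp_if (cp k.+1 == 0%N)).
    rewrite eval_eqe; ev; rewrite k2.
    have -> : k%:Z + 1 = k.+1 by lia.
    by rewrite eC eqz_nat.
  rewrite /J; case: ifP => ck; last first.
    by apply: wp_skip; split; [by frm|by ev|rd; rewrite h2 cntS ck addn0].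
  apply: (@wp_set (cnt k.+1)).
  + by ev; rewrite h2 cntS ck; lia.
  + by apply: small_nat; apply: leq_trans (cntk _) _; lia.
  + by split; [by frm|by ev|rd].
- by move=> s2 f2 h2; apply: hq => //; frm.
Qed.

Definition append (e : expr) : cmd := Put aOut $vo e;; Set_ vo ($vo + #1).

(** Cell 0 of the output, its length, is left out: it is filled last, from [vo]. *)
Definition written (s : state) (l : seq int) : Prop :=
  s vo 0 = (size l).+1 /\
  forall k : nat, (k < size l)%N -> s aOut k.+1 = nth 0 l k.

Lemma wp_append (l : seq int) (v : int) (b : nat) (e : expr) (Q : state -> Prop)
    (s : state) :
  ((size l).+1 < b)%N -> eval s e = v -> small b v -> written s l ->
  (forall s', framed [:: aOut; vo] s s' -> written s' (rcons l v) -> Q s') ->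
  wp b (append e) Q s.
Proof.
move=> lb ev_e sv [ho hl] hq.
apply/wp_then/(@wp_put (size l).+1 v) => //.
apply: (@wp_set (size l).+2); [by ev; rewrite ho; lia|exact: small_nat|].
apply: hq; first by frm.
split=> [|k]; first by rd; rewrite size_rcons.
rewrite size_rcons ltnS nth_rcons => kl; rd; rewrite eqz_nat eqSS.
by case: ltngtP kl => // kl _; rewrite hl.
Qed.

Lemma written_frame mods s s' l : framed mods s s' -> aOut \notin mods ->
  vo \notin mods -> written s l -> written s' l.
Proof.
move=> f h1 h2 [h3 h4]; split; first by rewrite f.
by move=> k kl; rewrite f // h4.
Qed.

Definition emit : cmd :=
  If (eqe (Get aCp $vi) #0)
    (Set_ vx ($vE * Get aH (pr ($vm + $vc) ($vm + $vi))))
    (Set_ vsum #0;;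
     For vj ($vn + #1) (Set_ vsum ($vsum +
       Get aT (pr (Get aCp $vi - #1) $vj) * Get aH (pr ($vm + $vc) ($vm + $vj))));;
     Set_ vx (#0 - $vsg * $vsum));;
  Set_ vq $vE;; Set_ vy (mode $vx $vE);;
  While $vy (Set_ vt (mode $vq $vy);; Set_ vq $vy;; Set_ vy $vt);;
  append ($vx / $vq);; append ($vE / $vq).

Section Emit.

Variables (b b' m n p : nat) (a E sg : int) (T0 T H : nat -> nat -> int).
Variables (rp cp : nat -> nat) (D : int) (L : (nat -> int) -> Prop).
Hypothesis nb : (2 * b' + n.+1 < b)%N.
Hypothesis E0 : 0 < E.
Hypothesis Eb : E < (2 ^ b')%N%:Z.
Hypothesis sg1 : sg * sg = 1.
Hypothesis Tb : forall i j, (i < m)%N -> (j <= n)%N -> `|T i j| < (2 ^ b')%N%:Z.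
Hypothesis rows : echelon_rows (m + n.+1) E L H.
Hypothesis cpm : forall c, (cp c <= m)%N.

Let ratio := entry m n T E sg cp H.

Definition ready (s : state) : Prop :=
  [/\ s vm 0 = m, s vn 0 = n, s vE 0 = E, s vsg 0 = sg &
  [/\ mat s aT = T, mat s aH = H & forall i : nat, s aCp i = cp i]].

Lemma ready_frame mods s s' : framed mods s s' ->
  ~~ has (mem mods) [:: vm; vn; vE; vsg; aT; aH; aCp] -> ready s -> ready s'.
Proof.
move=> f; rewrite -all_predC => /and5P[h1 h2 h3 h4 /and4P[h5 h6 h7 _]].
move=> [e1 e2 e3 e4 [e5 e6 e7]]; split; rewrite ?f //; split.
- by rewrite -e5; apply: mat_eq => x y; rewrite f.
- by rewrite -e6; apply: mat_eq => x y; rewrite f.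
- by move=> i; rewrite f.
Qed.

(** Partial sums are stored, hence the general [k]. Each term is below [2 ^ (2 * b')], and the
    number of terms is below [2 ^ n.+1]. *)
Lemma sum_small r c k : (r < m)%N -> (c <= n)%N -> (k <= n.+1)%N ->
  small b (\sum_(j < k) T r j * H (m + c) (m + j)).
Proof.
move=> rm cN kn; apply: small_int.
have e2 : (2 ^ b')%N%:Z * (2 ^ b')%N%:Z * k%:Z < (2 ^ b)%N%:Z.
  rewrite -!PoszM ltz_nat -expnD addnn -mul2n.
  apply: (@leq_ltn_trans (2 ^ (2 * b' + n.+1))); last by rewrite ltn_exp2l.
  rewrite expnD leq_mul2l; apply/orP; right; apply: leq_trans kn _.
  by rewrite ltnW // ltn_expl.
apply: le_lt_trans e2; apply: le_trans (ler_norm_sum _ _ _) _.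
have -> : (2 ^ b')%N%:Z * (2 ^ b')%N%:Z * k%:Z =
    \sum_(j < k) (2 ^ b')%N%:Z * (2 ^ b')%N%:Z.
  by rewrite sumr_const card_ord -mulr_natr natz.
apply: ler_sum => j _; have jn : (j <= n)%N by have := ltn_ord j; lia.
have hc : (m + c < m + n.+1)%N by lia.
have hj : (m + j < m + n.+1)%N by lia.
have /andP[h1 h2] := row_le rows hc hj; rewrite normrM (ger0_norm h1).
by apply: ler_pM => //; [apply/ltW/Tb|lia].
Qed.

Lemma numer_small i c : (i <= n)%N -> (c <= n)%N ->
  small b (numer m n T E sg cp H i c).
Proof.
move=> iN cN; rewrite /numer; case: ifP => ci.
  apply: small_int; have [hc hi] : (m + c < m + n.+1)%N /\ (m + i < m + n.+1)%N by lia.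
  have /andP[h1 h2] := row_le rows hc hi; rewrite ger0_norm; last by nia.
  apply: (@lt_trans _ _ ((2 ^ b')%N%:Z * (2 ^ b')%N%:Z)); first by nia.
  by rewrite -PoszM ltz_nat -expnD ltn_exp2l //; lia.
have [c0|c0] := posnP (cp i); first by rewrite c0 in ci.
have rm : ((cp i).-1 < m)%N by have := cpm i; lia.
have := sum_small rm cN (leqnn _); rewrite /small abszM abszN.
have -> : `|sg|%N = 1%N by nia.
by rewrite mul1n.
Qed.

Lemma small_quotient (z g : int) : 0 < g -> (g %| z)%Z -> small b z ->
  small b (z %/ g)%Z.
Proof. by move=> g0 /divzK e; rewrite /small => h; apply: leq_ltn_trans h; nia. Qed.

Lemma wp_emit (i c : nat) (l : seq int) (Q : state -> Prop) (s : state) :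
  (i <= n)%N -> (c <= n)%N -> ready s -> s vi 0 = i -> s vc 0 = c ->
  written s l -> (size l + 2 < b)%N ->
  (forall s', framed [:: vx; vsum; vj; vq; vy; vt; aOut; vo] s s' ->
     written s' (l ++ code_rat (ratio i c)) -> Q s') ->
  wp b emit Q s.
Proof.
move=> iN cN rd_s ei ec wl sl hq.
have [em en eE esg [eT eH eC]] := rd_s.
set z := numer m n T E sg cp H i c.
have sE : small b E.
  by apply: small_le (_ : small b' E); [lia|apply: small_int; rewrite gtr0_norm].
have Hmat s' j : framed [:: vx; vsum; vj; vq; vy; vt; aOut; vo] s s' ->
    mat s' aH (m + c) j = H (m + c) j.
  by move=> f; rewrite -eH /mat; rd.
apply: wp_then.
(* The common tail of both branches: reduce [z / E] to lowest terms and print it. *)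
have step : forall s', framed [:: vx; vsum; vj] s s' -> s' vx 0 = z ->
  wp b (Set_ vq $vE;; Set_ vy (mode $vx $vE);;
  While $vy (Set_ vt (mode $vq $vy);; Set_ vq $vy;; Set_ vy $vt);;
  append ($vx / $vq);; append ($vE / $vq)) Q s'.
  move=> s1 f1 x1.
  apply/wp_then/(@wp_set E); [by ev|by []|].
  have zE : 0 <= (z %% E)%Z < E by rewrite modz_ge0 ?gt_eqF // ltz_pmod.
  apply/wp_then/(@wp_set (z %% E)%Z); [by rewrite eval_mode; ev; rewrite x1 eE| |].
    by move: sE zE; rewrite /small; lia.
  set s2 := update _ _ _ _.
  have f2 : framed [:: vx; vsum; vj; vq; vy] s s2 by rewrite /s2; frm.
  have q2 : s2 vq 0 = E by rewrite /s2; rd.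
  have y2 : s2 vy 0 = (z %% E)%Z by rewrite /s2; rd.
  have x2 : s2 vx 0 = z by rewrite /s2; rd.
  clearbody s2.
  (* Starting from [E] and [z] modulo [E] keeps both numbers at most [E], even if [z] is much
     longer; the gcd is unchanged. *)
  pose K x y (s' : state) := [/\ framed [:: vq; vy; vt] s2 s', s' vq 0 = Posz x,
    s' vy 0 = Posz y, Posz (gcdn x y) = gcdz z E & [&& 0 < x, x <= `|E| & y <= `|E|]%N].
  apply/wp_then/(@wp_euclid K _ (2 * b') `|E|%N `|(z %% E)%Z|%N).
  - by lia.
  - have [h1 h2] : (`|E| < 2 ^ b')%N /\ (`|(z %% E)%Z| < 2 ^ b')%N by move: Eb zE; lia.
    by rewrite mul2n -addnn expnD; apply: ltn_mul.
  - split=> //; [by rewrite q2 gtz0_abs|by rewrite y2 gez0_abs //; case/andP: zE| |by lia].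
    by rewrite -[LHS]/(gcdz E (z %% E)%Z) gcdz_modr gcdzC.
  - by move=> x y s' [f' _ e' _ _]; ev; rewrite e'.
  - move=> x y s' y0 [f' ex' ey' g' /and3P[x0 xE yE]].
    have xyE : (x %% y <= `|E|)%N by apply: leq_trans (leq_mod _ _) xE.
    have sn u : (u <= `|E|)%N -> small b u by move: sE; rewrite /small /=; lia.
    apply/wp_then/(@wp_set (x %% y)%N); [|exact: sn|].
      by rewrite eval_mode; ev; rewrite ex' ey' modz_nat.
    apply/wp_then/(@wp_set y); [by ev|exact: sn|].
    apply: (@wp_set (x %% y)%N); [by ev|exact: sn|].
    split; [by frm|by rd|by rd| |by apply/and3P].
    by rewrite -g' gcdn_modr gcdnC.
  move=> g s' [f' eq ey eg /and3P[g0 _ _]]; rewrite gcdn0 in eg.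
  have [nE dE] := numq_denq_gcd z E0.
  apply/wp_then/(@wp_append l (numq (ratio i c))).
  - by lia.
  - by rewrite eval_div; ev; rewrite x2 eq eg nE.
  - rewrite nE -eg; apply: small_quotient; [by []|by rewrite eg dvdz_gcdl|].
    exact: numer_small.
  - by apply: (written_frame (f' : framed _ s2 s')) => //; apply: (written_frame f2).
  move=> s3 f3 w3; apply: (wp_append (l := rcons l (numq (ratio i c))) (v := denq (ratio i c))) => //.
  - by rewrite size_rcons; lia.
  - by rewrite eval_div; ev; rewrite eE eq eg dE.
  - by rewrite dE -eg; apply: small_quotient; [|rewrite eg dvdz_gcdr|].
  move=> s4 f4 w4; apply: hq; first by frm.
  by move: w4; rewrite -!cats1 -catA.
apply: (@wp_if (cp i == 0%N)); first by rewrite eval_eqe; ev; rewrite ei eC eqz_nat.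
case: ifP => ci.
  apply: (@wp_set z); [|exact: numer_small|by apply: step; [frm|rd]].
  rewrite eval_mul (@eval_mat _ _ _ _ (m + c) (m + i)); last 2 first.
  - by ev; rewrite em ec.
  - by ev; rewrite em ei.
  by ev; rewrite eE eH /z /numer ci.
apply/wp_then/(@wp_set 0); [by ev|by apply: small_nat; lia|].
have [c0|c0] := posnP (cp i); first by rewrite c0 in ci.
have rm : ((cp i).-1 < m)%N by have := cpm i; lia.
pose J k (s' : state) := s' vsum 0 = \sum_(j < k) T (cp i).-1 j * H (m + c) (m + j).
apply/wp_then/(@wp_for [:: vj; vsum] J n.+1) => //.
- by lia.
- by move=> s' fr; ev; rewrite en; lia.
- by rewrite /J big_ord0; rd.
- move=> k s1 kn f1 k1 h1; apply: (@wp_set (\sum_(j < k.+1) T (cp i).-1 j * H (m + c) (m + j))).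
  + rewrite eval_add eval_mul (@eval_mat _ _ _ _ (cp i).-1 k); last 2 first.
    * by ev; rewrite ei eC; lia.
    * by ev.
    rewrite (@eval_mat _ _ _ _ (m + c) (m + k)); last 2 first.
    * by ev; rewrite em ec.
    * by ev; rewrite em k1.
    by ev; rewrite h1 big_ord_recr /= /mat; rd; rewrite -eT -eH.
  + exact: sum_small.
  + by split; [frm|ev|rewrite /J; rd].
- move=> s1 f1 h1; apply: (@wp_set z); [|exact: numer_small|by apply: step; [frm|rd]].
  by ev; rewrite h1 esg /z /numer ci sub0r mulNr.
Qed.

End Emit.

Definition print_map : cmd :=
  Set_ vo #1;; append #1;; append $vn;; append #1;;
  Set_ vc #0;;
  For vk $vn (Set_ vi ($vk + #1);; emit);;
  append $vn;; append $vfree;;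
  For vk $vn (Set_ vi ($vk + #1);;
    For vl $vn (Set_ vc ($vl + #1);; If (eqe (Get aCp $vc) #0) emit Skip));;
  Set_ aOut ($vo - #1).

Definition output : cmd :=
  If ($vok * eqe (Get aH (pr $vm $vm)) #1) print_map
    (Set_ aOut #1;; Put aOut #1 #0).

Lemma flatten_rcons (T : Type) (ss : seq (seq T)) (s : seq T) :
  flatten (rcons ss s) = flatten ss ++ s.
Proof. by rewrite -cats1 flatten_cat /= cats0. Qed.

Lemma iota_rcons (i k : nat) : iota i k.+1 = rcons (iota i k) (i + k)%N.
Proof. by rewrite -addn1 iotaD cats1. Qed.

Lemma written_upd (s : state) (a : nat) (i v : int) (l : seq int) :
  a != aOut -> a != vo -> written s l -> written (update s a i v) l.
Proof.
move=> ao av; apply: (@written_frame [:: a]); rewrite ?inE 1?eq_sym //.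
by apply: framed_upd; rewrite ?inE.
Qed.

Section Print.

Variables (b b' m n : nat) (E sg : int) (T H : nat -> nat -> int).
Variables (cp : nat -> nat) (L : (nat -> int) -> Prop).
Hypothesis nb : (2 * b' + n.+1 < b)%N.
Hypothesis nnb : (2 * n * n + 2 * n + 10 < b)%N.
Hypothesis E0 : 0 < E.
Hypothesis Eb : E < (2 ^ b')%N%:Z.
Hypothesis sg1 : sg * sg = 1.
Hypothesis Tb : forall i j, (i < m)%N -> (j <= n)%N -> `|T i j| < (2 ^ b')%N%:Z.
Hypothesis rows : echelon_rows (m + n.+1) E L H.
Hypothesis cpm : forall c, (cp c <= m)%N.

Let ent i c := code_rat (entry m n T E sg cp H i c).

Definition printed : seq int :=
  1 :: (n%:Z :: 1 :: flatten [seq ent i.+1 0 | i <- iota 0 n]) ++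
  (n%:Z :: (size (free_cols n cp))%:Z ::
   flatten [seq flatten [seq ent i.+1 c | c <- free_cols n cp] | i <- iota 0 n]).

Let size_ent (s : seq nat) i : size (flatten [seq ent i c | c <- s]) = (2 * size s)%N.
Proof. by elim: s => //= c s ->; rewrite mulnS. Qed.

Let size_ent0 (s : seq nat) : size (flatten [seq ent i.+1 0 | i <- s]) = (2 * size s)%N.
Proof. by elim: s => //= c s ->; rewrite mulnS. Qed.

(** The quadratic hypothesis [nnb] bounds the write position: five header cells, [2 * n] cells for
    the point and at most [2 * n * n] for the matrix. *)
Lemma wp_print_map (Q : state -> Prop) (s : state) :
  ready m n E sg T H cp s -> s vfree 0 = size (free_cols n cp) ->
  (forall s', outputs s' printed -> Q s') ->
  wp b print_map Q s.
Proof.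
move=> rd_s efree hq.
have [em en eE esg [eT eH eC]] := rd_s.
have free_n k : (size [seq c <- iota 1 k | cp c == 0%N] <= k)%N.
  by rewrite size_filter; apply: leq_trans (count_size _ _) _; rewrite size_iota.
apply/wp_then/(@wp_set 1); [by ev|by apply: small_nat; lia|].
set s1 := update _ _ _ _.
have w1 : written s1 [::] by split=> //; rewrite /s1; rd.
have f1 : framed [:: vo] s s1 by rewrite /s1; frm.
clearbody s1.
apply/wp_then/(wp_append (l := [::]) (v := 1)) => //; [by rewrite /=; lia|by apply: small_nat; lia|].
move=> s2 f2 w2.
apply/wp_then/(wp_append (v := n) _ _ _ w2); [by rewrite /=; lia|by ev|by apply: small_nat; lia|].
move=> s3 f3 w3.
apply/wp_then/(wp_append (v := 1) _ _ _ w3); [by rewrite /=; lia|by ev|by apply: small_nat; lia|].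
move=> s4 f4 w4.
apply/wp_then/(@wp_set 0); [by ev|by apply: small_nat; lia|].
set s5 := update _ _ _ _.
have f5 : framed [:: aOut; vo; vc] s s5 by rewrite /s5; frm.
have w5 : written s5 [:: 1; n%:Z; 1].
  by apply: (written_frame (_ : framed [:: vc] s4 s5)) w4 => //; rewrite /s5; frm.
have c5 : s5 vc 0 = 0 by rewrite /s5; rd.
clearbody s5.
pose l1 k := [:: 1; n%:Z; 1] ++ flatten [seq ent i.+1 0 | i <- iota 0 k].
have l1S k : l1 k.+1 = l1 k ++ ent k.+1 0.
  by rewrite /l1 iota_rcons map_rcons flatten_rcons catA add0n.
have sz1 k : size (l1 k) = (3 + 2 * k)%N by rewrite size_cat size_ent0 size_iota.
have rdF s' mods : framed mods s s' ->
    ~~ has (mem mods) [:: vm; vn; vE; vsg; aT; aH; aCp] -> ready m n E sg T H cp s'.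
  by move=> f h; apply: (ready_frame f h rd_s).
apply/wp_then/(@wp_for [:: vk; vi; vx; vsum; vj; vq; vy; vt; aOut; vo]
   (fun k s' => written s' (l1 k)) n) => //.
- by lia.
- by move=> s' fr; ev.
- move=> k s6 kn f6 k6 w6.
  apply/wp_then/(@wp_set k.+1); [by ev; rewrite k6; lia|by apply: small_nat; lia|].
  set s7 := update _ _ _ _.
  have f7 : framed [:: vi] s6 s7 by rewrite /s7; frm.
  have i7 : s7 vi 0 = k.+1 by rewrite /s7; rd.
  clearbody s7.
  have f7' : framed [:: vk; vi; vx; vsum; vj; vq; vy; vt; aOut; vo; vc] s s7 by frm.
  apply: (@wp_emit b b' m n E sg T H cp L _ _ _ _ _ _ _ k.+1 0 (l1 k)) => //.
  + exact: (rdF _ _ f7').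
  + by rd.
  + exact: (written_frame f7).
  + by rewrite sz1; lia.
  + move=> s8 f8 w8; split; [by frm|by ev|].
    by rewrite l1S; apply: written_upd.
move=> s6 f6 w6.
have f6' : framed [:: vk; vi; vx; vsum; vj; vq; vy; vt; aOut; vo; vc] s s6 by frm.
apply/wp_then/(wp_append (v := n) _ _ _ w6); [by rewrite sz1; lia|by ev|by apply: small_nat; lia|].
move=> s7 f7 w7.
apply/wp_then/(wp_append (v := size (free_cols n cp)) _ _ _ w7).
- by rewrite size_rcons sz1; lia.
- by ev.
- by apply: small_nat; apply: leq_trans (free_n n) _; lia.
move=> s8 f8 w8.
pose l2 k := rcons (rcons (l1 n) n) (size (free_cols n cp)) ++
  flatten [seq flatten [seq ent i.+1 c | c <- free_cols n cp] | i <- iota 0 k].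
have l2S k : l2 k.+1 = l2 k ++ flatten [seq ent k.+1 c | c <- free_cols n cp].
  by rewrite /l2 iota_rcons map_rcons flatten_rcons catA add0n.
have sz2 k : (size (l2 k) <= 5 + 2 * n + 2 * n * k)%N.
  elim: k => [|k ih]; first by rewrite size_cat !size_rcons sz1 /=; lia.
  by rewrite l2S size_cat size_ent; have := free_n n; rewrite -/(free_cols n cp); lia.
have f8' : framed [:: vk; vi; vx; vsum; vj; vq; vy; vt; aOut; vo; vc] s s8 by frm.
apply/wp_then/(@wp_for [:: vk; vl; vi; vx; vsum; vj; vq; vy; vt; aOut; vo; vc]
   (fun k s' => written s' (l2 k)) n) => //.
- by lia.
- by move=> s' fr; ev.
- rewrite /l2 /= cats0.
  by apply: written_upd.
- move=> k s9 kn f9 k9 w9.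
  apply/wp_then/(@wp_set k.+1); [by ev; rewrite k9; lia|by apply: small_nat; lia|].
  set s10 := update _ _ _ _.
  have f10 : framed [:: vi] s9 s10 by rewrite /s10; frm.
  have i10 : s10 vi 0 = k.+1 by rewrite /s10; rd.
  have w10 : written s10 (l2 k) by apply: (written_frame f10).
  clearbody s10.
  pose l3 c := l2 k ++ flatten [seq ent k.+1 d | d <- [seq d <- iota 1 c | cp d == 0%N]].
  have l3S c : l3 c.+1 = l3 c ++ (if cp c.+1 == 0%N then ent k.+1 c.+1 else [::]).
    rewrite /l3 iota_rcons filter_rcons add1n; case: ifP => _; last by rewrite cats0.
    by rewrite map_rcons flatten_rcons catA.
  have sz3 c : (c <= n)%N -> (size (l3 c) <= 5 + 2 * n + 2 * n * k + 2 * c)%N.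
    move=> cn; rewrite size_cat size_ent; have := sz2 k; have := free_n c; lia.
  apply: (@wp_for [:: vl; vx; vsum; vj; vq; vy; vt; aOut; vo; vc]
    (fun c s' => written s' (l3 c)) n) => //.
  + by lia.
  + by move=> s' fr; ev.
  + rewrite /l3 /= cats0.
    by apply: written_upd.
  + move=> c s11 cn f11 l11 w11.
    apply/wp_then/(@wp_set c.+1); [by ev; rewrite l11; lia|by apply: small_nat; lia|].
    set s12 := update _ _ _ _.
    have f12 : framed [:: vc] s11 s12 by rewrite /s12; frm.
    have c12 : s12 vc 0 = c.+1 by rewrite /s12; rd.
    clearbody s12.
    have w12 : written s12 (l3 c) by apply: (written_frame f12).
    have f12' : framed [:: vk; vl; vi; vx; vsum; vj; vq; vy; vt; aOut; vo; vc] s s12 by frm.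
    apply: (@wp_if (cp c.+1 == 0%N)).
      by rewrite eval_eqe; ev; rewrite c12 eC eqz_nat.
    case: ifP => cc; last first.
      apply: wp_skip; split; [by frm|by ev|rewrite l3S cc cats0].
      by apply: written_upd.
    apply: (@wp_emit b b' m n E sg T H cp L _ _ _ _ _ _ _ k.+1 c.+1 (l3 c)) => //.
    * exact: (rdF _ _ f12').
    * by rd.
    * have nk : (2 * n * k + 2 * n <= 2 * n * n)%N by nia.
      apply: (@leq_ltn_trans (5 + 2 * n + 2 * n * k + 2 * c + 2)%N); last by lia.
      by rewrite leq_add2r; apply/sz3/ltnW.
    * move=> s13 f13 w13; split; [by frm|by ev|rewrite l3S cc].
      by apply: written_upd.
  + move=> s11 f11 w11; split; [by frm|by ev|rewrite l2S].
    by apply: written_upd.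
move=> s9 f9 [o9 w9].
have ep : printed = l2 n.
  by rewrite /printed /l2 !cat_rcons.
apply: (@wp_set (size printed)); [by ev; rewrite o9 ep; lia| |].
  by apply: small_nat; rewrite ep; apply: leq_trans (sz2 n) _; lia.
apply: hq; split; first by rewrite upd_same.
by move=> k kl; rewrite upd_eq /= w9 -?ep.
Qed.

Lemma wp_output (ok : bool) (Q : state -> Prop) (s : state) :
  ready m n E sg T H cp s -> s vfree 0 = size (free_cols n cp) -> s vok 0 = ok ->
  (ok -> H m m = 1 -> forall s', outputs s' printed -> Q s') ->
  (~~ (ok && (H m m == 1)) -> forall s', outputs s' [:: 0] -> Q s') ->
  wp b output Q s.
Proof.
move=> rd_s efree eok h1 h2; have [em en eE esg [eT eH eC]] := rd_s.
apply: (@wp_if (ok && (H m m == 1))).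
  rewrite eval_mul eval_eqe eval_const (@eval_mat _ _ _ _ m m) //.
  by rewrite eH; ev; rewrite eok -PoszM mulnb.
case: ifP => [/andP[o /eqP e]|/negbT hn].
  by apply: wp_print_map => //; apply: h1.
apply/wp_then/(@wp_set 1); [by ev|by apply: small_nat; lia|].
apply: (@wp_put 1 0); [by ev|by ev|by apply: small_nat; lia|].
apply: h2 => //; split; first by rewrite upd_eq /= upd_same.
by case.
Qed.

End Print.

(** * Layout of the encoded data *)

Lemma nth_flatten_const (T : Type) (x0 : T) (d i k : nat) (ss : seq (seq T)) :
  all (fun s => size s == d) ss -> (i < size ss)%N -> (k < d)%N ->
  nth x0 (flatten ss) (i * d + k) = nth x0 (nth [::] ss i) k.
Proof.
elim: ss i => [|s ss ih] //= [|i] /andP[/eqP sd al] il kd; rewrite nth_cat sd.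
  by rewrite kd.
by rewrite mulSn -addnA ltnNge leq_addr /= addKn ih.
Qed.

Lemma size_flatten_const (T : Type) (d : nat) (ss : seq (seq T)) :
  all (fun s => size s == d) ss -> size (flatten ss) = (size ss * d)%N.
Proof.
by elim: ss => [|s ss ih] //= /andP[/eqP sd al]; rewrite size_cat sd ih // mulSn.
Qed.

Section Encoding.

Variables (m n : nat) (A : 'M[rat]_(m, n)).

Let row_code i := flatten [seq code_rat (A i j) | j <- enum 'I_n].

Let size_row i : size (row_code i) = (n * 2)%N.
Proof.
rewrite (@size_flatten_const _ 2) ?size_map -?enumT ?size_enum_ord //.
by apply/allP => _ /mapP[j _ ->].
Qed.

Lemma size_code_mx : size (code_mx A) = (2 + 2 * m * n)%N.
Proof.
rewrite /code_mx; set F := flatten _; rewrite -[LHS]/(size F).+2 /F.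
rewrite (@size_flatten_const _ (n * 2)) ?size_map -?enumT ?size_enum_ord; first by lia.
by apply/allP => _ /mapP[i _ ->]; rewrite size_row.
Qed.

Lemma nth_code_mx (i : 'I_m) (j : 'I_n) (k : nat) : (k < 2)%N ->
  nth 0 (code_mx A) (2 + 2 * (i * n + j) + k)%N = nth 0 (code_rat (A i j)) k.
Proof.
move=> k2; have -> : (2 + 2 * (i * n + j) + k = (i * (n * 2) + (j * 2 + k)).+2)%N by lia.
rewrite /code_mx; set F := flatten _; rewrite -[LHS]/(nth 0 F (i * (n * 2) + (j * 2 + k))) /F.
rewrite (@nth_flatten_const _ _ (n * 2)); last 1 first.
- by have := ltn_ord j; lia.
- rewrite (nth_map i) ?size_enum_ord // nth_ord_enum.
  rewrite (@nth_flatten_const _ _ 2) //; last by rewrite size_map size_enum_ord.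
    by rewrite (nth_map j) ?size_enum_ord // nth_ord_enum.
  by apply/allP => _ /mapP[l _ ->].
- by apply/allP => _ /mapP[l _ ->]; rewrite size_row.
- by rewrite size_map size_enum_ord.
Qed.

(** Passes from enumerations of ordinals to the ranges of naturals that the printing loops run
    through. *)
Lemma code_mx_fun (f : nat -> nat -> rat) :
  (forall (i : 'I_m) (j : 'I_n), A i j = f i j) ->
  code_mx A = m%:Z :: n%:Z :: flatten [seq flatten [seq code_rat (f i j) |
    j <- iota 0 n] | i <- iota 0 m].
Proof.
move=> h; rewrite /code_mx; congr (_ :: _ :: flatten _).
rewrite -[iota 0 m]val_enum_ord -map_comp; apply: eq_map => i /=.
rewrite -[iota 0 n]val_enum_ord -map_comp; congr flatten; apply: eq_map => j /=.
by rewrite h.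
Qed.

End Encoding.

Lemma bits_pos (z : int) : (0 < bits z)%N. Proof. by []. Qed.

Lemma size_bits_seq (l : seq int) : (size l <= bits_seq l)%N.
Proof.
rewrite /bits_seq; elim: l => [|z l ih]; first by rewrite big_nil.
by rewrite big_cons; apply: (leq_add (bits_pos z) ih).
Qed.

Lemma bits_bits_seq (l : seq int) (z : int) : z \in l -> (bits z <= bits_seq l)%N.
Proof.
rewrite /bits_seq; elim: l => [|y l ih] //; rewrite inE big_cons.
by case/orP=> [/eqP->|/ih h]; [rewrite leq_addr|apply: leq_trans h (leq_addl _ _)].
Qed.

Lemma bounded_initial (l : seq int) (b : nat) : (bits_seq l <= b)%N ->
  bounded b (initial l).
Proof.
move=> lb [|a] [k|k]; rewrite /initial /=; try by rewrite /small expn_gt0.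
case: k => [|k] /=.
  by apply: small_nat; apply: leq_trans (size_bits_seq l) lb.
have [kl|kl] := ltnP k (size l); last by rewrite nth_default // /small expn_gt0.
apply: small_le (small_bits _); apply: leq_trans lb.
by apply: bits_bits_seq; rewrite mem_nth.
Qed.

Lemma initial_input (l : seq int) (k : nat) : initial l aIn k.+1 = nth 0 l k.
Proof. by []. Qed.

Section Input.

Variables (m n : nat) (W : 'M[rat]_(m, n)) (w : 'cV[rat]_m) (p : 'I_n.+1).

Let x := Instance W w p.
Let s := initial (code_instance x).

Lemma size_code_instance : size (code_instance x) = (5 + 2 * m * n + 2 * m)%N.
Proof. by rewrite !size_cat !size_code_mx /=; lia. Qed.

Lemma input_p : s aIn (5 + 2 * m * n + 2 * m)%N = p.
Proof.
have -> : (5 + 2 * m * n + 2 * m = (size (code_mx W) + (size (code_mx w) + 0)).+1)%N.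
  by rewrite !size_code_mx; lia.
rewrite /s initial_input /code_instance.
by rewrite nth_cat ltnNge leq_addr addKn nth_cat ltnNge leq_addr addKn.
Qed.

Lemma input_W (i : 'I_m) (j : 'I_n) : s aIn (offset m n i j.+1) = numq (W i j) /\
  s aIn (offset m n i j.+1).+1 = denq (W i j).
Proof.
have ij : (i * n + j < m * n)%N.
  have := ltn_ord i; have := ltn_ord j.
  by have : (i.+1 * n <= m * n)%N by [rewrite leq_mul2r (ltn_ord i) orbT]; lia.
have h k : (k < 2)%N -> s aIn (offset m n i j.+1 + k)%N = nth 0 (code_rat (W i j)) k.
  move=> k2; have -> : (offset m n i j.+1 + k = (2 + 2 * (i * n + j) + k).+1)%N.
    by rewrite /offset; lia.
  rewrite /s initial_input /code_instance nth_cat size_code_mx.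
  have -> : (2 + 2 * (i * n + j) + k < 2 + 2 * m * n)%N by lia.
  exact: nth_code_mx.
by split; [have := h 0%N isT; rewrite addn0|have := h 1%N isT; rewrite addn1].
Qed.

Lemma input_w (i : 'I_m) : s aIn (offset m n i 0) = numq (w i 0) /\
  s aIn (offset m n i 0).+1 = denq (w i 0).
Proof.
have h k : (k < 2)%N -> s aIn (offset m n i 0 + k)%N = nth 0 (code_rat (w i 0)) k.
  move=> k2.
  have -> : (offset m n i 0 + k = (size (code_mx W) + (2 + 2 * (i * 1 + 0%N) + k)).+1)%N.
    by rewrite size_code_mx /offset; lia.
  rewrite /s initial_input /code_instance nth_cat.
  case: ifP => [|_]; first by rewrite ltnNge leq_addr.
  rewrite addKn nth_cat size_code_mx.
  have -> : (2 + 2 * (i * 1 + 0) + k < 2 + 2 * m * 1)%N.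
    by have := ltn_ord i; lia.
  exact: (@nth_code_mx _ _ w i ord0).
by split; [have := h 0%N isT; rewrite addn0|have := h 1%N isT; rewrite addn1].
Qed.

End Input.

(** * Assembly and the polynomial bound *)

Local Open Scope classical_set_scope.
Local Open Scope ring_scope.

Definition reduction : cmd :=
  read_input;; pivoting;; check_rows;; split_sign;; generators;; echelonize;;
  count_free;; output.

(** Weights and widths are constants of the program, and each nested loop contributes one more
    factor [b.+1]. *)
Lemma polyb_ctime (c : cmd) : polyb (fun b => ctime b c).
Proof.
have pS f : polyb f -> polyb (fun z => (f z).+1).
  by move=> pf; apply: (polyb_le _ (polybD pf (polyb_cst 1))) => z; rewrite addn1.
have sq w : polyb (fun b => w * b ^ 2)%N.
  apply: (polyb_le _ (polybM (polyb_cst w) (polybM polyb_id polyb_id))) => z.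
  by rewrite mulnn.
elim: c => [|a i e|c1 h1 c2 h2|e c1 h1 c2 h2|e c h] /=.
- exact: polyb_cst.
- exact/pS/sq.
- exact/pS/polybD.
- by apply/pS/polybD; [exact: sq|exact: polybD].
- by apply: polybM; [exact: pS polyb_id|exact/pS/polybD].
Qed.

(* With [a] bounding the entries of the scaled matrix, [2 ^ minor_bits Z] exceeds
   [m! a ^ m], which bounds all minors. *)
Definition entry_bits (Z : nat) : nat := Z * (Z * Z.+1).+1.
Definition minor_bits (Z : nat) : nat := (Z * Z + entry_bits Z * Z).+1.
Definition machine_bits (Z : nat) : nat :=
  (2 * minor_bits Z + 2 * Z * Z + 4 * Z + entry_bits Z + 20)%N.

Lemma polyb_machine_bits : polyb machine_bits.
Proof.
have pS f : polyb f -> polyb (fun z => (f z).+1).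
  by move=> pf; apply: (polyb_le _ (polybD pf (polyb_cst 1))) => z; rewrite addn1.
have pe : polyb entry_bits.
  by apply: polybM polyb_id (pS _ (polybM polyb_id (pS _ polyb_id))).
have pm : polyb minor_bits.
  by apply/pS/polybD; [exact: polybM polyb_id polyb_id|exact: polybM pe polyb_id].
have p2 : polyb (fun z => 2 * z)%N by apply: polybM polyb_id; exact: polyb_cst.
have p4 : polyb (fun z => 4 * z)%N by apply: polybM polyb_id; exact: polyb_cst.
have p2m : polyb (fun z => 2 * minor_bits z)%N by apply: polybM pm; exact: polyb_cst.
have := polybD p2m (polybM p2 polyb_id).
by move=> /polybD/(_ p4)/polybD/(_ pe)/polybD/(_ (polyb_cst 20)).
Qed.

(** The factorial is absorbed by [m! <= m ^ m <= 2 ^ (m * m)]. *)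
Lemma minor_bound (m Z A : nat) : (m <= Z)%N -> (A <= entry_bits Z)%N ->
  m`!%:R * (2 ^ A)%N%:Z ^+ m < (2 ^ minor_bits Z)%N%:Z.
Proof.
move=> mZ AZ; have -> : m`!%:R * (2 ^ A)%N%:Z ^+ m = (m`! * 2 ^ (A * m))%N%:Z.
  by rewrite natz PoszM expnM -[((2 ^ A) ^ m)%N%:Z]natz natrX natz.
rewrite ltz_nat.
have f : (m`! <= 2 ^ (m * m))%N.
  rewrite expnM; apply: (@leq_trans (m ^ m)); last first.
    by case: (m) => // k; rewrite leq_exp2r // ltnW // ltn_expl.
  elim: (m) => // k ih; rewrite factS expnS leq_mul2l /=.
  by apply: leq_trans ih _; case: k => // k; rewrite leq_exp2r.
apply: (@leq_ltn_trans (2 ^ (m * m + A * m))); first by rewrite expnD leq_mul2r f orbT.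
by rewrite ltn_exp2l // ltnS leq_add // leq_mul.
Qed.

Lemma numer_denom (q : rat) (t : int) : (denq q %| t)%Z ->
  t%:~R * q = (numq q * (t %/ denq q)%Z)%:~R.
Proof.
by move=> h; rewrite -{1}(divzK h) !intrM numqE; ring.
Qed.

Section Correctness.

Variables (R : realType) (m n : nat) (W : 'M[rat]_(m, n)) (w : 'cV[rat]_m).
Variable p : 'I_n.+1.

Definition correct (out : seq int) : Prop :=
  let A : set 'cV[R]_n := affine_space W w in
  let S : set 'cV[R]_n := A `&` mixed R n p in
  (S = set0 /\ out = [:: 0]) \/
  (S !=set0 /\
   exists (xbar : 'cV[rat]_n) (M : 'M[rat]_(n, n - \rank W)),
     [/\ out = 1 :: code_mx xbar ++ code_mx M,
         mixed rat n p xbar,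
         full_rank M,
         A = range (affine_map xbar M)
       & S = affine_map xbar M @` mixed R (n - \rank W) (reduced_nints p W)]).

Lemma wp_reduction :
  let x := Instance W w p in
  let b := machine_bits (size_instance x) in
  wp b reduction (fun s => exists2 out, outputs s out & correct out)
    (initial (code_instance x)).
Proof.
move=> x; set Z := size_instance x => b; set s0 := initial _.
have nZ : (n <= Z)%N by rewrite /Z /size_instance leq_addr.
have mZ : (m <= Z)%N.
  rewrite /Z /size_instance; apply: leq_trans (leq_addl _ _).
  by apply: leq_trans (size_bits_seq _); rewrite size_code_instance; lia.
have pn : (p <= n)%N by rewrite -ltnS.
have s0b : bounded Z s0 by apply: bounded_initial; rewrite leq_addl.
pose A := (Z * (m * n.+1).+1)%N.
have AZ : (A <= entry_bits Z)%N.
  by rewrite /A /entry_bits leq_mul2l ltnS leq_mul ?orbT.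
pose b' := minor_bits Z.
have hb : (2 * b' + 2 * Z * Z + 4 * Z + entry_bits Z + 20 <= b)%N by [].
have ZZ : (n * n <= Z * Z)%N by rewrite leq_mul.
pose num i c := s0 aIn (offset m n i c); pose den i c := s0 aIn (offset m n i c).+1.
have numden i c : (i < m)%N -> (c <= n)%N -> `|num i c| < (2 ^ Z)%N%:Z /\
    0 < den i c < (2 ^ Z)%N%:Z.
  move=> im cn; have := s0b aIn (offset m n i c); have := s0b aIn (offset m n i c).+1.
  move=> /smallP d1 /smallP d2; split=> //; apply/andP; split; last first.
    by apply: le_lt_trans (ler_norm _) d1.
  rewrite /den; case: c cn {d1 d2} => [|c] cn.
    have -> : s0 aIn (offset m n i 0).+1 = denq (w (Ordinal im) 0) :=
      proj2 (input_w W w p (Ordinal im)).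
    exact: denq_gt0.
  have -> : s0 aIn (offset m n i c.+1).+1 = denq (W (Ordinal im) (Ordinal cn)) :=
    proj2 (input_W W w p (Ordinal im) (Ordinal cn)).
  exact: denq_gt0.
apply/wp_then/(@wp_read_input b Z m n p num den) => //; try by lia.
- exact: input_p.
move=> s1 q f1 em en ep eD q0 hT.
have Tb1 i j : (i < m)%N -> (j <= n)%N -> `|mat s1 aT i j| <= (2 ^ A)%N%:Z.
  by move=> im jn; case: (hT i j im jn).
have fact_b := minor_bound mZ AZ.
apply/wp_then/(@wp_pivoting b m n (2 ^ A)%N%:Z) => //; try by lia.
- by apply: lt_trans fact_b _; rewrite ltz_nat ltn_exp2l //; lia.
- by move=> i; rd.
- by move=> i; rd.
move=> s2 rp cp f2 piv eR eC.
set T0 := mat s1 aT in Tb1 piv; set T := mat s2 aT in piv; set D := s2 vD 0 in piv.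
have Q0 : q%:~R != 0 :> rat by rewrite intr_eq0 gt_eqF.
have T0W (i : 'I_m) (j : 'I_n) : q%:~R * W i j = (T0 i j.+1)%:~R.
  have [e h _] := hT i j.+1 (ltn_ord i) (ltn_ord j).
  have := input_W W w p i j; rewrite -/x -/s0 => -[e1 e2]; rewrite /T0 /mat e mul1r /num e1.
  by move: h; rewrite /den e2 => h; rewrite numer_denom.
have T0w (i : 'I_m) : q%:~R * w i 0 = - (T0 i 0%N)%:~R.
  have [e h _] := hT i 0%N (ltn_ord i) (leq0n _).
  have := input_w W w p i; rewrite -/x -/s0 => -[e1 e2]; rewrite /T0 /mat e /num e1.
  move: h; rewrite /den e2 => h; rewrite numer_denom // -rmorphN; congr (_%:~R).
  by rewrite mulN1r mulNr opprK.
have [Db Tb] : `|D| < (2 ^ b')%N%:Z /\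
    forall i j, (i < m)%N -> (j <= n)%N -> `|T i j| < (2 ^ b')%N%:Z.
  have [h1 h2] := pivoted_bound piv Tb1; split; first exact: le_lt_trans h1 _.
  by move=> i j im jn; apply: le_lt_trans (h2 i j im jn) _.
have b'b : (b' <= b)%N by lia.
apply/wp_then/(@wp_check_rows b m rp) => //; try by [lia|rd].
move=> s3 ok f3 eok hok.
apply/wp_then/wp_split_sign => //.
  by rd; rewrite -/D; apply: small_le b'b _; apply: small_int.
move=> s4 f4; rd; rewrite -/D; set E := s4 vE 0; set sg := s4 vsg 0 => eE eDs sg1.
have E0 : 0 < E by rewrite eE normr_gt0; case: piv.
have Eb : E < (2 ^ b')%N%:Z by rewrite eE.
have sE : small b E by apply: small_le b'b _; apply: small_int; rewrite gtr0_norm.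
have eT4 : mat s4 aT = T by apply: mat_eq => i j; rd.
apply/wp_then/(@wp_generators b m n p rp cp) => //; try by [lia|rd].
- by move=> i; rd.
- by move=> i; rd.
rewrite eT4 -/E => s5 f5 hV.
have lext := @lat_ext m n p E T rp cp.
have lV k : (k <= n)%N -> lat m n p E T rp cp (mat s5 aV k).
  move=> kn; apply: lext (lat_gen m p E T rp cp kn) => j jN.
  by rewrite hV.
apply/wp_then/(@wp_echelonize b b' m n E (lat m n p E T rp cp)) => //; try by [lia|rd].
- exact: lat_lin.
- exact: lat_mod.
- by move=> k j kn jN; rewrite hV // gen_mod_bound.
- move=> y /lat_span[c [v hy]]; exists c, v => j jN; rewrite hy //.
  by congr (_ + _); apply: eq_bigr => k _; rewrite hV // -ltnS.
move=> s6 f6; set H := mat s6 aH => rows.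
apply/wp_then/(@wp_count_free b n cp) => //; try by [lia|rd].
- by move=> i; rd.
move=> s7 f7 efree.
have cpm c : (cp c <= m)%N.
  by case e: (cp c) => [|r] //; case: piv => _ _ _ _ /(_ _ _ e)[].
have hT4 : mat s7 aT = T by apply: mat_eq => i j; rd.
have hH : mat s7 aH = H by apply: mat_eq => i j; rd.
apply: (@wp_output b b' m n E sg T H cp (lat m n p E T rp cp) _ _ _ _ _ _ _ _ ok) => //.
- by lia.
- by lia.
- split; try by rd.
  by split=> // i; rd.
- by rd.
- move=> /hok feas lead s8 out8; exists (printed m n E sg T H cp) => //; right.
  have eA := affine_range R Q0 T0W T0w piv E0 eDs sg1 rows lead feas.
  have eS := mixed_range R Q0 T0W T0w piv E0 eDs sg1 rows lead feas.
  split.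
    rewrite eS; exists (affine_map (particular m n T E sg cp H) (directions W T E sg cp H) 0).
    by exists 0 => // i _; rewrite mxE.
  exists (particular m n T E sg cp H), (directions W T E sg cp H); split=> //.
  + rewrite /printed; congr (1 :: _ ++ _).
      rewrite (code_mx_fun (f := fun i _ => entry m n T E sg cp H i.+1 0)).
        by congr (_ :: _ :: flatten _); apply: eq_map => i /=; rewrite cats0.
      by move=> i j; rewrite mxE.
    rewrite (code_mx_fun (f := fun i k => entry m n T E sg cp H i.+1
      (nth 0%N (free_cols n cp) k))); last by move=> i j; rewrite mxE.
    rewrite -(size_free_cols piv Q0 T0W); congr (_ :: _ :: flatten _).
    apply: eq_map => i; congr flatten.
    rewrite -[in LHS](mkseq_nth 0%N (free_cols n cp)) /mkseq -map_comp.
    exact: eq_map.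
  + exact: (particular_mixed R Q0 piv E0 eDs sg1 rows).
  + by rewrite /full_rank (directions_rank R Q0 T0W piv E0 eDs sg1 rows lead) -?minnE; lia.
(* A point of the set would make both tests succeed: consistency of the rows without pivot, and
   leading entry 1. *)
- move=> hn s8 out8; exists [:: 0] => //; left; split=> //.
  apply/seteqP; split=> // y [Ay My]; case/negP: hn; apply/andP; split.
    by apply/hok/(feasible_row Q0 T0W T0w piv E0 eDs sg1); exists y.
  by apply/eqP; apply: (feasible_lead Q0 T0W T0w piv E0 eDs sg1 rows Ay My).
Qed.

End Correctness.

Lemma machine_bits_ge (Z : nat) : (Z <= machine_bits Z)%N.
Proof. by rewrite /machine_bits; lia. Qed.

Theorem proposition1 (R : realType) :
  poly_time code_instance size_instance
    (fun (x : instance) (out : seq int) =>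
      let: Instance m n W w p := x in
      let A : set 'cV[R]_n := affine_space W w in
      let S : set 'cV[R]_n := A `&` mixed R n p in
      let n' := (n - \rank W)%N in
      let p' := reduced_nints p W in
      (S = set0 /\ out = [:: 0]) \/
      (S !=set0 /\
       exists (xbar : 'cV[rat]_n) (M : 'M[rat]_(n, n')),
         [/\ out = 1 :: code_mx xbar ++ code_mx M,
             mixed rat n p xbar,
             full_rank M,
             A = range (affine_map xbar M)
           & S = affine_map xbar M @` mixed R n' p']))
  /\
  (forall (m n : nat) (W : 'M[rat]_(m, n)) (w : 'cV[rat]_m) (p : 'I_n.+1),
    let A : set 'cV[R]_n := affine_space W w in
    let S : set 'cV[R]_n := A `&` mixed R n p in
    let p' := reduced_nints p W in
    S !=set0 ->
    forall (d : 'cV[R]_n) (beta : R),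
      d != 0 ->
      (forall i : 'I_n, (p <= i)%N -> d i 0 = 0) ->
      (forall x, A x -> (d^T *m x) 0 0 = beta) ->
      (p' < p)%N).
Proof.
split; last first.
  move=> m n W w p A S p' [x [Ax _]] d beta d0 dz hd.
  by apply: (reduced_nints_lt _ d0 dz hd); exists x.
have [k hk] := polyb_comp (polyb_ctime reduction) polyb_machine_bits.
(* The program does not depend on [R]: the reals occur only in the specification. *)
exists reduction, k => x; set b := machine_bits (size_instance x).
have b0 : (0 < b)%N by rewrite /b /machine_bits addn_gt0 orbT.
have hb : bounded b (initial (code_instance x)).
  apply: bounded_initial; apply: leq_trans (machine_bits_ge _).
  by rewrite /size_instance leq_addl.
have hx : wp b reduction (fun s => exists2 out, outputs s out &
    let: Instance m n W w p := x in @correct R m n W w p out)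
    (initial (code_instance x)).
  by rewrite /b; case: (x) => m n W w p; apply: wp_reduction.
have [t [s [ex le_t _ [out ho hc]]]] := wp_sound b0 hb hx.
by exists t, s, out; split=> //; apply: leq_trans le_t (hk _).
Qed.
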